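(* Let $f\in M_k(\Gamma_1)$ and $g\in M_\ell(\Gamma_1)$ with $k,\ell\ge0$ integers. Then for every $n\ge0$ the extended Rankin–Cohen bracket $\langle f,g\rangle_n$ is a modular form of weight $k+\ell+2n$ on $\Gamma_1$, and $$\langle f,g\rangle_n=\begin{cases}\dfrac{n!}{(k)_n(\ell)_n}[f,g]_n^{(k,\ell)}&\text{if }k,\ell>0,\\[2mm] \dfrac1{(\ell)_n}\mathcal K_\ell^n(g)&\text{if }f=1,\ \ell>0,\\[2mm] \dfrac1{n!}\sum_{m=0}^n(-1)^m\binom nm^2\omega_m\omega_{n-m}&\text{if }f=g=1.\end{cases}$$
   Context: $\Gamma_1=SL_2(\mathbb Z)$; $M_k(\Gamma_1)$ holomorphic modular forms of weight $k$ (for $k=0$ the constants). $D=\frac1{2\pi i}\frac d{d\tau}$, $q=e^{2\pi i\tau}$, $(x)_n=x(x+1)\cdots(x+n-1)$, $E_2=1-24\sum\frac{nq^n}{1-q^n}$. Modified derivatives: for $h\in M_k(\Gamma_1)$ with $k>0$, $D^{(n)}(h)=D^n(h)/(k)_n$; for the constant function $1$, $D^{(0)}(1)=1$ and $D^{(n)}(1)=\frac{D^{n-1}(E_2)}{12\,(n-1)!}$ for $n\ge1$ (extended linearly to constants). Extended Rankin–Cohen bracket: $\langle f,g\rangle_n=\sum_{i=0}^n(-1)^i\binom ni D^{(i)}(f)D^{(n-i)}(g)$. Rankin–Cohen bracket: $[f,g]_n^{(k,\ell)}=\sum_{i=0}^n(-1)^i\binom{n+k-1}{n-i}\binom{n+\ell-1}{i}D^if\,D^{n-i}g$.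 Kaneko–Koike operator: $\mathcal K_\ell^n(g)=D^ng-\frac{\ell+n-1}{12}[g,E_2]_{n-1}^{(\ell,2)}$ ($n\ge1$), $\mathcal K_\ell^0(g)=g$. The functions $\omega_m$ are defined by the generating series $\sum_{m\ge0}\frac{\omega_m(\tau)}{m!^2}(-X)^m=e^{-XE_2(\tau)/12}\Bigl(1+\frac1{12}\sum_{n\ge1}\frac{D^{n-1}E_2(\tau)}{n!(n-1)!}X^n\Bigr)$.
   Formalization: For n ≥ 1 the Kaneko–Koike operator is taken with an extra sign: D^n g − (−1)^{n−1}((ℓ+n−1)/12)[g,E_2]_{n−1}^{(ℓ,2)}; without it the second case fails for even n, e.g. g=E_4, n=2. *)

(* Defs.v *)
From Stdlib Require Export Reals ZArith.
From Coquelicot Require Export Coquelicot.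

Open Scope C_scope.

Definition Cexp (z : C) : C :=
  (exp (Re z) * cos (Im z), exp (Re z) * sin (Im z))%R.

(** Sum of a convergent complex series, computed on real and imaginary parts;
    it agrees with the value characterised by [is_series]. *)
Definition CSeries (a : nat -> C) : C :=
  (Series (fun n => Re (a n)), Series (fun n => Im (a n))).

(** Functions on the upper half-plane are total functions [C -> C] of which
    only the values at points satisfying [upper_half] are meaningful. *)
Definition upper_half (tau : C) : Prop := (0 < Im tau)%R.

Definition qexp (tau : C) : C := Cexp (2 * PI * Ci * tau).

Definition holomorphic_on_H (f : C -> C) : Prop :=
  forall tau : C, upper_half tau ->
    @ex_derive C_AbsRing C_NormedModule f tau.

Definition weakly_modular (k : nat) (f : C -> C) : Prop :=
  forall a b c d : Z, (a * d - b * c = 1)%Z ->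
  forall tau : C, upper_half tau ->
    f ((IZR a * tau + IZR b) / (IZR c * tau + IZR d))
    = (IZR c * tau + IZR d) ^ k * f tau.

(** Holomorphy at the cusp: the Fourier expansion has no negative powers
    of [q]. *)
Definition holomorphic_at_infinity (f : C -> C) : Prop :=
  exists a : nat -> C, forall tau : C, upper_half tau ->
    @is_series C_AbsRing C_NormedModule (fun n => a n * qexp tau ^ n) (f tau).

Definition modular_form (k : nat) (f : C -> C) : Prop :=
  holomorphic_on_H f /\ weakly_modular k f /\ holomorphic_at_infinity f.

Definition constant_on_H (f : C -> C) : Prop :=
  exists c : C, forall tau : C, upper_half tau -> f tau = c.

(** The space of holomorphic modular forms of weight [k] on SL_2(Z).  In
    weight 0 these are the constants, a convention on which the modified
    derivatives below rely; it is recorded as part of the definition. *)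
Definition M (k : nat) (f : C -> C) : Prop :=
  modular_form k f /\ (k = 0%nat -> constant_on_H f).

Definition D (f : C -> C) : C -> C :=
  fun tau => / (2 * PI * Ci) * C_derive f tau.

Definition Diter (n : nat) (f : C -> C) : C -> C := Nat.iter n D f.

Fixpoint pochhammer (x : C) (n : nat) : C :=
  match n with
  | O => 1
  | S m => pochhammer x m * (x + INR m)
  end.

Definition Cfact (n : nat) : C := INR (fact n).

(** [Binomial.C n m] is [n! / (m! (n - m)!)] with truncated subtraction, so it
    is the binomial coefficient only for [m <= n].  That inequality holds in
    every term of the sums below, provided [0 < k] and [0 < l] in
    [RC_bracket]. *)
Definition binom (n m : nat) : C := Binomial.C n m.

Definition E2 (tau : C) : C :=
  1 - 24 * CSeries (fun m =>
        INR (S m) * qexp tau ^ (S m) / (1 - qexp tau ^ (S m))).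

Definition mod_deriv_one (n : nat) (tau : C) : C :=
  match n with
  | O => 1
  | S m => Diter m E2 tau / (12 * Cfact m)
  end.

(** The modified derivative D^(n) of a form of weight [k].  In weight 0 the
    form [h] is constant, and [h tau] is the scalar by which the modified
    derivative of 1 is multiplied. *)
Definition mod_deriv (k n : nat) (h : C -> C) (tau : C) : C :=
  match k with
  | O => h tau * mod_deriv_one n tau
  | S _ => Diter n h tau / pochhammer (INR k) n
  end.

Definition ext_RC_bracket (k l n : nat) (f g : C -> C) (tau : C) : C :=
  sum_n (fun i => (-1) ^ i * binom n i
                  * mod_deriv k i f tau * mod_deriv l (n - i) g tau) n.

Definition RC_bracket (k l n : nat) (f g : C -> C) (tau : C) : C :=
  sum_n (fun i => (-1) ^ i * binom (n + k - 1) (n - i) * binom (n + l - 1) i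
                  * Diter i f tau * Diter (n - i) g tau) n.

(** The sign [(-1) ^ m], with [m = n - 1], is forced by the convention for
    [RC_bracket], which attaches [(-1) ^ i] to the [i]-th derivative of the
    first argument: the bracket term is that of
    [RC_bracket 2 l m E2 g] = [(-1) ^ m] [RC_bracket l 2 m g E2].  For [n = 2]
    this gives the modular combination
    [D^2 g - (l + 1) / 6 E2 (D g) + l (l + 1) / 12 (D E2) g],
    which without the sign would not be modular. *)
Definition Kaneko_Koike (l n : nat) (g : C -> C) (tau : C) : C :=
  match n with
  | O => g tau
  | S m => Diter n g tau
           - INR (l + n - 1) / 12 * ((-1) ^ m * RC_bracket l 2 m g E2 tau)
  end.

(** Formal power series in [X] over [C] are given by their coefficients. *)
Definition fps_mul (u v : nat -> C) (m : nat) : C :=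
  sum_n (fun j => u j * v (m - j)%nat) m.

(** Coefficients of [exp (a X)]. *)
Definition fps_exp (a : C) (m : nat) : C := a ^ m / Cfact m.

Definition omega_factor (tau : C) (m : nat) : C :=
  match m with
  | O => 1
  | S p => / 12 * (Diter p E2 tau / (Cfact m * Cfact p))
  end.

(** The coefficient of [X ^ m] in the defining generating series is
    [(-1) ^ m * omega m tau / m! ^ 2]. *)
Definition omega (m : nat) (tau : C) : C :=
  (-1) ^ m * Cfact m ^ 2
  * fps_mul (fps_exp (- E2 tau / 12)) (omega_factor tau) m.

(* Main.v *)
Require Import Defs.
From Stdlib Require Import Lra Lia Psatz.

(** Every form has a q-expansion valid on the whole half-plane, so the bracket
    has one as well, and only its behaviour under tau -> -1/tau is at stake.

    Quasi-modularity of E_2.  With csc2 z = pi^2 / sin^2 (pi z) one has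
    E_2 tau = 1 + 6/pi^2 sum_(m >= 1) csc2 (m tau), and csc2 z is the sum of
    1/(z + n)^2 over the integers n.  The law of E_2 thus measures the failure
    of sum_m sum_n 1/(m tau + n)^2 to commute.  Comparing 1/z^2 with
    1/(z^2 - 1), which telescopes in n, leaves an absolutely convergent double
    series; the telescoped part is a cotangent series in m, evaluated through
    the partial fractions of pi cot (pi z) as Im z -> infinity.

    The bracket.  Put phi_n = D^(n) f / n!.  Then
    D phi_n = (n + 1) (k + n) phi_(n + 1), also in weight 0, whence by induction
    the series Phi_f (tau, X) = sum phi_n X^n satisfies
    Phi_f (-1/tau, X/tau^2) = tau^k exp (X / (2 pi i tau)) Phi_f (tau, X)
    (for k = 0 this is where E_2 enters).  As <f, g>_n / n! is the coefficient
    of X^n in Phi_f (-X) Phi_g (X), the exponential factors cancel.  The same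
    cancellation, with the factor exp (- X E_2 / 12), gives the formula for
    <1, 1>_n. *)

(** * Limits and series of complex numbers *)

(** The partial fractions of [csc2] come from its duplication formula. Iterated, it writes csc2 z as
    M^-2 times a sum of M values csc2 (w_k), with M a power of 2 and the w_k in a vertical strip
    around 0 on which csc2 w - 1/w^2 is bounded; replacing each value by 1/w_k^2 therefore costs
    O(1/M). Termwise differentiation then identifies the cotangent series up to a constant, which is
    fixed at z = 1/2, and csc2 (1/2) gives the sum of 1/n^2. In the comparison with 1/(z^2 - 1),
    every row of the telescoping series sums to 0, but its boundary terms, added over m, tend to a
    nonzero multiple of 1/tau: this is the whole anomaly of E_2, and it exists because cot has a
    nonzero limit at i infinity. No Cauchy theory enters: functions with a q-expansion are
    differentiated term by term, and a function with zero derivative is compared at the ends of a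
    segment. *)

Definition clim (u : nat -> C) (l : C) : Prop :=
  is_lim_seq (fun n => Cmod (u n - l)) 0.

Lemma clim_le (u : nat -> C) (l : C) (e : nat -> R) :
  eventually (fun n => (Cmod (u n - l) <= e n)%R) -> is_lim_seq e 0 -> clim u l.
Proof.
  intros [N HN] He.
  apply is_lim_seq_le_le_loc with (fun _ => 0%R) e; auto.
  - exists N; intros n Hn; split; [apply Cmod_ge_0 | auto].
  - apply is_lim_seq_const.
Qed.

Lemma clim_ext_loc (u v : nat -> C) (l : C) :
  eventually (fun n => u n = v n) -> clim u l -> clim v l.
Proof.
  intros [N HN] H; apply clim_le with (2 := H).
  exists N; intros n Hn; rewrite HN by auto; apply Rle_refl.
Qed.

Lemma clim_ext (u v : nat -> C) (l : C) :
  (forall n, u n = v n) -> clim u l -> clim v l.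
Proof. intros H; apply clim_ext_loc; exists 0%nat; auto. Qed.

Lemma clim_const (c : C) : clim (fun _ => c) c.
Proof.
  apply clim_le with (fun _ => 0%R); [|apply is_lim_seq_const].
  exists 0%nat; intros n _.
  replace (c - c) with (RtoC 0) by ring; rewrite Cmod_0; apply Rle_refl.
Qed.

Lemma is_lim_seq_0_plus (u v : nat -> R) :
  is_lim_seq u 0 -> is_lim_seq v 0 -> is_lim_seq (fun n => (u n + v n)%R) 0.
Proof.
  intros Hu Hv; replace 0%R with (0 + 0)%R by ring.
  apply is_lim_seq_plus'; auto.
Qed.

Lemma is_lim_seq_0_scal (u : nat -> R) (c : R) :
  is_lim_seq u 0 -> is_lim_seq (fun n => (c * u n)%R) 0.
Proof.
  intros Hu; replace 0%R with (c * 0)%R by ring.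
  apply is_lim_seq_mult'; auto; apply is_lim_seq_const.
Qed.

Lemma clim_plus (u v : nat -> C) (a b : C) :
  clim u a -> clim v b -> clim (fun n => u n + v n) (a + b).
Proof.
  intros Hu Hv.
  apply clim_le with (2 := is_lim_seq_0_plus _ _ Hu Hv).
  exists 0%nat; intros n _.
  replace (u n + v n - (a + b)) with ((u n - a) + (v n - b)) by ring.
  apply Cmod_triangle.
Qed.

Lemma clim_scal (u : nat -> C) (c a : C) :
  clim u a -> clim (fun n => c * u n) (c * a).
Proof.
  intros Hu.
  apply clim_le with (2 := is_lim_seq_0_scal _ (Cmod c) Hu).
  exists 0%nat; intros n _.
  replace (c * u n - c * a) with (c * (u n - a)) by ring.
  rewrite Cmod_mult; apply Rle_refl.
Qed.

Lemma clim_opp (u : nat -> C) (a : C) :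
  clim u a -> clim (fun n => - u n) (- a).
Proof.
  intros H; apply (clim_scal _ (-1)) in H.
  replace (-1 * a) with (- a) in H by ring.
  apply clim_ext with (2 := H); intros; ring.
Qed.

Lemma clim_minus (u v : nat -> C) (a b : C) :
  clim u a -> clim v b -> clim (fun n => u n - v n) (a - b).
Proof. intros Hu Hv; apply clim_plus; [|apply clim_opp]; auto. Qed.

Lemma clim_unique (u : nat -> C) (a b : C) : clim u a -> clim u b -> a = b.
Proof.
  intros Ha Hb.
  assert (H : clim (fun _ => 0) (a - b)).
  { apply clim_ext with (fun n => u n - u n); [intros; ring | apply clim_minus; auto]. }
  unfold clim in H.
  assert (E : Finite (Cmod (0 - (a - b))) = Finite 0).
  { rewrite <- (is_lim_seq_unique _ _ H); symmetry.
    apply is_lim_seq_unique, is_lim_seq_const. }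
  injection E; intros E'; apply Cmod_eq_0 in E'.
  replace a with (b - (0 - (a - b))) by ring; rewrite E'; ring.
Qed.

Lemma clim_comp (u : nat -> C) (l : C) (f : nat -> nat) :
  filterlim f eventually eventually -> clim u l -> clim (fun n => u (f n)) l.
Proof. intros Hf H; apply (is_lim_seq_subseq _ _ f Hf H). Qed.

Lemma clim_incr_1 (u : nat -> C) (l : C) :
  clim (fun n => u (S n)) l <-> clim u l.
Proof.
  unfold clim; symmetry; apply (is_lim_seq_incr_1 (fun n => Cmod (u n - l)) 0).
Qed.

Lemma clim_spec (u : nat -> C) (l : C) :
  clim u l <->
  forall eps : R, (0 < eps)%R -> eventually (fun n => (Cmod (u n - l) < eps)%R).
Proof.
  unfold clim; rewrite <- is_lim_seq_spec; unfold is_lim_seq'; split; intros H.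
  - intros eps He; destruct (H (mkposreal eps He)) as [N HN].
    exists N; intros n Hn; specialize (HN n Hn); simpl in HN.
    rewrite Rminus_0_r, Rabs_pos_eq in HN; auto; apply Cmod_ge_0.
  - intros eps; destruct (H eps (cond_pos eps)) as [N HN].
    exists N; intros n Hn; rewrite Rminus_0_r, Rabs_pos_eq; auto; apply Cmod_ge_0.
Qed.

Lemma im_le_Cmod (c : C) : (Rabs (Im c) <= Cmod c)%R.
Proof.
  eapply Rle_trans; [|apply Rmax_Cmod]; apply Rmax_r.
Qed.

Lemma Cmod_le_parts (c : C) : (Cmod c <= Rabs (Re c) + Rabs (Im c))%R.
Proof.
  destruct c as [x y]; simpl.
  replace (x, y) with (RtoC x + Ci * RtoC y)
    by (unfold Cplus, Cmult, Ci, RtoC; simpl; f_equal; ring).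
  eapply Rle_trans; [apply Cmod_triangle|].
  rewrite Cmod_mult, Cmod_Ci, !Cmod_R; lra.
Qed.

Lemma clim_Re (u : nat -> C) (l : C) :
  clim u l -> is_lim_seq (fun n => Re (u n)) (Re l).
Proof.
  intros H; apply is_lim_seq_spec; intros eps.
  destruct (proj1 (clim_spec _ _) H eps (cond_pos eps)) as [N HN].
  exists N; intros n Hn; eapply Rle_lt_trans; [|apply (HN n Hn)].
  apply (re_le_Cmod (u n - l)).
Qed.

Lemma clim_Im (u : nat -> C) (l : C) :
  clim u l -> is_lim_seq (fun n => Im (u n)) (Im l).
Proof.
  intros H; apply is_lim_seq_spec; intros eps.
  destruct (proj1 (clim_spec _ _) H eps (cond_pos eps)) as [N HN].
  exists N; intros n Hn; eapply Rle_lt_trans; [|apply (HN n Hn)].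
  apply (im_le_Cmod (u n - l)).
Qed.

Lemma clim_parts (u : nat -> C) (l : C) :
  is_lim_seq (fun n => Re (u n)) (Re l) -> is_lim_seq (fun n => Im (u n)) (Im l) ->
  clim u l.
Proof.
  intros Hr Hi; apply clim_spec; intros eps He.
  apply is_lim_seq_spec in Hr; apply is_lim_seq_spec in Hi.
  assert (He2 : (0 < eps / 2)%R) by lra.
  destruct (Hr (mkposreal _ He2)) as [N HN], (Hi (mkposreal _ He2)) as [N' HN'].
  exists (N + N')%nat; intros n Hn.
  specialize (HN n ltac:(lia)); specialize (HN' n ltac:(lia)); simpl in HN, HN'.
  eapply Rle_lt_trans; [apply Cmod_le_parts|]; simpl.
  unfold Rminus in *; unfold Re, Im in *; lra.
Qed.

Lemma clim_Cmod_le (u : nat -> C) (l : C) (B : nat -> R) (b : R) :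
  clim u l -> eventually (fun n => (Cmod (u n) <= B n)%R) -> is_lim_seq B b ->
  (Cmod l <= b)%R.
Proof.
  intros H Hu HB.
  assert (HL : is_lim_seq (fun n => (B n + Cmod (u n - l))%R) (b + 0)%R).
  { apply is_lim_seq_plus'; auto. }
  rewrite Rplus_0_r in HL.
  refine (is_lim_seq_le_loc (fun _ => Cmod l) _ (Cmod l) b _ _ HL).
  - destruct Hu as [N HN]; exists N; intros n Hn.
    replace l with (u n + - (u n - l)) at 1 by ring.
    eapply Rle_trans; [apply Cmod_triangle|]; rewrite Cmod_opp.
    apply Rplus_le_compat_r; auto.
  - apply is_lim_seq_const.
Qed.

Lemma clim_mult (u v : nat -> C) (a b : C) :
  clim u a -> clim v b -> clim (fun n => u n * v n) (a * b).
Proof.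
  intros Hu Hv.
  pose proof (clim_Re _ _ Hu); pose proof (clim_Im _ _ Hu).
  pose proof (clim_Re _ _ Hv); pose proof (clim_Im _ _ Hv).
  apply clim_parts; simpl.
  - apply is_lim_seq_minus'; apply is_lim_seq_mult'; auto.
  - apply is_lim_seq_plus'; apply is_lim_seq_mult'; auto.
Qed.

Lemma clim_Cmod (u : nat -> C) (l : C) :
  clim u l -> is_lim_seq (fun n => Cmod (u n)) (Cmod l).
Proof.
  intros H; apply is_lim_seq_spec; intros eps.
  destruct (proj1 (clim_spec _ _) H eps (cond_pos eps)) as [N HN].
  exists N; intros n Hn; eapply Rle_lt_trans; [|apply (HN n Hn)].
  assert (Cmod (u n) <= Cmod (u n - l) + Cmod l)%R.
  { replace (u n) with (u n - l + l) at 1 by ring; apply Cmod_triangle. }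
  assert (Cmod l <= Cmod (u n - l) + Cmod (u n))%R.
  { replace l with (-(u n - l) + u n) at 1 by ring.
    rewrite <- (Cmod_opp (u n - l)); apply Cmod_triangle. }
  apply Rabs_le; lra.
Qed.

(** * Partial sums, dominated series and Cauchy products *)

(** Unlike [sum_n], which includes the term of index n, this takes the first n terms, so that
    inductions can start from the empty sum. *)
Fixpoint psum (a : nat -> C) (n : nat) : C :=
  match n with O => 0 | S m => psum a m + a m end.

Fixpoint rpsum (a : nat -> R) (n : nat) : R :=
  match n with O => 0%R | S m => (rpsum a m + a m)%R end.

Lemma sum_n_psum (a : nat -> C) (n : nat) : sum_n a n = psum a (S n).
Proof.
  induction n as [|n IH].
  - rewrite sum_O; simpl; ring.
  - rewrite sum_Sn, IH; reflexivity.
Qed.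

Lemma sum_n_rpsum (a : nat -> R) (n : nat) : sum_n a n = rpsum a (S n).
Proof.
  induction n as [|n IH].
  - rewrite sum_O; simpl; ring.
  - rewrite sum_Sn, IH; reflexivity.
Qed.

Lemma psum_ext (a b : nat -> C) (n : nat) :
  (forall i, (i < n)%nat -> a i = b i) -> psum a n = psum b n.
Proof.
  induction n as [|n IH]; intros H; simpl; auto.
  rewrite IH, H; auto; intros; apply H; lia.
Qed.

Lemma psum_plus (a b : nat -> C) (n : nat) :
  psum (fun i => a i + b i) n = psum a n + psum b n.
Proof. induction n as [|n IH]; simpl; [|rewrite IH]; ring. Qed.

Lemma psum_scal (c : C) (a : nat -> C) (n : nat) :
  psum (fun i => c * a i) n = c * psum a n.
Proof. induction n as [|n IH]; simpl; [|rewrite IH]; ring. Qed.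

Lemma psum_minus (a b : nat -> C) (n : nat) :
  psum (fun i => a i - b i) n = psum a n - psum b n.
Proof. induction n as [|n IH]; simpl; [|rewrite IH]; ring. Qed.

Lemma psum_zero (n : nat) : psum (fun _ => 0) n = 0.
Proof. induction n as [|n IH]; simpl; [|rewrite IH]; ring. Qed.

Lemma psum_first (a : nat -> C) (n : nat) :
  psum a (S n) = a O + psum (fun i => a (S i)) n.
Proof.
  induction n as [|n IH]; [simpl; ring|].
  change (psum a (S (S n))) with (psum a (S n) + a (S n)).
  rewrite IH; simpl; ring.
Qed.

Lemma psum_app (a : nat -> C) (n m : nat) :
  psum a (n + m) = psum a n + psum (fun i => a (n + i)%nat) m.
Proof.
  induction m as [|m IH]; [rewrite Nat.add_0_r; simpl; ring|].
  rewrite Nat.add_succ_r; simpl; rewrite IH; ring.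
Qed.

Lemma psum_rev (a : nat -> C) (n : nat) :
  psum a n = psum (fun i => a (n - 1 - i)%nat) n.
Proof.
  revert a; induction n as [|n IH]; intros a; auto.
  rewrite psum_first, IH; simpl.
  rewrite Cplus_comm; f_equal; [|f_equal; lia].
  apply psum_ext; intros; f_equal; lia.
Qed.

Lemma psum_Cmod (a : nat -> C) (B : nat -> R) (n : nat) :
  (forall i, (Cmod (a i) <= B i)%R) -> (Cmod (psum a n) <= rpsum B n)%R.
Proof.
  intros H; induction n as [|n IH]; simpl; [rewrite Cmod_0; apply Rle_refl|].
  eapply Rle_trans; [apply Cmod_triangle|]; apply Rplus_le_compat; auto.
Qed.

Lemma rpsum_lim (B : nat -> R) :
  ex_series B -> is_lim_seq (rpsum B) (Series B).
Proof.
  intros H; apply is_lim_seq_incr_1.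
  apply is_lim_seq_ext with (sum_n B); [intros; apply sum_n_rpsum|].
  apply (Series_correct _ H).
Qed.

Lemma rpsum_incr (B : nat -> R) (n m : nat) :
  (forall i, (0 <= B i)%R) -> (n <= m)%nat -> (rpsum B n <= rpsum B m)%R.
Proof. intros H Hn; induction Hn; simpl; [lra | specialize (H m); lra]. Qed.

Lemma rpsum_le_Series (B : nat -> R) (n : nat) :
  ex_series B -> (forall i, (0 <= B i)%R) -> (rpsum B n <= Series B)%R.
Proof.
  intros HB H.
  refine (is_lim_seq_le_loc (fun _ => rpsum B n) (rpsum B)
    (rpsum B n) (Series B) _ _ (rpsum_lim _ HB)).
  - exists n; intros m Hm; apply rpsum_incr; auto.
  - apply is_lim_seq_const.
Qed.

Definition csum (a : nat -> C) (l : C) : Prop := clim (psum a) l.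

Lemma csum_unique (a : nat -> C) (l m : C) : csum a l -> csum a m -> l = m.
Proof. apply clim_unique. Qed.

Lemma csum_ext (a b : nat -> C) (l : C) :
  (forall n, a n = b n) -> csum a l -> csum b l.
Proof. intros H; apply clim_ext; intros n; apply psum_ext; auto. Qed.

Lemma csum_plus (a b : nat -> C) (l m : C) :
  csum a l -> csum b m -> csum (fun n => a n + b n) (l + m).
Proof.
  intros H1 H2; apply clim_ext with (2 := clim_plus _ _ _ _ H1 H2).
  intros; symmetry; apply psum_plus.
Qed.

Lemma csum_minus (a b : nat -> C) (l m : C) :
  csum a l -> csum b m -> csum (fun n => a n - b n) (l - m).
Proof.
  intros H1 H2; apply clim_ext with (2 := clim_minus _ _ _ _ H1 H2).
  intros; symmetry; apply psum_minus.
Qed.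

Lemma csum_scal (c : C) (a : nat -> C) (l : C) :
  csum a l -> csum (fun n => c * a n) (c * l).
Proof.
  intros H1; apply clim_ext with (2 := clim_scal _ c _ H1).
  intros; symmetry; apply psum_scal.
Qed.

Lemma csum_first (a : nat -> C) (l : C) :
  csum (fun n => a (S n)) l <-> csum a (a O + l).
Proof.
  unfold csum; split; intros H.
  - apply clim_incr_1.
    apply clim_ext with (fun n => a O + psum (fun i => a (S i)) n).
    + intros; symmetry; apply psum_first.
    + apply clim_plus; auto using clim_const.
  - apply clim_incr_1 in H.
    apply clim_ext with (fun n => psum a (S n) - a O).
    + intros; rewrite psum_first; ring.
    + replace l with (a O + l - a O) by ring.
      apply clim_minus; auto using clim_const.
Qed.

Lemma csum_0 : csum (fun _ => 0) 0.
Proof.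
  apply clim_ext with (fun _ => 0); [intros; now rewrite psum_zero | apply clim_const].
Qed.

Lemma csum_psum (c : nat -> nat -> C) (k : nat -> C) (N : nat) :
  (forall j, csum (fun i => c i j) (k j)) ->
  csum (fun i => psum (c i) N) (psum k N).
Proof.
  intros H; induction N as [|N IH]; simpl; [apply csum_0 | apply csum_plus; auto].
Qed.

Lemma ex_csum (a : nat -> C) (B : nat -> R) :
  (forall n, (Cmod (a n) <= B n)%R) -> ex_series B -> exists l, csum a l.
Proof.
  intros H HB.
  assert (Hr : ex_series (fun n => Re (a n))).
  { apply (@ex_series_le R_AbsRing R_CompleteNormedModule _ B); auto; intros n.
    eapply Rle_trans; [apply (re_le_Cmod (a n)) | auto]. }
  assert (Hi : ex_series (fun n => Im (a n))).
  { apply (@ex_series_le R_AbsRing R_CompleteNormedModule _ B); auto; intros n.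
    eapply Rle_trans; [apply (im_le_Cmod (a n)) | auto]. }
  exists (Series (fun n => Re (a n)), Series (fun n => Im (a n))).
  apply clim_parts; simpl.
  - apply is_lim_seq_ext with (rpsum (fun n => Re (a n))); [|apply rpsum_lim; auto].
    intros n; induction n as [|n IH]; simpl; auto; rewrite IH; auto.
  - apply is_lim_seq_ext with (rpsum (fun n => Im (a n))); [|apply rpsum_lim; auto].
    intros n; induction n as [|n IH]; simpl; auto; rewrite IH; auto.
Qed.

Lemma csum_Cmod_le (a : nat -> C) (l : C) (B : nat -> R) :
  csum a l -> (forall n, (Cmod (a n) <= B n)%R) -> ex_series B ->
  (Cmod l <= Series B)%R.
Proof.
  intros Ha H HB; apply clim_Cmod_le with (psum a) (rpsum B); auto.
  - exists 0%nat; intros n _; apply psum_Cmod; auto.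
  - apply rpsum_lim; auto.
Qed.

Lemma csum_tail_le (a : nat -> C) (l : C) (B : nat -> R) (K : nat) :
  csum a l -> (forall n, (Cmod (a n) <= B n)%R) -> ex_series B ->
  (Cmod (l - psum a K) <= Series B - rpsum B K)%R.
Proof.
  intros Ha H HB.
  apply clim_Cmod_le with (fun n => psum a n - psum a K) (fun n => (rpsum B n - rpsum B K)%R).
  - apply clim_minus; auto using clim_const.
  - exists K; intros n Hn; induction Hn as [|n Hn IH]; simpl.
    + replace (psum a K - psum a K) with (RtoC 0) by ring; rewrite Cmod_0; lra.
    + replace (psum a n + a n - psum a K) with (psum a n - psum a K + a n) by ring.
      eapply Rle_trans; [apply Cmod_triangle|]; specialize (H n); lra.
  - apply is_lim_seq_minus'; [apply rpsum_lim; auto | apply is_lim_seq_const].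
Qed.

(** Dominated convergence for series: cut at an index K where the tail of the majorant is below
    eps/3, and let the finitely many remaining terms converge. *)
Lemma tannery (u : nat -> nat -> C) (U : nat -> C) (B : nat -> R) (s : nat -> C) (l : C) :
  ex_series B ->
  (forall N i, (Cmod (u N i) <= B i)%R) ->
  (forall i, clim (fun N => u N i) (U i)) ->
  (forall N, csum (u N) (s N)) -> csum U l -> clim s l.
Proof.
  intros HB Hu HU Hs Hl.
  assert (HUB : forall i, (Cmod (U i) <= B i)%R).
  { intros i; apply clim_Cmod_le with (fun N => u N i) (fun _ => B i); auto.
    - exists 0%nat; auto.
    - apply is_lim_seq_const. }
  apply clim_spec; intros eps He.
  assert (He3 : (0 < eps / 3)%R) by lra.
  pose proof (proj2 (is_lim_seq_spec _ _) (rpsum_lim B HB) (mkposreal _ He3)) as [K HK].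
  specialize (HK K ltac:(lia)); simpl in HK; apply Rabs_def2 in HK.
  assert (Hf : clim (fun N => psum (u N) K) (psum U K)).
  { clear -HU; induction K as [|K IH]; simpl; [apply clim_const | apply clim_plus; auto]. }
  destruct (proj1 (clim_spec _ _) Hf (eps/3)%R He3) as [N HN].
  exists N; intros n Hn; specialize (HN n Hn).
  pose proof (csum_tail_le _ _ _ K (Hs n) (Hu n) HB).
  pose proof (csum_tail_le _ _ _ K Hl HUB HB).
  replace (s n - l) with
    ((s n - psum (u n) K) + ((psum (u n) K - psum U K) + - (l - psum U K))) by ring.
  eapply Rle_lt_trans; [apply Cmod_triangle|].
  eapply Rle_lt_trans; [apply Rplus_le_compat_l, Cmod_triangle|].
  rewrite Cmod_opp; lra.
Qed.

(** Tannery's theorem for the partial sums of the rows: for each N their total over i is a finite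
    sum of columns. The majorant has to bound these row partial sums. *)
Lemma csum_swap (c : nat -> nat -> C) (r k : nat -> C) (B : nat -> R) (l : C) :
  ex_series B ->
  (forall i N, (Cmod (psum (c i) N) <= B i)%R) ->
  (forall i, csum (c i) (r i)) ->
  (forall j, csum (fun i => c i j) (k j)) ->
  csum r l -> csum k l.
Proof.
  intros HB Hc Hr Hk Hl.
  apply (tannery (fun N i => psum (c i) N) r B); auto.
  intros N; apply csum_psum; auto.
Qed.

Lemma csum_is_series (a : nat -> C) (l : C) :
  csum a l <-> @is_series C_AbsRing C_NormedModule a l.
Proof.
  unfold csum; rewrite <- clim_incr_1.
  split.
  - intros H; apply (filterlim_locally (U := C_UniformSpace) (sum_n a) l); intros eps.
    destruct (proj1 (clim_spec _ _) H eps (cond_pos eps)) as [N HN].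
    exists N; intros n Hn; rewrite sum_n_psum.
    apply C_NormedModule_mixin_compat1; apply (HN n Hn).
  - intros H; pose proof (proj1 (filterlim_locally (U := C_UniformSpace) (sum_n a) l) H) as H'.
    clear H; rename H' into H; apply clim_spec; intros eps He.
    (* Balls of the uniform structure and balls for [Cmod] agree only up to a factor sqrt 2. *)
    assert (Hs : (0 < eps / sqrt 2)%R).
    { apply Rdiv_lt_0_compat; auto; apply sqrt_lt_R0; lra. }
    destruct (H (mkposreal _ Hs)) as [N HN]; exists N; intros n Hn.
    specialize (HN n Hn); rewrite sum_n_psum in HN.
    apply C_NormedModule_mixin_compat2 in HN; simpl in HN.
    replace (sqrt 2 * (eps / sqrt 2))%R with eps in HN; auto.
    field; apply Rgt_not_eq, sqrt_lt_R0; lra.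
Qed.

Lemma csum_CSeries (a : nat -> C) (l : C) : csum a l -> CSeries a = l.
Proof.
  intros H; unfold CSeries.
  assert (E : forall n, rpsum (fun i => Re (a i)) n = Re (psum a n) /\
                        rpsum (fun i => Im (a i)) n = Im (psum a n)).
  { intros n; induction n as [|n [IH1 IH2]]; simpl; auto; rewrite IH1, IH2; auto. }
  rewrite (surjective_pairing l); f_equal; apply is_series_unique.
  - apply clim_incr_1 in H; apply clim_Re in H.
    apply is_lim_seq_ext with (2 := H); intros n; rewrite <- (proj1 (E _)).
    symmetry; apply (sum_n_rpsum (fun i => Re (a i))).
  - apply clim_incr_1 in H; apply clim_Im in H.
    apply is_lim_seq_ext with (2 := H); intros n; rewrite <- (proj2 (E _)).
    symmetry; apply (sum_n_rpsum (fun i => Im (a i))).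
Qed.

Lemma csum_parts (a : nat -> C) (l : C) :
  is_series (fun n => Re (a n)) (Re l) -> is_series (fun n => Im (a n)) (Im l) ->
  csum a l.
Proof.
  intros Hr Hi.
  assert (E : forall n, rpsum (fun i => Re (a i)) n = Re (psum a n) /\
                        rpsum (fun i => Im (a i)) n = Im (psum a n)).
  { intros n; induction n as [|n [IH1 IH2]]; simpl; auto; rewrite IH1, IH2; auto. }
  apply clim_incr_1, clim_parts.
  - apply is_lim_seq_ext with (2 := Hr); intros n; rewrite <- (proj1 (E _)).
    apply (sum_n_rpsum (fun i => Re (a i))).
  - apply is_lim_seq_ext with (2 := Hi); intros n; rewrite <- (proj2 (E _)).
    apply (sum_n_rpsum (fun i => Im (a i))).
Qed.

Lemma csum_Re (a : nat -> C) (l : C) :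
  csum a l -> is_series (fun n => Re (a n)) (Re l).
Proof.
  intros H; apply clim_incr_1 in H; apply clim_Re in H.
  apply is_lim_seq_ext with (2 := H); intros n; rewrite sum_n_rpsum.
  generalize (S n); intros m; induction m as [|m IH]; simpl; auto; rewrite <- IH; auto.
Qed.

Lemma csum_Im (a : nat -> C) (l : C) :
  csum a l -> is_series (fun n => Im (a n)) (Im l).
Proof.
  intros H; apply clim_incr_1 in H; apply clim_Im in H.
  apply is_lim_seq_ext with (2 := H); intros n; rewrite sum_n_rpsum.
  generalize (S n); intros m; induction m as [|m IH]; simpl; auto; rewrite <- IH; auto.
Qed.

(** Real and imaginary parts converge absolutely, so the complex Cauchy product splits into four
    real ones. *)
Lemma csum_mult (a b : nat -> C) (la lb : C) (A B : nat -> R) :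
  (forall n, (Cmod (a n) <= A n)%R) -> (forall n, (Cmod (b n) <= B n)%R) ->
  ex_series A -> ex_series B ->
  csum a la -> csum b lb -> csum (fps_mul a b) (la * lb).
Proof.
  intros Ha Hb HA HB Hla Hlb.
  assert (D : forall (u : nat -> R) (U : nat -> C) (V : nat -> R), ex_series V ->
            (forall n, (Rabs (u n) <= Cmod (U n))%R) ->
            (forall n, (Cmod (U n) <= V n)%R) -> ex_series (fun n => Rabs (u n))).
  { intros u U V HV H1 H2; apply (@ex_series_le R_AbsRing R_CompleteNormedModule _ V); auto; intros n.
    unfold norm; simpl; unfold abs; simpl; rewrite Rabs_Rabsolu; eauto using Rle_trans. }
  pose proof (D _ a A HA (fun n => re_le_Cmod (a n)) Ha) as RA.
  pose proof (D _ a A HA (fun n => im_le_Cmod (a n)) Ha) as IA.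
  pose proof (D _ b B HB (fun n => re_le_Cmod (b n)) Hb) as RB.
  pose proof (D _ b B HB (fun n => im_le_Cmod (b n)) Hb) as IB.
  pose proof (csum_Re _ _ Hla) as SRA; pose proof (csum_Im _ _ Hla) as SIA.
  pose proof (csum_Re _ _ Hlb) as SRB; pose proof (csum_Im _ _ Hlb) as SIB.
  pose proof (is_series_mult _ _ _ _ SRA SRB RA RB) as S1.
  pose proof (is_series_mult _ _ _ _ SIA SIB IA IB) as S2.
  pose proof (is_series_mult _ _ _ _ SRA SIB RA IB) as S3.
  pose proof (is_series_mult _ _ _ _ SIA SRB IA RB) as S4.
  assert (E : forall n, fps_mul a b n =
    ((sum_f_R0 (fun k => Re (a k) * Re (b (n - k)%nat)) n
      - sum_f_R0 (fun k => Im (a k) * Im (b (n - k)%nat)) n)%R,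
     (sum_f_R0 (fun k => Re (a k) * Im (b (n - k)%nat)) n
      + sum_f_R0 (fun k => Im (a k) * Re (b (n - k)%nat)) n)%R)).
  { intros n; unfold fps_mul.
    assert (G : forall (x y : nat -> C) m, sum_n (fun j => x j * y j) m =
      ((sum_f_R0 (fun k => Re (x k) * Re (y k)) m
        - sum_f_R0 (fun k => Im (x k) * Im (y k)) m)%R,
       (sum_f_R0 (fun k => Re (x k) * Im (y k)) m
        + sum_f_R0 (fun k => Im (x k) * Re (y k)) m)%R)).
    { intros x y m; induction m as [|m IH].
      - rewrite sum_O; reflexivity.
      - rewrite sum_Sn, IH; unfold plus; simpl; unfold Cplus; simpl.
        f_equal; unfold Re, Im; ring. }
    apply (G a (fun k => b (n - k)%nat)). }
  apply csum_parts.
  - apply is_series_ext with (2 := is_series_minus _ _ _ _ S1 S2).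
    intros n; rewrite E; reflexivity.
  - apply is_series_ext with (2 := is_series_plus _ _ _ _ S3 S4).
    intros n; rewrite E; reflexivity.
Qed.

(** * Complex derivatives and the exponential *)

(** Differentiability written with [Cmod] alone, so that remainder estimates apply directly;
    [cderiv_is_derive] returns to the derivative used in [D]. *)
Definition cderiv (f : C -> C) (z l : C) : Prop :=
  forall eps : R, (0 < eps)%R -> exists d : R, (0 < d)%R /\
    forall w : C, (Cmod (w - z) < d)%R ->
      (Cmod (f w - f z - l * (w - z)) <= eps * Cmod (w - z))%R.

Lemma cderiv_is_derive (f : C -> C) (z l : C) :
  cderiv f z l -> @is_derive C_AbsRing C_NormedModule f z l.
Proof.
  intros H; split.
  - apply is_linear_scal_l.
  - intros x Hx eps.
    pose proof (@is_filter_lim_locally_unique C_AbsRing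
      (AbsRing_NormedModule C_AbsRing) z x Hx) as E; subst x; clear Hx.
    destruct (H eps (cond_pos eps)) as [d [Hd Hw]].
    exists (mkposreal d Hd); intros y Hy.
    assert (Hy' : (Cmod (y - z) < d)%R) by exact Hy.
    specialize (Hw y Hy').
    change (Cmod (f y + - f z + - ((y + - z) * l)) <= eps * Cmod (y - z))%R.
    replace (f y + - f z + - ((y + - z) * l)) with (f y - f z - l * (y - z)) by ring.
    exact Hw.
Qed.

Lemma cderiv_C_derive (f : C -> C) (z l : C) : cderiv f z l -> C_derive f z = l.
Proof. intros H; apply is_C_derive_unique, cderiv_is_derive, H. Qed.

Lemma cderiv_unique (f : C -> C) (z l m : C) : cderiv f z l -> cderiv f z m -> l = m.
Proof.
  intros H1 H2; rewrite <- (cderiv_C_derive _ _ _ H1); apply cderiv_C_derive, H2.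
Qed.

Lemma cderiv_ext_loc (f g : C -> C) (z l : C) (d : R) :
  (0 < d)%R -> (forall w, (Cmod (w - z) < d)%R -> f w = g w) ->
  cderiv f z l -> cderiv g z l.
Proof.
  intros Hd E H eps He; destruct (H eps He) as [d' [Hd' Hw]].
  exists (Rmin d d'); split; [apply Rmin_pos; auto|]; intros w Hwz.
  rewrite <- !E.
  - apply Hw; eapply Rlt_le_trans; [apply Hwz | apply Rmin_r].
  - replace (z - z) with (RtoC 0) by ring; rewrite Cmod_0; auto.
  - eapply Rlt_le_trans; [apply Hwz | apply Rmin_l].
Qed.

Lemma cderiv_ext (f g : C -> C) (z l : C) :
  (forall w, f w = g w) -> cderiv f z l -> cderiv g z l.
Proof. intros E; apply cderiv_ext_loc with 1%R; auto; lra. Qed.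

Lemma cderiv_quad (f : C -> C) (z l : C) (d K : R) :
  (0 < d)%R ->
  (forall w, (Cmod (w - z) < d)%R ->
     (Cmod (f w - f z - l * (w - z)) <= K * Cmod (w - z) ^ 2)%R) ->
  cderiv f z l.
Proof.
  intros Hd H eps He.
  (* Passing to max (K, 1) makes eps / K a positive radius whatever the sign of K. *)
  assert (HK : (0 < Rmax K 1)%R) by (eapply Rlt_le_trans; [apply Rlt_0_1 | apply Rmax_r]).
  exists (Rmin d (eps / Rmax K 1)); split.
  { apply Rmin_pos; auto; apply Rdiv_lt_0_compat; auto. }
  intros w Hw; eapply Rle_trans.
  { apply H; eapply Rlt_le_trans; [apply Hw | apply Rmin_l]. }
  assert (Hw2 : (Cmod (w - z) < eps / Rmax K 1)%R)
    by (eapply Rlt_le_trans; [apply Hw | apply Rmin_r]).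
  apply (Rmult_lt_compat_l (Rmax K 1)) in Hw2; auto.
  replace (Rmax K 1 * (eps / Rmax K 1))%R with eps in Hw2 by (field; lra).
  pose proof (Rmax_l K 1); pose proof (Cmod_ge_0 (w - z)).
  simpl; rewrite Rmult_1_r, <- Rmult_assoc.
  apply Rmult_le_compat_r; auto; nra.
Qed.

Lemma cderiv_const (c z : C) : cderiv (fun _ => c) z 0.
Proof.
  apply cderiv_quad with 1%R 0%R; [lra|]; intros w _.
  replace (c - c - 0 * (w - z)) with (RtoC 0) by ring; rewrite Cmod_0; lra.
Qed.

Lemma cderiv_id (z : C) : cderiv (fun w => w) z 1.
Proof.
  apply cderiv_quad with 1%R 0%R; [lra|]; intros w _.
  replace (w - z - 1 * (w - z)) with (RtoC 0) by ring; rewrite Cmod_0; lra.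
Qed.

Lemma cderiv_plus (f g : C -> C) (z l m : C) :
  cderiv f z l -> cderiv g z m -> cderiv (fun w => f w + g w) z (l + m).
Proof.
  intros Hf Hg eps He.
  destruct (Hf (eps / 2)%R) as [d [Hd H]]; [lra|].
  destruct (Hg (eps / 2)%R) as [d' [Hd' H']]; [lra|].
  exists (Rmin d d'); split; [apply Rmin_pos; auto|]; intros w Hw.
  assert (Cmod (w - z) < d)%R by (eapply Rlt_le_trans; [apply Hw | apply Rmin_l]).
  assert (Cmod (w - z) < d')%R by (eapply Rlt_le_trans; [apply Hw | apply Rmin_r]).
  replace (f w + g w - (f z + g z) - (l + m) * (w - z))
    with ((f w - f z - l * (w - z)) + (g w - g z - m * (w - z))) by ring.
  eapply Rle_trans; [apply Cmod_triangle|].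
  specialize (H w ltac:(auto)); specialize (H' w ltac:(auto)); lra.
Qed.

Lemma cderiv_lipschitz (f : C -> C) (z l : C) :
  cderiv f z l -> exists d : R, (0 < d)%R /\ forall w, (Cmod (w - z) < d)%R ->
    (Cmod (f w - f z) <= (Cmod l + 1) * Cmod (w - z))%R.
Proof.
  intros H; destruct (H 1%R) as [d [Hd Hw]]; [lra|].
  exists d; split; auto; intros w Hwz; specialize (Hw w Hwz).
  replace (f w - f z) with ((f w - f z - l * (w - z)) + l * (w - z)) by ring.
  eapply Rle_trans; [apply Cmod_triangle|]; rewrite Cmod_mult; lra.
Qed.

Lemma cderiv_comp (f g : C -> C) (z l m : C) :
  cderiv f (g z) l -> cderiv g z m -> cderiv (fun w => f (g w)) z (l * m).
Proof.
  intros Hf Hg eps He.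
  pose proof (Cmod_ge_0 l) as Pl; pose proof (Cmod_ge_0 m) as Pm.
  destruct (cderiv_lipschitz _ _ _ Hg) as [d0 [Hd0 H0]].
  destruct (Hf (eps / (2 * (Cmod m + 1)))%R) as [d1 [Hd1 H1]].
  { apply Rdiv_lt_0_compat; lra. }
  destruct (Hg (eps / (2 * (Cmod l + 1)))%R) as [d2 [Hd2 H2]].
  { apply Rdiv_lt_0_compat; lra. }
  exists (Rmin (Rmin d0 d2) (d1 / (Cmod m + 1))); split.
  { repeat apply Rmin_pos; auto; apply Rdiv_lt_0_compat; lra. }
  intros w Hw.
  assert (W0 : (Cmod (w - z) < d0)%R).
  { eapply Rlt_le_trans; [apply Hw|]; eapply Rle_trans; [apply Rmin_l | apply Rmin_l]. }
  assert (W2 : (Cmod (w - z) < d2)%R).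
  { eapply Rlt_le_trans; [apply Hw|]; eapply Rle_trans; [apply Rmin_l | apply Rmin_r]. }
  assert (W1 : (Cmod (w - z) < d1 / (Cmod m + 1))%R).
  { eapply Rlt_le_trans; [apply Hw | apply Rmin_r]. }
  specialize (H0 w W0); specialize (H2 w W2).
  assert (W3 : (Cmod (g w - g z) < d1)%R).
  { eapply Rle_lt_trans; [apply H0|].
    apply (Rmult_lt_compat_l (Cmod m + 1)) in W1; [|lra].
    replace ((Cmod m + 1) * (d1 / (Cmod m + 1)))%R with d1 in W1 by (field; lra); auto. }
  specialize (H1 (g w) W3).
  replace (f (g w) - f (g z) - l * m * (w - z)) with
    ((f (g w) - f (g z) - l * (g w - g z)) + l * (g w - g z - m * (w - z))) by ring.
  eapply Rle_trans; [apply Cmod_triangle|]; rewrite Cmod_mult.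
  assert (A1 : (Cmod (f (g w) - f (g z) - l * (g w - g z)) <= eps / 2 * Cmod (w - z))%R).
  { eapply Rle_trans; [apply H1|].
    eapply Rle_trans; [apply Rmult_le_compat_l; [|apply H0]|].
    - apply Rlt_le, Rdiv_lt_0_compat; lra.
    - right; field; lra. }
  assert (A2 : (Cmod l * Cmod (g w - g z - m * (w - z)) <= eps / 2 * Cmod (w - z))%R).
  { eapply Rle_trans; [apply Rmult_le_compat_l; [auto|apply H2]|].
    apply Rle_trans with ((Cmod l + 1) * (eps / (2 * (Cmod l + 1)) * Cmod (w - z)))%R.
    - apply Rmult_le_compat_r; [|lra].
      apply Rmult_le_pos; [|apply Cmod_ge_0]; apply Rlt_le, Rdiv_lt_0_compat; lra.
    - right; field; lra. }
  lra.
Qed.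

Lemma cderiv_square (z : C) : cderiv (fun w => w * w) z (2 * z).
Proof.
  apply cderiv_quad with 1%R 1%R; [lra|]; intros w _.
  replace (w * w - z * z - 2 * z * (w - z)) with ((w - z) * (w - z)) by ring.
  rewrite Cmod_mult; lra.
Qed.

Lemma cderiv_scal (c : C) (f : C -> C) (z l : C) :
  cderiv f z l -> cderiv (fun w => c * f w) z (c * l).
Proof.
  intros H; apply (cderiv_comp (fun w => c * w)); auto.
  apply cderiv_quad with 1%R 0%R; [lra|]; intros w _.
  replace (c * w - c * f z - c * (w - f z)) with (RtoC 0) by ring; rewrite Cmod_0; lra.
Qed.

Lemma cderiv_opp (f : C -> C) (z l : C) :
  cderiv f z l -> cderiv (fun w => - f w) z (- l).
Proof.
  intros H; apply (cderiv_scal (-1)) in H; replace (-1 * l) with (- l) in H by ring.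
  apply cderiv_ext with (2 := H); intros; ring.
Qed.

Lemma cderiv_minus (f g : C -> C) (z l m : C) :
  cderiv f z l -> cderiv g z m -> cderiv (fun w => f w - g w) z (l - m).
Proof. intros Hf Hg; apply cderiv_plus; [|apply cderiv_opp]; auto. Qed.

(* Polarisation: [f g = ((f + g)^2 - f^2 - g^2) / 2]. *)
Lemma cderiv_mult (f g : C -> C) (z l m : C) :
  cderiv f z l -> cderiv g z m ->
  cderiv (fun w => f w * g w) z (l * g z + f z * m).
Proof.
  intros Hf Hg.
  assert (Sq : forall h k, cderiv h z k -> cderiv (fun w => h w * h w) z (2 * h z * k)).
  { intros h k H; apply (cderiv_comp (fun w => w * w) h); auto; apply cderiv_square. }
  pose proof (Sq _ _ (cderiv_plus _ _ _ _ _ Hf Hg)) as H.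
  pose proof (cderiv_scal (/ 2) _ _ _
    (cderiv_minus _ _ _ _ _ (cderiv_minus _ _ _ _ _ H (Sq _ _ Hf)) (Sq _ _ Hg))) as H'.
  simpl in H'.
  assert (N2 : RtoC 2 <> 0) by (intros E; apply RtoC_inj in E; lra).
  replace (l * g z + f z * m) with
    (/ 2 * (2 * (f z + g z) * (l + m) - 2 * f z * l - 2 * g z * m))
    by (field; auto).
  apply cderiv_ext with (2 := H'); intros w; field; auto.
Qed.

Lemma cderiv_pow (n : nat) (z : C) :
  cderiv (fun w => w ^ n) z (INR n * z ^ (n - 1)).
Proof.
  induction n as [|n IH].
  - simpl INR; replace (0 * z ^ (0 - 1)) with (RtoC 0) by ring.
    apply cderiv_ext with (fun _ => 1); [reflexivity | apply cderiv_const].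
  - pose proof (cderiv_mult _ _ _ _ _ (cderiv_id z) IH) as H.
    replace (INR (S n) * z ^ (S n - 1)) with (1 * z ^ n + z * (INR n * z ^ (n - 1))).
    + exact H.
    + rewrite S_INR, RtoC_plus; replace (S n - 1)%nat with n by lia.
      destruct n as [|n]; [simpl; ring|].
      replace (S n - 1)%nat with n by lia; simpl Cpow; ring.
Qed.

Lemma cderiv_psum (f : nat -> C -> C) (l : nat -> C) (z : C) (n : nat) :
  (forall i, (i < n)%nat -> cderiv (f i) z (l i)) ->
  cderiv (fun w => psum (fun i => f i w) n) z (psum l n).
Proof.
  induction n as [|n IH]; intros H; simpl; [apply cderiv_const|].
  apply (cderiv_plus (fun w => psum (fun i => f i w) n) (f n)); auto.
Qed.

Lemma Cmod_minus_ge (a b : C) : (Cmod a - Cmod b <= Cmod (a - b))%R.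
Proof.
  assert (Cmod a <= Cmod (a - b) + Cmod b)%R; [|lra].
  replace a with (a - b + b) at 1 by ring; apply Cmod_triangle.
Qed.

Lemma cderiv_inv (z : C) : z <> 0 -> cderiv (fun w => / w) z (- / (z * z)).
Proof.
  intros Hz; pose proof (proj1 (Cmod_gt_0 z) Hz) as Pz.
  apply cderiv_quad with (Cmod z / 2)%R (2 / Cmod z ^ 3)%R; [lra|]; intros w Hw.
  assert (Hwz : (Cmod z / 2 < Cmod w)%R).
  { pose proof (Cmod_minus_ge z (z - w)) as H.
    replace (z - (z - w)) with w in H by ring.
    rewrite <- (Cmod_opp (z - w)) in H; replace (- (z - w)) with (w - z) in H by ring; lra. }
  assert (Hw0 : w <> 0) by (apply Cmod_gt_0; lra).
  replace (/ w - / z - - / (z * z) * (w - z))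
    with ((w - z) * (w - z) * / (z * z * w)) by (field; auto).
  rewrite !Cmod_mult, Cmod_inv, !Cmod_mult by (repeat apply Cmult_neq_0; auto).
  assert (Hi : (/ (Cmod z * Cmod z * Cmod w) <= 2 / Cmod z ^ 3)%R).
  { replace (2 / Cmod z ^ 3)%R with (/ (Cmod z * Cmod z * (Cmod z / 2)))%R by (field; lra).
    apply Rinv_le_contravar; [repeat apply Rmult_lt_0_compat; lra|].
    apply Rmult_le_compat_l; [|lra]; apply Rmult_le_pos; lra. }
  pose proof (Cmod_ge_0 (w - z)).
  replace (2 / Cmod z ^ 3 * Cmod (w - z) ^ 2)%R
    with (Cmod (w - z) * Cmod (w - z) * (2 / Cmod z ^ 3))%R by ring.
  apply Rmult_le_compat_l; auto; apply Rmult_le_pos; auto.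
Qed.

(** * Taylor estimates and the complex exponential *)

(** One integration of a bound on the derivative: the exponent goes up by one and K stays. Iterating
    it from exp <= 3 or from |cos| <= 1 produces the Taylor remainders below without any factorial
    bookkeeping. *)
Lemma mean_value_pow (f df : R -> R) (K : R) (n : nat) :
  f 0%R = 0%R -> (forall t, is_derive f t (df t)) ->
  (forall t, (Rabs t <= 1)%R -> (Rabs (df t) <= K * Rabs t ^ n)%R) ->
  forall x, (Rabs x <= 1)%R -> (Rabs (f x) <= K * Rabs x ^ S n)%R.
Proof.
  intros H0 Hd Hb x Hx.
  destruct (MVT_gen f 0 x df) as [c [Hc E]].
  - intros; apply Hd.
  - intros y _; apply continuity_pt_filterlim.
    apply (@ex_derive_continuous R_AbsRing R_NormedModule); exists (df y); apply Hd.
  - rewrite H0, !Rminus_0_r in E; rewrite E, Rabs_mult.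
    assert (Hcx : (Rabs c <= Rabs x)%R).
    { unfold Rmin, Rmax in Hc; destruct (Rle_dec 0 x).
      - rewrite !Rabs_pos_eq; lra.
      - rewrite !Rabs_left1; lra. }
    assert (K0 : (0 <= K)%R).
    { assert (H1 : (Rabs 1 <= 1)%R) by (rewrite Rabs_R1; lra).
      specialize (Hb 1%R H1); rewrite Rabs_R1, pow1 in Hb.
      pose proof (Rabs_pos (df 1%R)); lra. }
    simpl; replace (K * (Rabs x * Rabs x ^ n))%R with ((K * Rabs x ^ n) * Rabs x)%R by ring.
    apply Rmult_le_compat_r; [apply Rabs_pos|].
    eapply Rle_trans; [apply Hb; lra|].
    apply Rmult_le_compat_l; auto; apply pow_incr; split; auto; apply Rabs_pos.
Qed.

Lemma exp_taylor2 (x : R) :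
  (Rabs x <= 1)%R -> (Rabs (exp x - 1 - x - x ^ 2 / 2) <= 3 * Rabs x ^ 3)%R.
Proof.
  revert x; apply (mean_value_pow (fun x => exp x - 1 - x - x ^ 2 / 2)%R
    (fun x => exp x - 1 - x)%R).
  { rewrite exp_0; field. }
  { intros t; auto_derive; auto; field. }
  apply (mean_value_pow (fun x => exp x - 1 - x)%R (fun x => exp x - 1)%R).
  { rewrite exp_0; field. }
  { intros t; auto_derive; auto; field. }
  apply (mean_value_pow (fun x => exp x - 1)%R (fun x => exp x)%R 3 0).
  { rewrite exp_0; field. }
  { intros t; auto_derive; auto; field. }
  intros t Ht; simpl; rewrite Rabs_pos_eq by (apply Rlt_le, exp_pos).
  apply Rle_trans with (exp 1); [|pose proof exp_le_3; lra].
  apply Rabs_le_between in Ht; destruct (Rle_lt_or_eq_dec t 1) as [H|H]; try lra.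
  - apply Rlt_le, exp_increasing; auto.
  - rewrite H; lra.
Qed.

Lemma sin_taylor1 (x : R) :
  (Rabs x <= 1)%R -> (Rabs (sin x - x) <= 1 * Rabs x ^ 3)%R.
Proof.
  revert x; apply (mean_value_pow (fun x => sin x - x)%R (fun x => cos x - 1)%R).
  { rewrite sin_0; field. }
  { intros t; auto_derive; auto; field. }
  apply (mean_value_pow (fun x => cos x - 1)%R (fun x => - sin x)%R).
  { rewrite cos_0; field. }
  { intros t; auto_derive; auto; field. }
  intros t Ht; rewrite Rabs_Ropp; revert t Ht.
  apply (mean_value_pow sin cos 1 0).
  { apply sin_0. }
  { intros t; apply is_derive_Reals, derivable_pt_lim_sin. }
  intros t _; simpl; pose proof (COS_bound t); apply Rabs_le; lra.
Qed.

Lemma cos_taylor2 (x : R) :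
  (Rabs x <= 1)%R -> (Rabs (cos x - 1 + x ^ 2 / 2) <= 1 * Rabs x ^ 4)%R.
Proof.
  revert x; apply (mean_value_pow (fun x => cos x - 1 + x ^ 2 / 2)%R
    (fun x => - (sin x - x))%R).
  { rewrite cos_0; field. }
  { intros t; auto_derive; auto; field. }
  intros t Ht; rewrite Rabs_Ropp; apply sin_taylor1; auto.
Qed.

Lemma Rabs_plus_le (a b A B : R) :
  (Rabs a <= A -> Rabs b <= B -> Rabs (a + b) <= A + B)%R.
Proof. intros; eapply Rle_trans; [apply Rabs_triang|]; lra. Qed.

Lemma Rabs_mult_le (a b A B : R) :
  (Rabs a <= A -> Rabs b <= B -> Rabs (a * b) <= A * B)%R.
Proof. intros; rewrite Rabs_mult; apply Rmult_le_compat; auto using Rabs_pos. Qed.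

Lemma Cexp_taylor2 (u : C) :
  (Cmod u <= 1)%R ->
  (Cmod (Cexp u - 1 - u - u * u / 2) <= 13 * Cmod u ^ 3)%R.
Proof.
  destruct u as [x y]; set (p := Cmod (x, y)); intros Hp.
  assert (Hx : (Rabs x <= p)%R) by apply (re_le_Cmod (x, y)).
  assert (Hy : (Rabs y <= p)%R) by apply (im_le_Cmod (x, y)).
  assert (P0 : (0 <= p)%R) by apply Cmod_ge_0.
  assert (Q : forall t n, (Rabs t <= p -> Rabs t ^ n <= p ^ n)%R).
  { intros t n Ht; apply pow_incr; split; auto using Rabs_pos. }
  pose proof (exp_taylor2 x ltac:(lra)) as Hr.
  pose proof (sin_taylor1 y ltac:(lra)) as Ht.
  pose proof (cos_taylor2 y ltac:(lra)) as Hs.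
  pose proof (Q x 3%nat Hx); pose proof (Q y 3%nat Hy); pose proof (Q y 4%nat Hy).
  set (r := (exp x - 1 - x - x ^ 2 / 2)%R) in *.
  set (t := (sin y - y)%R) in *.
  set (s := (cos y - 1 + y ^ 2 / 2)%R) in *.
  assert (P4 : (p ^ 4 <= p ^ 3)%R).
  { simpl; rewrite <- (Rmult_1_l (p * (p * (p * 1)))) at 2.
    apply Rmult_le_compat_r; auto; repeat apply Rmult_le_pos; lra. }
  assert (Hr' : (Rabs r <= 3 * p ^ 3)%R) by lra.
  assert (Ht' : (Rabs t <= p ^ 3)%R) by lra.
  assert (Hs' : (Rabs s <= p ^ 3)%R) by lra.
  assert (Hc1 : (Rabs (cos y) <= 1)%R) by (pose proof (COS_bound y); apply Rabs_le; lra).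
  assert (Hs1 : (Rabs (sin y) <= 1)%R) by (pose proof (SIN_bound y); apply Rabs_le; lra).
  assert (Hh : (Rabs (1 + x + x ^ 2 / 2) <= 5 / 2)%R).
  { apply Rle_trans with (1 + 1 + 1 * 1 / 2)%R; [|lra].
    repeat apply Rabs_plus_le; try lra.
    - rewrite Rabs_R1; lra.
    - unfold Rdiv; simpl; rewrite Rmult_1_r; repeat apply Rabs_mult_le; try lra.
      rewrite Rabs_pos_eq; lra. }
  eapply Rle_trans; [apply Cmod_le_parts|].
  assert (N2 : RtoC 2 <> 0) by (intros E; apply RtoC_inj in E; lra).
  (* Substitute e^x = 1 + x + x^2/2 + r, cos y = 1 - y^2/2 + s and sin y = y + t. Terms of degree at
     most 2 cancel, and the bounds of the two parts add up to 6.25 p^3 + 6 p^3, below 13 p^3. *)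
  replace (Cexp (x, y) - 1 - (x, y) - (x, y) * (x, y) / 2) with
    ((- (x * (y * y) * / 2) + - (x * x * (y * y) * / 4) + r * cos y
      + (1 + x + x ^ 2 / 2) * s)%R,
     (x * x * y * / 2 + (1 + x + x ^ 2 / 2) * t + r * sin y)%R).
  - simpl.
    assert (B1 : (Rabs (- (x * (y * y) * / 2) + - (x * x * (y * y) * / 4) + r * cos y
      + (1 + x + x ^ 2 / 2) * s) <= p * (p * p) * / 2 + p * p * (p * p) * / 4
      + 3 * p ^ 3 * 1 + 5 / 2 * p ^ 3)%R).
    { repeat apply Rabs_plus_le; rewrite ?Rabs_Ropp; repeat apply Rabs_mult_le; auto;
        rewrite Rabs_pos_eq; lra. }
    assert (B2 : (Rabs (x * x * y * / 2 + (1 + x + x ^ 2 / 2) * t + r * sin y)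
       <= p * p * p * / 2 + 5 / 2 * p ^ 3 + 3 * p ^ 3 * 1)%R).
    { repeat apply Rabs_plus_le; rewrite ?Rabs_Ropp; repeat apply Rabs_mult_le; auto;
        rewrite Rabs_pos_eq; lra. }
    eapply Rle_trans; [apply Rplus_le_compat; [exact B1 | exact B2]|].
    assert (P3 : (0 <= p ^ 3)%R) by (apply pow_le; auto).
    replace (p * (p * p))%R with (p ^ 3)%R by ring.
    replace (p * p * p)%R with (p ^ 3)%R by ring.
    replace (p * p * (p * p))%R with (p ^ 4)%R by ring.
    lra.
  - unfold Cexp, Cminus, Cplus, Copp, Cmult, Cdiv, Cinv, RtoC, r, s, t, Re, Im; simpl.
    f_equal; field.
Qed.

Lemma Cexp_plus (a b : C) : Cexp (a + b) = Cexp a * Cexp b.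
Proof.
  unfold Cexp, Cmult, Cplus, Re, Im; simpl.
  rewrite exp_plus, cos_plus, sin_plus; f_equal; ring.
Qed.

Lemma Cexp_0 : Cexp 0 = 1.
Proof.
  unfold Cexp, RtoC; simpl; rewrite exp_0, cos_0, sin_0; f_equal; ring.
Qed.

Lemma Cmod_Cexp (z : C) : Cmod (Cexp z) = exp (Re z).
Proof.
  unfold Cmod, Cexp; simpl fst; simpl snd.
  replace ((exp (Re z) * cos (Im z)) ^ 2 + (exp (Re z) * sin (Im z)) ^ 2)%R
    with (exp (Re z) ^ 2)%R.
  - apply sqrt_pow2, Rlt_le, exp_pos.
  - pose proof (sin2_cos2 (Im z)) as H; unfold Rsqr in H.
    transitivity (exp (Re z) ^ 2 * (sin (Im z) * sin (Im z) + cos (Im z) * cos (Im z)))%R;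
      [rewrite H|]; ring.
Qed.

Lemma Cexp_neq_0 (z : C) : Cexp z <> 0.
Proof. apply Cmod_gt_0; rewrite Cmod_Cexp; apply exp_pos. Qed.

Lemma Cexp_taylor1 (u : C) :
  (Cmod u <= 1)%R -> (Cmod (Cexp u - 1 - u) <= 14 * Cmod u ^ 2)%R.
Proof.
  intros Hu; pose proof (Cexp_taylor2 u Hu) as H; pose proof (Cmod_ge_0 u) as P.
  assert (N2 : RtoC 2 <> 0) by (intros E; apply RtoC_inj in E; lra).
  replace (Cexp u - 1 - u) with ((Cexp u - 1 - u - u * u / 2) + u * u / 2) by (field; auto).
  eapply Rle_trans; [apply Cmod_triangle|].
  rewrite (Cmod_div (u * u)), Cmod_mult, (Cmod_R 2), (Rabs_pos_eq 2) by (auto; lra).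
  assert (Cmod u ^ 3 <= Cmod u ^ 2)%R.
  { replace (Cmod u ^ 3)%R with (Cmod u * Cmod u ^ 2)%R by ring.
    rewrite <- (Rmult_1_l (Cmod u ^ 2)) at 2.
    apply Rmult_le_compat_r; auto; apply pow_le; auto. }
  simpl in *; nra.
Qed.

Lemma cderiv_Cexp (z : C) : cderiv Cexp z (Cexp z).
Proof.
  apply cderiv_quad with 1%R (Cmod (Cexp z) * 14)%R; [lra|]; intros w Hw.
  replace (Cexp w) with (Cexp z * Cexp (w - z)).
  - replace (Cexp z * Cexp (w - z) - Cexp z - Cexp z * (w - z))
      with (Cexp z * (Cexp (w - z) - 1 - (w - z))) by ring.
    rewrite Cmod_mult, Rmult_assoc; apply Rmult_le_compat_l; [apply Cmod_ge_0|].
    apply Cexp_taylor1; lra.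
  - rewrite <- Cexp_plus; f_equal; ring.
Qed.

Lemma qexp_parts (z : C) : 2 * PI * Ci * z = ((- (2 * PI * Im z))%R, (2 * PI * Re z)%R).
Proof.
  destruct z as [x y]; unfold Cmult, Ci, RtoC, Re, Im; simpl; f_equal; ring.
Qed.

Lemma qexp_plus (a b : C) : qexp (a + b) = qexp a * qexp b.
Proof. unfold qexp; rewrite <- Cexp_plus; f_equal; ring. Qed.

Lemma Cmod_qexp (z : C) : Cmod (qexp z) = exp (- (2 * PI * Im z)).
Proof. unfold qexp; rewrite qexp_parts, Cmod_Cexp; reflexivity. Qed.

Lemma qexp_neq_0 (z : C) : qexp z <> 0.
Proof. apply Cexp_neq_0. Qed.

Lemma qexp_IZR (n : Z) : qexp (IZR n) = 1.
Proof.
  assert (H1 : qexp 1 = 1).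
  { unfold qexp; rewrite qexp_parts; unfold Cexp, RtoC; simpl.
    rewrite !Rmult_0_r, Ropp_0, Rmult_1_r, exp_0, cos_2PI, sin_2PI; f_equal; ring. }
  assert (H0 : qexp 0 = 1).
  { unfold qexp; rewrite Cmult_0_r; apply Cexp_0. }
  assert (HN : forall m : nat, qexp (INR m) = 1).
  { induction m as [|m IH]; [apply H0|].
    rewrite S_INR, RtoC_plus, qexp_plus, IH, H1; ring. }
  destruct (Z_le_gt_dec 0 n) as [H|H].
  - rewrite <- (Z2Nat.id n), <- INR_IZR_INZ by auto; apply HN.
  - assert (E : qexp (IZR n) * qexp (INR (Z.to_nat (- n))) = 1).
    { rewrite <- qexp_plus, INR_IZR_INZ, Z2Nat.id, <- RtoC_plus, <- plus_IZR by lia.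
      replace (n + - n)%Z with 0%Z by ring; apply H0. }
    rewrite HN, Cmult_1_r in E; auto.
Qed.

Lemma qexp_nat (n : nat) (z : C) : qexp (INR n * z) = qexp z ^ n.
Proof.
  induction n as [|n IH].
  - simpl INR; rewrite Cmult_0_l; apply (qexp_IZR 0).
  - rewrite S_INR, RtoC_plus.
    replace ((INR n + 1) * z) with (z + INR n * z) by ring.
    rewrite qexp_plus, IH; reflexivity.
Qed.

Lemma cderiv_qexp (z : C) : cderiv qexp z (2 * PI * Ci * qexp z).
Proof.
  replace (2 * PI * Ci * qexp z) with (qexp z * (2 * PI * Ci * 1)) by ring.
  apply (cderiv_comp Cexp); [apply cderiv_Cexp | apply cderiv_scal, cderiv_id].
Qed.

Lemma qexp_half : qexp (/ 2) = -1.
Proof.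
  assert (N2 : RtoC 2 <> 0) by (intros E; apply RtoC_inj in E; lra).
  unfold qexp; replace (2 * PI * Ci * / 2) with (PI * Ci) by (field; auto).
  unfold Cexp, Cmult, Ci, RtoC, Re, Im; simpl.
  replace (PI * 0 - 0 * 1)%R with 0%R by ring; replace (PI * 1 + 0 * 0)%R with PI by ring.
  rewrite exp_0, cos_PI, sin_PI; f_equal; ring.
Qed.

(** * Partial fractions of the squared cosecant *)

Lemma RtoC_neq (x y : R) : x <> y -> RtoC x <> RtoC y.
Proof. intros H E; apply H, RtoC_inj, E. Qed.

Lemma C2_neq_0 : RtoC 2 <> 0.
Proof. apply RtoC_neq; lra. Qed.

Lemma CPI_neq_0 : RtoC PI <> 0.
Proof. apply RtoC_neq, PI_neq0. Qed.

Lemma Ci_neq_0 : Ci <> 0.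
Proof. intros E; injection E; intros; lra. Qed.

Lemma CINR_neq_0 (n : nat) : (n <> 0)%nat -> RtoC (INR n) <> 0.
Proof. intros H; apply RtoC_neq, not_0_INR, H. Qed.

Lemma Cminus_neq_0 (a b : C) : a <> b -> a - b <> 0.
Proof. intros H E; apply H; replace a with (a - b + b) by ring; rewrite E; ring. Qed.

(* [PI^2 / sin (PI z)^2] in terms of [q]. *)
Definition csc2 (z : C) : C :=
  - (4 * PI * PI) * (qexp z / ((1 - qexp z) * (1 - qexp z))).

Lemma csc2_periodic (z : C) (n : Z) : csc2 (z + IZR n) = csc2 z.
Proof. unfold csc2; rewrite qexp_plus, qexp_IZR, Cmult_1_r; reflexivity. Qed.

(** With r = qexp (z/2) the two points on the left have parameters r and -r, and r/(1-r)^2 -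
    r/(1+r)^2 = 4 r^2/(1-r^2)^2. *)
Lemma csc2_double (z : C) :
  qexp z <> 1 -> csc2 (z / 2) + csc2 ((z + 1) / 2) = 4 * csc2 z.
Proof.
  pose proof C2_neq_0 as N2.
  assert (E1 : qexp z = qexp (z / 2) * qexp (z / 2)).
  { rewrite <- qexp_plus; f_equal; field; auto. }
  assert (E2 : qexp ((z + 1) / 2) = - qexp (z / 2)).
  { replace ((z + 1) / 2) with (z / 2 + / 2) by (field; auto).
    rewrite qexp_plus, qexp_half; ring. }
  unfold csc2; rewrite E2, E1; generalize (qexp (z / 2)); intros r Hr.
  assert (A1 : 1 - r <> 0).
  { apply Cminus_neq_0; intros E; apply Hr; rewrite <- E; ring. }
  assert (A2 : 1 + r <> 0).
  { intros E; apply Hr; replace r with (-(1) + (1 + r)) by ring; rewrite E; ring. }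
  assert (A3 : 1 - r * r <> 0).
  { replace (1 - r * r) with ((1 - r) * (1 + r)) by ring; apply Cmult_neq_0; auto. }
  field; repeat split; auto.
  replace (1 - - r) with (1 + r) by ring; auto.
Qed.

(** Duplication iterated p times. Powers of 2 are enough, since the limit in [csum_csc2] is taken
    along them. *)
Lemma csc2_multiplication (p : nat) (z : C) :
  qexp z <> 1 ->
  psum (fun k => csc2 ((z + INR k) / INR (2 ^ p))) (2 ^ p)
  = INR (4 ^ p) * csc2 z.
Proof.
  intros Hz; induction p as [|p IH].
  - simpl; replace ((z + 0) / 1) with z by (field; apply RtoC_neq; lra); ring.
  - assert (N0 : (2 ^ p <> 0)%nat) by (apply Nat.pow_nonzero; lia).
    pose proof (CINR_neq_0 _ N0) as NN; pose proof C2_neq_0 as N2.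
    replace (2 ^ S p)%nat with (2 ^ p + 2 ^ p)%nat by (simpl; lia).
    (* Indices k and k + 2^p are paired: their points differ by 1/2, as duplication requires. *)
    rewrite psum_app, <- psum_plus.
    replace (4 ^ S p)%nat with (4 * 4 ^ p)%nat by (simpl; lia).
    rewrite mult_INR, RtoC_mult, <- Cmult_assoc, <- IH, <- psum_scal.
    apply psum_ext; intros k _.
    replace (INR 4) with 4%R by (simpl; ring).
    rewrite <- csc2_double.
    + f_equal; f_equal; rewrite !plus_INR, !RtoC_plus; field; repeat split; auto;
        replace (INR (2 ^ p) + INR (2 ^ p)) with (2 * INR (2 ^ p)) by ring;
        apply Cmult_neq_0; auto.
    + intros E; apply Hz.
      assert (E' : qexp (INR (2 ^ p) * ((z + INR k) / INR (2 ^ p))) = 1).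
      { rewrite qexp_nat, E; apply Cpow_1_l. }
      replace (INR (2 ^ p) * ((z + INR k) / INR (2 ^ p))) with (z + INR k) in E'
        by (field; auto).
      rewrite INR_IZR_INZ, qexp_plus, qexp_IZR, Cmult_1_r in E'; auto.
Qed.

(** The range must go beyond 1/2, because the points w_k of [csum_csc2] only satisfy |Re w_k| <=
    3/4. The constant 1/3 is what the bound sin (pi t) >= 1 - t, obtained by reflection, gives at t
    = 3/4. *)
Lemma sin_PI_lower (x : R) :
  (Rabs x <= 3 / 4)%R -> (Rabs x / 3 <= Rabs (sin (PI * x)))%R.
Proof.
  pose proof PI_4 as P4; pose proof PI2_3_2 as P3; unfold PI2 in P3.
  assert (H0 : forall t, (0 <= t <= / 2 -> t <= sin (PI * t))%R).
  { intros t Ht.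
    (* For s = pi t at most 2, sin s >= s - s^3/6 >= s/3 >= t. *)
    destruct (sin_bound (PI * t) 0) as [H _]; [nra | nra |].
    unfold sin_approx in H; simpl in H; unfold sin_term in H; simpl in H.
    assert (PI * t <= 2)%R by nra.
    assert (0 <= PI * t)%R by nra.
    assert ((PI * t) ^ 2 <= 4)%R by nra.
    assert (PI * t - (PI * t) * (PI * t) ^ 2 / 6 >= (PI * t) / 3)%R by nra.
    nra. }
  assert (H1 : forall t, (0 <= t <= 3 / 4 -> t / 3 <= sin (PI * t))%R).
  { intros t Ht; destruct (Rle_dec t (/ 2)) as [H|H].
    - specialize (H0 t); lra.
    - assert (E : sin (PI * t) = sin (PI * (1 - t))).
      { rewrite <- (sin_PI_x (PI * t)); f_equal; ring. }
      rewrite E; specialize (H0 (1 - t)%R); lra. }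
  intros Hx; destruct (Rle_dec 0 x) as [H|H].
  - rewrite (Rabs_pos_eq x) in * by auto; specialize (H1 x).
    eapply Rle_trans; [|apply Rle_abs]; lra.
  - rewrite (Rabs_left1 x) in * by lra; specialize (H1 (- x)%R).
    replace (PI * - x)%R with (- (PI * x))%R in H1 by ring; rewrite sin_neg in H1.
    rewrite <- Rabs_Ropp; eapply Rle_trans; [|apply Rle_abs]; lra.
Qed.

(** The difference e^a + e^-a - 2 is the square of e^(a/2) - e^(-a/2), which is at least a/2 for a
    >= 0. *)
Lemma cosh_lower (a : R) : (2 + a ^ 2 / 4 <= exp a + exp (- a))%R.
Proof.
  assert (H : forall a, (0 <= a -> 2 + a ^ 2 / 4 <= exp a + exp (- a))%R).
  { clear a; intros a Ha.
    assert (E1 : exp a = (exp (a / 2) * exp (a / 2))%R) by (rewrite <- exp_plus; f_equal; field).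
    assert (E2 : exp (- a) = (exp (- (a / 2)) * exp (- (a / 2)))%R)
      by (rewrite <- exp_plus; f_equal; field).
    assert (E3 : (exp (a / 2) * exp (- (a / 2)) = 1)%R)
      by (rewrite <- exp_plus, Rplus_opp_r; apply exp_0).
    assert (B1 : (1 + a / 2 <= exp (a / 2))%R).
    { destruct (Req_dec a 0) as [->|N].
      - replace (0 / 2)%R with 0%R by field; rewrite exp_0; lra.
      - apply Rlt_le, exp_ineq1; lra. }
    assert (B2 : (exp (- (a / 2)) <= 1)%R).
    { rewrite <- exp_0; destruct (Req_dec a 0) as [->|N].
      - right; f_equal; field.
      - apply Rlt_le, exp_increasing; lra. }
    rewrite E1, E2; set (x := exp (a / 2)) in *; set (y := exp (- (a / 2))) in *.
    assert ((a / 2) ^ 2 <= (x - y) ^ 2)%R by (apply pow_incr; lra).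
    nra. }
  destruct (Rle_dec 0 a) as [Ha|Ha]; [auto|].
  specialize (H (- a)%R ltac:(lra)); rewrite Ropp_involutive in H.
  replace ((- a) ^ 2)%R with (a ^ 2)%R in H by ring; lra.
Qed.

(** Since |1 - q|^2 = 4 |q| |sin (pi w)|^2, this says |sin (pi w)| >= |w|/3. The real direction is
    controlled by [sin_PI_lower], the imaginary one by [cosh_lower]. *)
Lemma one_minus_qexp_lower (w : C) :
  (Rabs (Re w) <= 3 / 4)%R ->
  (4 / 9 * Cmod w ^ 2 * Cmod (qexp w) <= Cmod (1 - qexp w) ^ 2)%R.
Proof.
  intros Hw; rewrite !Cmod2_alt, Cmod_qexp.
  set (x := Re w) in *; set (y := Im w).
  assert (E : qexp w = ((exp (- (2 * PI * y)) * cos (2 * PI * x))%R,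
                        (exp (- (2 * PI * y)) * sin (2 * PI * x))%R)).
  { unfold qexp; rewrite qexp_parts; reflexivity. }
  rewrite E; set (v := exp (- (2 * PI * y))).
  assert (Hv : (0 < v)%R) by apply exp_pos.
  pose proof (cosh_lower (2 * PI * y)) as Hc.
  assert (Ev : (exp (2 * PI * y) * v = 1)%R)
    by (unfold v; rewrite <- exp_plus, Rplus_opp_r; apply exp_0).
  set (e := exp (2 * PI * y)) in *; fold v in Hc.
  pose proof (sin_PI_lower x Hw) as Hs.
  assert (Hs2 : (x ^ 2 / 9 <= sin (PI * x) ^ 2)%R).
  { assert (Hs' : (0 <= Rabs x / 3 <= Rabs (sin (PI * x)))%R)
      by (split; [pose proof (Rabs_pos x); lra | auto]).
    apply (pow_incr _ _ 2) in Hs'.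
    rewrite <- (pow2_abs (sin (PI * x))).
    replace (x ^ 2 / 9)%R with ((Rabs x / 3) ^ 2)%R; auto.
    rewrite <- (pow2_abs x); field. }
  assert (C2 : (cos (2 * PI * x) = 1 - 2 * sin (PI * x) ^ 2)%R).
  { replace (2 * PI * x)%R with (2 * (PI * x))%R by ring; rewrite cos_2a_sin; ring. }
  pose proof (sin2_cos2 (2 * PI * x)) as SC; unfold Rsqr in SC.
  pose proof PI2_3_2 as P3; unfold PI2 in P3.
  assert (Hy : (y ^ 2 <= (2 * PI * y) ^ 2 / 4)%R).
  { assert (0 <= y ^ 2)%R by apply pow2_ge_0.
    replace ((2 * PI * y) ^ 2 / 4)%R with (PI * PI * y ^ 2)%R by field.
    assert (1 <= PI * PI)%R by nra; nra. }
  unfold Cminus, Cplus, Copp, RtoC, Re, Im; simpl fst; simpl snd.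
  replace ((1 + - (v * cos (2 * PI * x))) ^ 2 + (0 + - (v * sin (2 * PI * x))) ^ 2)%R
    with (v * (e + v - 2 * cos (2 * PI * x)))%R.
  - rewrite (Rmult_comm _ v); apply Rmult_le_compat_l; [lra|].
    rewrite C2; nra.
  - set (k := cos (2 * PI * x)) in *; set (j := sin (2 * PI * x)) in *.
    assert (E3 : (v * v * (j * j + k * k) = v * v)%R) by (rewrite SC; ring).
    lra.
Qed.

Lemma csc2_upper (w : C) :
  (Rabs (Re w) <= 3 / 4)%R -> w <> 0 ->
  (Cmod (csc2 w) <= 9 * PI ^ 2 / Cmod w ^ 2)%R.
Proof.
  intros Hr Hw; pose proof (one_minus_qexp_lower w Hr) as H.
  pose proof (proj1 (Cmod_gt_0 w) Hw) as Pw.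
  pose proof (proj1 (Cmod_gt_0 _) (qexp_neq_0 w)) as Pq.
  assert (Pw2 : (0 < Cmod w ^ 2)%R) by (apply pow_lt; auto).
  assert (PL : (0 < 4 / 9 * Cmod w ^ 2 * Cmod (qexp w))%R)
    by (repeat apply Rmult_lt_0_compat; auto; lra).
  assert (N : 1 - qexp w <> 0).
  { intros E; rewrite E, Cmod_0 in H; simpl in H; lra. }
  unfold csc2; rewrite Cmod_mult, Cmod_opp, Cmod_div, !Cmod_mult, !Cmod_R
    by (apply Cmult_neq_0; auto).
  rewrite !Rabs_pos_eq by (pose proof PI_RGT_0; lra).
  replace (Cmod (1 - qexp w) * Cmod (1 - qexp w))%R with (Cmod (1 - qexp w) ^ 2)%R by ring.
  apply Rle_trans with
    (4 * PI * PI * (Cmod (qexp w) / (4 / 9 * Cmod w ^ 2 * Cmod (qexp w))))%R.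
  - apply Rmult_le_compat_l; [pose proof PI_RGT_0; nra|].
    apply Rmult_le_compat_l; [lra|]; apply Rinv_le_contravar; auto.
  - right; field; split; lra.
Qed.

Lemma csc2_near_0 (w : C) :
  w <> 0 -> (Cmod (2 * PI * Ci * w) <= / 28)%R ->
  (Cmod (csc2 w - 1 / (w * w)) <= 4 * PI ^ 2 * (196 * 4))%R.
Proof.
  intros Hw; unfold csc2, qexp; set (u := 2 * PI * Ci * w); intros Hu.
  pose proof C2_neq_0 as N2; pose proof CPI_neq_0 as NP; pose proof Ci_neq_0 as NI.
  assert (N1 : RtoC 1 <> 0) by (apply RtoC_neq; lra).
  assert (Nu : u <> 0) by (unfold u; repeat apply Cmult_neq_0; auto).
  pose proof (proj1 (Cmod_gt_0 u) Nu) as Pu.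
  pose proof (Cexp_taylor2 u ltac:(lra)) as T2.
  pose proof (Cexp_taylor1 u ltac:(lra)) as T1.
  set (q := Cexp u) in *.
  set (r := q - 1 - u - u * u / 2) in *.
  (* The radius 1/28 is chosen so that the remainder 14 |u|^2 is at most |u|/2. *)
  assert (Hl : (Cmod u / 2 <= Cmod (1 - q))%R).
  { pose proof (Cmod_minus_ge u (- (q - 1 - u))) as H.
    replace (u - - (q - 1 - u)) with (- (1 - q)) in H by ring.
    rewrite !Cmod_opp in H.
    assert (14 * Cmod u ^ 2 <= Cmod u / 2)%R; [|lra].
    replace (14 * Cmod u ^ 2)%R with (Cmod u * (14 * Cmod u))%R by ring.
    apply Rmult_le_compat_l; lra. }
  assert (Nq : 1 - q <> 0) by (apply Cmod_gt_0; lra).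
  (* This is q u^2 - (1 - q)^2 after q = 1 + u + u^2/2 + r; the terms u^2 and u^3 cancel, so the
     double poles do too. The constant covers 1/4 + 2*13 + 13^2. *)
  assert (Hn : (Cmod (u * u * u * u / 4 - 2 * r * u - r * r) <= 196 * Cmod u ^ 4)%R).
  { unfold Cminus; eapply Rle_trans; [apply Cmod_triangle|].
    eapply Rle_trans; [apply Rplus_le_compat_r, Cmod_triangle|].
    rewrite !Cmod_opp, Cmod_div, !Cmod_mult, !Cmod_R, !Rabs_pos_eq by (try apply RtoC_neq; lra).
    set (p := Cmod u) in *; pose proof (Cmod_ge_0 r).
    assert (Cmod r * p <= 13 * p ^ 3 * p)%R by (apply Rmult_le_compat_r; lra).
    assert (Cmod r * Cmod r <= (13 * p ^ 3) * (13 * p ^ 3))%R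
      by (apply Rmult_le_compat; auto).
    assert (0 <= p ^ 4)%R by (apply pow_le; lra).
    assert (p ^ 6 <= p ^ 4)%R.
    { replace (p ^ 6)%R with (p ^ 4 * (p * p))%R by ring.
      rewrite <- (Rmult_1_r (p ^ 4)) at 2; apply Rmult_le_compat_l; auto; nra. }
    lra. }
  replace (- (4 * PI * PI) * (q / ((1 - q) * (1 - q))) - 1 / (w * w)) with
    (- (4 * PI * PI) * ((u * u * u * u / 4 - 2 * r * u - r * r)
       * / (u * u * ((1 - q) * (1 - q))))).
  - rewrite !Cmod_mult, Cmod_opp, !Cmod_mult, Cmod_inv, !Cmod_mult, !Cmod_R, !Rabs_pos_eq
      by (try (repeat apply Cmult_neq_0; auto); pose proof PI_RGT_0; lra).
    replace (4 * PI ^ 2)%R with (4 * PI * PI)%R by ring.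
    apply Rmult_le_compat_l; [pose proof PI_RGT_0; nra|].
    apply Rle_trans with (196 * Cmod u ^ 4 * / (Cmod u * Cmod u * (Cmod u / 2 * (Cmod u / 2))))%R.
    + apply Rmult_le_compat; auto using Cmod_ge_0.
      * apply Rlt_le, Rinv_0_lt_compat; repeat apply Rmult_lt_0_compat; auto; lra.
      * apply Rinv_le_contravar; [repeat apply Rmult_lt_0_compat; auto; lra|].
        apply Rmult_le_compat_l; [nra|]; apply Rmult_le_compat; lra.
    + right; field; lra.
  - transitivity (- (4 * PI * PI) * (q / ((1 - q) * (1 - q))) + (4 * PI * PI) / (u * u)).
    + unfold r; field; repeat split; auto; apply RtoC_neq; lra.
    + assert (E : Ci * Ci = - (1)) by (unfold Cmult, Ci, Copp, RtoC; simpl; f_equal; ring).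
      assert (Eu : u * u = - (4 * PI * PI) * (w * w)).
      { unfold u; transitivity (4 * PI * PI * (Ci * Ci) * (w * w)); [ring | rewrite E; ring]. }
      rewrite Eu; field; repeat split; auto; apply RtoC_neq; lra.
Qed.

(** Near 0 the double poles cancel; for |w| >= 1/(56 pi) both terms are bounded separately. The two
    constants in the maximum belong to these cases. *)
Lemma csc2_bounded : exists K : R, (0 <= K)%R /\ forall w : C,
  (Rabs (Re w) <= 3 / 4)%R -> w <> 0 -> (Cmod (csc2 w - 1 / (w * w)) <= K)%R.
Proof.
  pose proof PI_RGT_0 as PP.
  exists (Rmax (4 * PI ^ 2 * (196 * 4)) ((9 * PI ^ 2 + 1) * (56 * PI) ^ 2)); split.
  { eapply Rle_trans; [|apply Rmax_l]; simpl; nra. }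
  intros w Hr Hw; pose proof (proj1 (Cmod_gt_0 w) Hw) as Pw.
  destruct (Rle_dec (Cmod (2 * PI * Ci * w)) (/ 28)) as [H|H].
  - eapply Rle_trans; [apply csc2_near_0; auto | apply Rmax_l].
  - eapply Rle_trans; [|apply Rmax_r].
    rewrite !Cmod_mult, Cmod_Ci, !Cmod_R, !Rabs_pos_eq in H by lra.
    assert (Hwl : (/ (56 * PI) <= Cmod w)%R).
    { apply Rmult_le_reg_l with (56 * PI)%R; [lra|]; rewrite Rinv_r by lra; lra. }
    unfold Cminus; eapply Rle_trans; [apply Cmod_triangle|].
    rewrite Cmod_opp, Cmod_div, Cmod_1, Cmod_mult by (apply Cmult_neq_0; auto).
    pose proof (csc2_upper w Hr Hw).
    assert (Hi : (/ Cmod w ^ 2 <= (56 * PI) ^ 2)%R).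
    { rewrite <- (Rinv_inv ((56 * PI) ^ 2)); apply Rinv_le_contravar.
      - apply Rinv_0_lt_compat, pow_lt; lra.
      - rewrite <- pow_inv; apply pow_incr; split; auto.
        apply Rlt_le, Rinv_0_lt_compat; lra. }
    apply Rle_trans with ((9 * PI ^ 2 + 1) * / Cmod w ^ 2)%R.
    + unfold Rdiv in *; replace (Cmod w * Cmod w)%R with (Cmod w ^ 2)%R by ring; lra.
    + apply Rmult_le_compat_l; auto; nra.
Qed.

(** * Symmetric sums over the integers and the expansion of csc2 *)

Lemma ex_series_inv_square : ex_series (fun n => / INR (S n) ^ 2)%R.
Proof.
  assert (H : forall n, (rpsum (fun n => / INR (S n) ^ 2) (S n) <= 2 - / INR (S n))%R).
  { induction n as [|n IH].
    - simpl; lra.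
    - change (rpsum (fun n => / INR (S n) ^ 2) (S (S n)))%R with
        (rpsum (fun n => / INR (S n) ^ 2) (S n) + / INR (S (S n)) ^ 2)%R.
      assert (Pn : (0 < INR (S n))%R) by (apply lt_0_INR; lia).
      rewrite (S_INR (S n)); set (x := INR (S n)) in *.
      assert (/ (x + 1) ^ 2 <= / x - / (x + 1))%R; [|lra].
      replace (/ x - / (x + 1))%R with (/ (x * (x + 1)))%R by (field; lra).
      apply Rinv_le_contravar; nra. }
  destruct (ex_finite_lim_seq_incr (sum_n (fun n => / INR (S n) ^ 2)%R) 2) as [l Hl].
  - intros n; rewrite sum_Sn; unfold plus; simpl plus.
    assert (0 < / INR (S (S n)) ^ 2)%R.
    { apply Rinv_0_lt_compat, pow_lt, lt_0_INR; lia. }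
    change (sum_n (fun n => / INR (S n) ^ 2)%R n
            <= sum_n (fun n => / INR (S n) ^ 2)%R n + / INR (S (S n)) ^ 2)%R; lra.
  - intros n; rewrite sum_n_rpsum; specialize (H n).
    assert (0 < / INR (S n))%R by (apply Rinv_0_lt_compat, lt_0_INR; lia); lra.
  - exists l; exact Hl.
Qed.

(* Sums over [Z] are taken symmetrically: [psum (sym g) (S N)] is the sum of
   [g] over the integers [n] with [|n| <= N]. *)
Definition sym (g : Z -> C) (n : nat) : C :=
  match n with
  | O => g 0%Z
  | S _ => g (Z.of_nat n) + g (- Z.of_nat n)%Z
  end.

(** The multiplication formula yields an even number of consecutive integers, a symmetric sum an odd
    number; one end term is left over. *)
Lemma psum_window (g : Z -> C) (N : nat) :
  psum (fun k => g (Z.of_nat k - Z.of_nat (S N))%Z) (2 * S N)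
  = psum (sym g) (S N) + g (- Z.of_nat (S N))%Z.
Proof.
  induction N as [|N IH].
  - simpl; ring.
  - replace (2 * S (S N))%nat with (S (S (2 * S N))) by lia.
    rewrite psum_first.
    change (psum (fun i => g (Z.of_nat (S i) - Z.of_nat (S (S N)))%Z) (S (2 * S N)))
      with (psum (fun i => g (Z.of_nat (S i) - Z.of_nat (S (S N)))%Z) (2 * S N)
            + g (Z.of_nat (S (2 * S N)) - Z.of_nat (S (S N)))%Z).
    rewrite (psum_ext _ (fun k => g (Z.of_nat k - Z.of_nat (S N))%Z)).
    + rewrite IH.
      change (psum (sym g) (S (S N))) with
        (psum (sym g) (S N) + (g (Z.of_nat (S N)) + g (- Z.of_nat (S N))%Z)).
      replace (Z.of_nat (S (2 * S N)) - Z.of_nat (S (S N)))%Z with (Z.of_nat (S N)) by lia.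
      replace (Z.of_nat 0 - Z.of_nat (S (S N)))%Z with (- Z.of_nat (S (S N)))%Z by lia.
      ring.
    + intros i _; f_equal; lia.
Qed.

Lemma sym_Cmod (g : Z -> C) (b : nat -> R) :
  (forall n : Z, (Cmod (g n) <= b (Z.abs_nat n))%R) ->
  forall n, (Cmod (sym g n) <= 2 * b n)%R.
Proof.
  intros H [|n]; simpl.
  - pose proof (H 0%Z) as H0; simpl in H0; pose proof (Cmod_ge_0 (g 0%Z)); lra.
  - eapply Rle_trans; [apply Cmod_triangle|].
    pose proof (H (Z.pos (Pos.of_succ_nat n))) as H1.
    pose proof (H (Z.neg (Pos.of_succ_nat n))) as H2.
    simpl in H1, H2; rewrite !SuccNat2Pos.id_succ in H1, H2; lra.
Qed.

(** A quantitative form of z not being an integer. It bounds all terms 1/(z + n) at once and covers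
    the upper half-plane as well as the real point 1/2. *)
Definition away (c : R) (z : C) : Prop :=
  (0 < c)%R /\ forall n : Z, (c * (1 + Rabs (IZR n)) <= Cmod (z + IZR n))%R.

Lemma INR_abs_nat (n : Z) : INR (S (Z.abs_nat n)) = (1 + Rabs (IZR n))%R.
Proof.
  rewrite S_INR, INR_IZR_INZ, Zabs2Nat.id_abs, abs_IZR; ring.
Qed.

Lemma away_Cmod_inv (c : R) (z : C) (n : Z) : away c z ->
  z + IZR n <> 0 /\ (Cmod (/ (z + IZR n)) <= / c * / INR (S (Z.abs_nat n)))%R.
Proof.
  intros [Hc H]; specialize (H n); rewrite <- INR_abs_nat in H.
  assert (P : (0 < INR (S (Z.abs_nat n)))%R) by (apply lt_0_INR; lia).
  assert (Pc : (0 < c * INR (S (Z.abs_nat n)))%R) by (apply Rmult_lt_0_compat; auto).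
  assert (N : z + IZR n <> 0) by (apply Cmod_gt_0; lra).
  split; auto; rewrite Cmod_inv, <- Rinv_mult by auto.
  apply Rinv_le_contravar; auto.
Qed.

Lemma inv_square_Cmod (c : R) (z : C) (n : Z) : away c z ->
  (Cmod (1 / ((z + IZR n) * (z + IZR n)))
   <= / c ^ 2 * / INR (S (Z.abs_nat n)) ^ 2)%R.
Proof.
  intros Ha; destruct (away_Cmod_inv c z n Ha) as [N H].
  replace (1 / ((z + IZR n) * (z + IZR n))) with (/ (z + IZR n) * / (z + IZR n))
    by (field; auto).
  rewrite Cmod_mult, <- !pow_inv, <- Rpow_mult_distr.
  simpl; rewrite Rmult_1_r; apply Rmult_le_compat; auto using Cmod_ge_0.
Qed.

Lemma filterlim_pow2 : filterlim (fun p => 2 ^ p)%nat eventually eventually.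
Proof.
  intros P [N HN]; exists N; intros n Hn; apply HN.
  pose proof (Nat.pow_gt_lin_r 2 n); lia.
Qed.

Lemma is_lim_seq_inv_pow2 (K : R) : is_lim_seq (fun p => K * / INR (2 ^ p))%R 0.
Proof.
  apply is_lim_seq_0_scal.
  apply is_lim_seq_ext with (fun n => (/ 2) ^ n)%R.
  - intros n; rewrite pow_INR, pow_inv; reflexivity.
  - apply is_lim_seq_geom; rewrite Rabs_pos_eq; lra.
Qed.

(** With M = 2^(p+1) and w_k = (z + k - 2^p)/M, both csc2 z and the window sum of 1/(z + n)^2 equal
    M^-2 times a sum over the w_k, of csc2 (w_k) and of 1/w_k^2 respectively. The M differences are
    at most K each, so the total error is K/M. *)
Lemma csum_csc2 (c : R) (z : C) : away c z -> qexp z <> 1 ->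
  csum (sym (fun n => 1 / ((z + IZR n) * (z + IZR n)))) (csc2 z).
Proof.
  intros Ha Hq; set (g := fun n : Z => 1 / ((z + IZR n) * (z + IZR n))).
  pose proof (fun n => inv_square_Cmod c z n Ha) as Hg.
  destruct (ex_csum (sym g) (fun n => 2 * (/ c ^ 2 * / INR (S n) ^ 2))%R) as [l Hl].
  { exact (sym_Cmod g (fun n => / c ^ 2 * / INR (S n) ^ 2)%R Hg). }
  { apply (@ex_series_scal R_AbsRing R_NormedModule 2%R).
    apply (@ex_series_scal R_AbsRing R_NormedModule (/ c ^ 2)%R), ex_series_inv_square. }
  destruct csc2_bounded as [K [HK Hb]].
  (* The windows tend to [l] along all N, so their limit along N = 2^p is enough to identify [l]. *)
  set (v := fun N => psum (fun k => g (Z.of_nat k - Z.of_nat N)%Z) (2 * N)).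
  assert (Hv : clim (fun p => v (2 ^ p)%nat) (csc2 z)).
  { destruct (INR_unbounded (4 * Rabs (Re z))) as [N0 HN0].
    apply clim_le with (2 := is_lim_seq_inv_pow2 K).
    (* From here on |Re z| <= M/4; with |k - 2^p| <= M/2 this puts every [w k] into the strip of
       [csc2_bounded]. *)
    exists N0; intros p Hp.
    assert (N2 : (2 ^ p <> 0)%nat) by (apply Nat.pow_nonzero; lia).
    assert (Hpos : (0 < INR (2 ^ p))%R) by (apply lt_0_INR; lia).
    set (M := INR (2 ^ S p)).
    assert (HM : M = (2 * INR (2 ^ p))%R).
    { unfold M; replace (2 ^ S p)%nat with (2 * 2 ^ p)%nat by (simpl; lia).
      rewrite mult_INR; simpl; ring. }
    assert (PM : (0 < M)%R) by lra.
    assert (NM : RtoC M <> 0) by (apply RtoC_neq; lra).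
    set (w := fun k : nat => (z + IZR (Z.of_nat k - Z.of_nat (2 ^ p))) / M).
    assert (Hwk : forall k, (k < 2 ^ S p)%nat -> w k <> 0 /\ (Rabs (Re (w k)) <= 3 / 4)%R).
    { intros k Hk; split.
      - unfold w, Cdiv; apply Cmult_neq_0; [apply (away_Cmod_inv c z _ Ha)|].
        intros E; apply (Cinv_r M) in NM; rewrite E, Cmult_0_r in NM.
        apply RtoC_inj in NM; lra.
      - unfold w; rewrite minus_IZR, <- !INR_IZR_INZ.
        replace (Re ((z + (INR k - INR (2 ^ p))%R) / M))
          with ((Re z + (INR k - INR (2 ^ p))) / M)%R.
        + unfold Rdiv; rewrite Rabs_mult, (Rabs_pos_eq (/ M)) by (apply Rlt_le, Rinv_0_lt_compat; auto).
          apply Rmult_le_reg_r with M; auto; rewrite Rmult_assoc, Rinv_l, Rmult_1_r by lra.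
          assert (HRz : (4 * Rabs (Re z) <= M)%R).
          { apply Rle_trans with (INR N0); [lra|]; unfold M; apply le_INR.
            pose proof (Nat.pow_gt_lin_r 2 (S p)); lia. }
          assert (Hk' : (INR k <= 2 * INR (2 ^ p))%R).
          { rewrite <- HM; apply le_INR; lia. }
          pose proof (pos_INR k).
          eapply Rle_trans; [apply Rabs_triang|].
          assert (Rabs (INR k - INR (2 ^ p)) <= M / 2)%R by (apply Rabs_le; lra); lra.
        + destruct z as [x y]; unfold Cdiv, Cinv, Cmult, Cplus, RtoC, Re; simpl; field; lra. }
    (* Periodicity moves z to z - 2^p first, which centres the window of indices at 0. *)
    assert (E1 : csc2 z = / (M * M) * psum (fun k => csc2 (w k)) (2 ^ S p)).
    { rewrite <- (csc2_periodic z (- Z.of_nat (2 ^ p))).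
      assert (H4 : INR (4 ^ S p) = (M * M)%R).
      { unfold M; rewrite <- mult_INR; f_equal; rewrite <- Nat.pow_mul_l; reflexivity. }
      assert (Hq' : qexp (z + IZR (- Z.of_nat (2 ^ p))) <> 1).
      { rewrite qexp_plus, qexp_IZR, Cmult_1_r; auto. }
      pose proof (csc2_multiplication (S p) _ Hq') as Hm; rewrite H4, RtoC_mult in Hm.
      rewrite (psum_ext _ (fun k => csc2 ((z + IZR (- Z.of_nat (2 ^ p)) + INR k) / INR (2 ^ S p)))).
      - rewrite Hm; field; auto.
      - intros k _; unfold w; f_equal; unfold Cdiv; f_equal.
        rewrite INR_IZR_INZ, <- Cplus_assoc, <- RtoC_plus, <- plus_IZR; do 3 f_equal; lia. }
    assert (E2 : v (2 ^ p)%nat = / (M * M) * psum (fun k => 1 / (w k * w k)) (2 ^ S p)).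
    { unfold v; replace (2 * 2 ^ p)%nat with (2 ^ S p)%nat by (simpl; lia).
      rewrite <- psum_scal; apply psum_ext; intros k Hk.
      unfold g, w; pose proof (proj1 (away_Cmod_inv c z (Z.of_nat k - Z.of_nat (2 ^ p)) Ha)).
      field; auto. }
    rewrite E1, E2.
    replace (/ (M * M) * psum (fun k => 1 / (w k * w k)) (2 ^ S p)
      - / (M * M) * psum (fun k => csc2 (w k)) (2 ^ S p)) with
      (/ (M * M) * - psum (fun k => csc2 (w k) - 1 / (w k * w k)) (2 ^ S p))
      by (rewrite psum_minus; ring).
    rewrite Cmod_mult, Cmod_opp, Cmod_inv, Cmod_mult, Cmod_R, Rabs_pos_eq
      by (try apply Cmult_neq_0; auto; lra).
    assert (HS : forall m, (m <= 2 ^ S p)%nat ->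
      (Cmod (psum (fun k => csc2 (w k) - 1 / (w k * w k))%C m) <= K * INR m)%R).
    { induction m as [|m IH]; intros Hm.
      - simpl; rewrite Cmod_0; lra.
      - cbn [psum]; eapply Rle_trans; [apply Cmod_triangle|].
        rewrite S_INR; destruct (Hwk m ltac:(lia)) as [W1 W2].
        specialize (Hb _ W2 W1); specialize (IH ltac:(lia)); lra. }
    specialize (HS _ (le_n _)); fold M in HS.
    apply Rle_trans with (/ (M * M) * (K * M))%R.
    - apply Rmult_le_compat_l; auto; apply Rlt_le, Rinv_0_lt_compat; nra.
    - replace (/ (M * M) * (K * M))%R with (K * / M)%R by (field; lra).
      apply Rmult_le_compat_l; auto; apply Rinv_le_contravar; lra. }
  assert (Hv' : clim v l).
  { apply clim_incr_1.
    apply clim_ext with (fun N => psum (sym g) (S N) + g (- Z.of_nat (S N))%Z).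
    { intros N; symmetry; apply psum_window. }
    replace l with (l + 0) by ring; apply clim_plus; [apply clim_incr_1, Hl|].
    apply clim_le with (fun n => / c ^ 2 * / INR (S (S n)) ^ 2)%R.
    - exists 0%nat; intros n _; replace (g (- Z.of_nat (S n))%Z - 0)
        with (g (- Z.of_nat (S n))%Z) by ring.
      eapply Rle_trans; [apply Hg|]; right; do 4 f_equal; lia.
    - apply is_lim_seq_0_scal.
      apply (is_lim_seq_incr_1 (fun n => / INR (S n) ^ 2)%R 0).
      apply ex_series_lim_0, ex_series_inv_square. }
  rewrite (clim_unique _ _ _ Hv (clim_comp _ _ _ filterlim_pow2 Hv')); exact Hl.
Qed.

Lemma away_half : away (/ 4) (/ 2).
Proof.
  split; [lra|]; intros n.
  assert (E : / 2 + IZR n = RtoC (/ 2 + IZR n)%R).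
  { rewrite RtoC_plus, RtoC_inv; auto; lra. }
  rewrite E, Cmod_R.
  destruct (Z_le_gt_dec 0 n) as [H|H].
  - apply IZR_le in H; rewrite !Rabs_pos_eq; lra.
  - assert (H' : (n <= -1)%Z) by lia; apply IZR_le in H'.
    rewrite !Rabs_left1; lra.
Qed.

(** At z = 1/2 the expansion of csc2 reads pi^2 = 2 O, where O is the sum of 4/(2k+1)^2. Splitting
    the sum Z of 1/n^2 into odd and even n gives Z = O/4 + Z/4, hence 3 Z = O. *)
Lemma zeta2_value : csum (fun n => 1 / (INR (S n) * INR (S n))) (PI * PI / 6).
Proof.
  pose proof C2_neq_0 as N2.
  assert (Hm1 : RtoC (-1) <> 1) by (apply RtoC_neq; lra).
  pose proof (csum_csc2 _ _ away_half) as H; rewrite qexp_half in H; specialize (H Hm1).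
  assert (E : csc2 (/ 2) = PI * PI).
  { unfold csc2; rewrite qexp_half.
    replace (1 - -1) with (RtoC 2) by (rewrite <- RtoC_minus; f_equal; ring).
    replace (RtoC 4) with (2 * 2) by (rewrite <- RtoC_mult; f_equal; ring).
    replace (RtoC (-1)) with (- (1)) by (rewrite <- RtoC_opp; auto).
    field; auto. }
  rewrite E in H; clear E Hm1.
  set (o := fun k : nat => 4 / ((2 * INR k + 1) * (2 * INR k + 1))).
  assert (No : forall k : nat, 2 * INR k + 1 <> 0).
  { intros k; rewrite <- RtoC_mult, <- RtoC_plus; apply RtoC_neq; pose proof (pos_INR k); lra. }
  assert (Nh : forall n : Z, / 2 + IZR n <> 0) by (intros n; apply (away_Cmod_inv _ _ n away_half)).
  assert (E1 : forall N, psum (sym (fun n => 1 / ((/ 2 + IZR n) * (/ 2 + IZR n)))) (S N)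
                         = psum o (S N) + psum o N).
  { induction N as [|N IH].
    - simpl; unfold o; simpl INR; field; repeat split; auto; try apply RtoC_neq; try lra.
    - change (psum (sym (fun n => 1 / ((/ 2 + IZR n) * (/ 2 + IZR n)))) (S (S N))) with
        (psum (sym (fun n => 1 / ((/ 2 + IZR n) * (/ 2 + IZR n)))) (S N)
         + (1 / ((/ 2 + IZR (Z.of_nat (S N))) * (/ 2 + IZR (Z.of_nat (S N))))
         + 1 / ((/ 2 + IZR (- Z.of_nat (S N))) * (/ 2 + IZR (- Z.of_nat (S N)))))).
      rewrite IH.
      change (psum o (S (S N))) with (psum o (S N) + o (S N)).
      change (psum o (S N)) with (psum o N + o N).
      pose proof (Nh (Z.of_nat (S N))) as N3; pose proof (Nh (- Z.of_nat (S N))%Z) as N4.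
      pose proof (No N) as N5; pose proof (No (S N)) as N6.
      assert (A1 : 1 / ((/ 2 + IZR (Z.of_nat (S N))) * (/ 2 + IZR (Z.of_nat (S N)))) = o (S N)).
      { revert N3 N6; unfold o; rewrite <- INR_IZR_INZ; generalize (RtoC (INR (S N))); intros x N3 N6.
        replace (RtoC 4) with (2 * 2) by (rewrite <- RtoC_mult; f_equal; ring).
        replace (/ 2 + x) with ((2 * x + 1) / 2) by (field; auto); field; auto. }
      assert (A2 : 1 / ((/ 2 + IZR (- Z.of_nat (S N))) * (/ 2 + IZR (- Z.of_nat (S N)))) = o N).
      { revert N4 N5; unfold o; rewrite opp_IZR, <- INR_IZR_INZ, S_INR, RtoC_opp, RtoC_plus.
        generalize (RtoC (INR N)); intros x N4 N5.
        replace (RtoC 4) with (2 * 2) by (rewrite <- RtoC_mult; f_equal; ring).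
        replace (/ 2 + - (x + 1)) with (- (2 * x + 1) / 2) by (field; auto); field; auto. }
      rewrite A1, A2; ring. }
  assert (Bo : forall n, (Cmod (o n) <= 4 * / INR (S n) ^ 2)%R).
  { intros n; unfold o; rewrite Cmod_div, Cmod_mult by (apply Cmult_neq_0; auto).
    rewrite <- RtoC_mult, <- RtoC_plus, !Cmod_R, S_INR; pose proof (pos_INR n).
    rewrite !Rabs_pos_eq by lra; unfold Rdiv; apply Rmult_le_compat_l; [lra|].
    apply Rinv_le_contravar; nra. }
  destruct (ex_csum o _ Bo) as [O HO].
  { apply (@ex_series_scal R_AbsRing R_NormedModule 4%R), ex_series_inv_square. }
  assert (EO : O + O = PI * PI).
  { apply clim_unique with (fun N => psum o (S N) + psum o N).
    - apply clim_plus; [apply clim_incr_1|]; exact HO.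
    - apply clim_incr_1 in H; apply clim_ext with (2 := H); intros; apply E1. }
  set (z := fun n : nat => 1 / (INR (S n) * INR (S n))).
  assert (Bz : forall n, (Cmod (z n) <= / INR (S n) ^ 2)%R).
  { intros n; unfold z; pose proof (lt_0_INR (S n) ltac:(lia)).
    rewrite Cmod_div, Cmod_1, Cmod_mult, Cmod_R, Rabs_pos_eq
      by (try apply Cmult_neq_0; try (apply CINR_neq_0; lia); lra).
    unfold Rdiv; rewrite Rmult_1_l; right; f_equal; ring. }
  destruct (ex_csum z _ Bz ex_series_inv_square) as [Z HZ].
  assert (E2 : forall N, psum z (2 * N) = / 4 * psum o N + / 4 * psum z N).
  { assert (N4 : RtoC 4 <> 0) by (apply RtoC_neq; lra).
    induction N as [|N IH]; [simpl; ring|].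
    replace (2 * S N)%nat with (S (S (2 * N))) by lia.
    change (psum z (S (S (2 * N)))) with (psum z (2 * N) + z (2 * N)%nat + z (S (2 * N))).
    rewrite IH; cbn [psum].
    assert (A1 : z (2 * N)%nat = / 4 * o N).
    { unfold z, o; replace (RtoC (INR (S (2 * N)))) with (2 * INR N + 1).
      - pose proof (No N); field; auto.
      - rewrite S_INR, mult_INR, RtoC_plus, RtoC_mult; reflexivity. }
    assert (A2 : z (S (2 * N)) = / 4 * z N).
    { unfold z; replace (RtoC (INR (S (S (2 * N))))) with (2 * INR (S N)).
      - pose proof (CINR_neq_0 (S N) ltac:(lia)).
        replace (RtoC 4) with (2 * 2) by (rewrite <- RtoC_mult; f_equal; ring).
        field; auto.
      - rewrite !S_INR, mult_INR, <- RtoC_mult; f_equal; simpl; ring. }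
    rewrite A1, A2; ring. }
  assert (EZ : Z = / 4 * O + / 4 * Z).
  { apply clim_unique with (fun N => psum z (2 * N)).
    - apply (clim_comp (psum z) Z (fun N => 2 * N)%nat); auto.
      intros P [N HN]; exists N; intros n Hn; apply HN; lia.
    - apply clim_ext with (fun N => / 4 * psum o N + / 4 * psum z N);
        [intros; symmetry; apply E2|].
      apply clim_plus; apply clim_scal; auto. }
  replace (PI * PI / 6) with Z; auto.
  rewrite <- EO.
  assert (N4 : RtoC 4 <> 0) by (apply RtoC_neq; lra).
  assert (N3 : RtoC 3 <> 0) by (apply RtoC_neq; lra).
  assert (N6 : RtoC 6 <> 0) by (apply RtoC_neq; lra).
  replace (RtoC 6) with (2 * 3) by (rewrite <- RtoC_mult; f_equal; ring).
  assert (E3 : 3 * Z = O).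
  { replace (RtoC 3) with (4 - 1) by (rewrite <- RtoC_minus; f_equal; ring).
    replace O with (4 * (/ 4 * O + / 4 * Z) - Z) by (field; auto).
    rewrite <- EZ; ring. }
  rewrite <- E3; field; auto.
Qed.

(** * Partial fractions of the cotangent *)

(** The real mean value theorem along the segment, applied to [p] composed with F, where [p] is the
    real or the imaginary part. *)
Lemma cderiv_zero_segment (F : C -> C) (a b : C) :
  (forall t : R, (0 <= t <= 1)%R -> cderiv F (a + t * (b - a)) 0) -> F b = F a.
Proof.
  intros H; set (path := fun t : R => a + t * (b - a)).
  assert (HD : forall (p : C -> R), (forall x, Rabs (p x) <= Cmod x)%R ->
     (forall x y, p (x - y) = (p x - p y)%R) ->
     forall t : R, (0 <= t <= 1)%R -> is_derive (fun s => p (F (path s))) t 0%R).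
  { intros p Hp1 Hp2 t Ht; apply is_derive_Reals; intros eps He.
    pose proof (Cmod_ge_0 (b - a)) as P0.
    destruct (H t Ht (eps / (2 * (Cmod (b - a) + 1)))%R) as [d [Hd Hw]].
    { apply Rdiv_lt_0_compat; lra. }
    assert (Hd' : (0 < d / (Cmod (b - a) + 1))%R) by (apply Rdiv_lt_0_compat; lra).
    exists (mkposreal _ Hd'); intros h Hh0 Hh; simpl in Hh.
    assert (E : path (t + h)%R - path t = h * (b - a)).
    { unfold path; rewrite RtoC_plus; ring. }
    assert (Hs : (Cmod (path (t + h)%R - path t) < d)%R).
    { rewrite E, Cmod_mult, Cmod_R.
      apply Rle_lt_trans with (Rabs h * (Cmod (b - a) + 1))%R.
      - apply Rmult_le_compat_l; [apply Rabs_pos | lra].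
      - apply Rmult_lt_compat_r with (r := (Cmod (b - a) + 1)%R) in Hh; [|lra].
        replace (d / (Cmod (b - a) + 1) * (Cmod (b - a) + 1))%R with d in Hh by (field; lra).
        auto. }
    specialize (Hw _ Hs); fold (path t) in Hw.
    replace (F (path (t + h)%R) - F (path t) - 0 * (path (t + h)%R - path t))
      with (F (path (t + h)%R) - F (path t)) in Hw by ring.
    rewrite E, Cmod_mult, Cmod_R in Hw.
    rewrite Rminus_0_r; unfold Rdiv; rewrite Rabs_mult, Rabs_inv, <- Hp2.
    apply Rabs_pos_lt in Hh0.
    apply Rle_lt_trans with (eps / (2 * (Cmod (b - a) + 1)) * Cmod (b - a))%R.
    - apply Rmult_le_reg_r with (Rabs h); auto.
      rewrite Rmult_assoc, Rinv_l, Rmult_1_r by lra.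
      eapply Rle_trans; [apply Hp1|]; lra.
    - apply Rle_lt_trans with (eps / (2 * (Cmod (b - a) + 1)) * (Cmod (b - a) + 1))%R.
      + apply Rmult_le_compat_l; [|lra]; apply Rlt_le, Rdiv_lt_0_compat; lra.
      + replace (eps / (2 * (Cmod (b - a) + 1)) * (Cmod (b - a) + 1))%R with (eps / 2)%R
          by (field; lra); lra. }
  assert (HM : forall (p : C -> R), (forall x, Rabs (p x) <= Cmod x)%R ->
     (forall x y, p (x - y) = (p x - p y)%R) -> p (F b) = p (F a)).
  { intros p Hp1 Hp2.
    destruct (MVT_gen (fun s => p (F (path s))) 0 1 (fun _ => 0%R)) as [c [_ Ec]].
    - intros x Hx; rewrite Rmin_left, Rmax_right in Hx by lra; apply HD; auto; lra.
    - intros x Hx; rewrite Rmin_left, Rmax_right in Hx by lra.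
      apply continuity_pt_filterlim, (@ex_derive_continuous R_AbsRing R_NormedModule).
      exists 0%R; apply HD; auto.
    - replace (path 1%R) with b in Ec by (unfold path; ring).
      replace (path 0%R) with a in Ec by (unfold path; ring).
      lra. }
  rewrite (surjective_pairing (F b)), (surjective_pairing (F a)); f_equal.
  - apply (HM Re); [apply re_le_Cmod | reflexivity].
  - apply (HM Im); [apply im_le_Cmod | reflexivity].
Qed.

(** One lower bound is linear in m and the other in |n|; using each for two of four factors bounds a
    product below by a multiple of m^2 (1 + |n|)^2, which separates the variables. *)
Lemma upper_half_lattice (tau : C) : upper_half tau ->
  exists c : R, (0 < c)%R /\ forall (m : R) (n : Z), (1 <= m)%R ->
    (c * m <= Cmod (m * tau + IZR n))%R /\
    (c * (1 + Rabs (IZR n)) <= Cmod (m * tau + IZR n))%R.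
Proof.
  intros Ht; unfold upper_half in Ht.
  set (x := Re tau); set (y := Im tau) in *.
  pose proof (Rabs_pos x) as Px.
  (* From |n| <= |w| + m |x| and m y <= |w| follows 1 + |n| <= k |w|, where w = m tau + n. *)
  set (k := (1 + (2 + Rabs x) / y)%R).
  assert (Pk : (0 < k)%R) by (unfold k; assert (0 < (2 + Rabs x) / y)%R by (apply Rdiv_lt_0_compat; lra); lra).
  exists (Rmin y (/ k)); split; [apply Rmin_pos; auto; apply Rinv_0_lt_compat; auto|].
  intros m n Hm; set (w := m * tau + IZR n).
  assert (Ew1 : Im w = (m * y)%R).
  { unfold w, y; destruct tau as [a b]; unfold Cplus, Cmult, RtoC, Im; simpl; ring. }
  assert (Ew2 : Re w = (m * x + IZR n)%R).
  { unfold w, x; destruct tau as [a b]; unfold Cplus, Cmult, RtoC, Re; simpl; ring. }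
  pose proof (im_le_Cmod w) as H1; pose proof (re_le_Cmod w) as H2.
  rewrite Ew1 in H1; rewrite Ew2 in H2; rewrite Rabs_pos_eq in H1 by nra.
  split.
  - eapply Rle_trans; [apply Rmult_le_compat_r; [lra | apply Rmin_l]|]; lra.
  - eapply Rle_trans; [apply Rmult_le_compat_r; [pose proof (Rabs_pos (IZR n)); lra | apply Rmin_r]|].
    apply Rmult_le_reg_l with k; auto; rewrite <- Rmult_assoc, Rinv_r, Rmult_1_l by lra.
    assert (Hn : (Rabs (IZR n) <= Cmod w + m * Rabs x)%R).
    { replace (IZR n) with ((m * x + IZR n) + - (m * x))%R by ring.
      eapply Rle_trans; [apply Rabs_triang|].
      rewrite Rabs_Ropp, Rabs_mult, (Rabs_pos_eq m) by lra; lra. }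
    assert (Hmk : (m * (2 + Rabs x) <= (2 + Rabs x) / y * Cmod w)%R).
    { replace (m * (2 + Rabs x))%R with ((2 + Rabs x) / y * (m * y))%R by (field; lra).
      apply Rmult_le_compat_l; auto; apply Rlt_le, Rdiv_lt_0_compat; lra. }
    unfold k; nra.
Qed.

Lemma away_upper_half (z : C) : upper_half z -> exists c, away c z.
Proof.
  intros Hz; destruct (upper_half_lattice z Hz) as [c [Hc H]].
  exists c; split; auto; intros n.
  replace (z + IZR n) with (1%R * z + IZR n) by ring; apply H; lra.
Qed.

Lemma Cmod_qexp_lt_1 (z : C) : upper_half z -> (Cmod (qexp z) < 1)%R.
Proof.
  intros Hz; rewrite Cmod_qexp, <- exp_0; apply exp_increasing.
  unfold upper_half in Hz; pose proof PI_RGT_0; nra.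
Qed.

Lemma qexp_neq_1 (z : C) : upper_half z -> qexp z <> 1.
Proof. intros Hz E; pose proof (Cmod_qexp_lt_1 z Hz) as H; rewrite E, Cmod_1 in H; lra. Qed.

Definition cot_series (z : C) : C := CSeries (sym (fun n => 1 / (z + IZR n))).

(** Pairing n with -n gives 2z/((z + n)(z - n)), of order 1/n^2; this is what makes the symmetric
    order of summation converge. *)
Lemma cot_series_correct (c : R) (z : C) : away c z ->
  csum (sym (fun n => 1 / (z + IZR n))) (cot_series z).
Proof.
  intros Ha; pose proof (fun n => away_Cmod_inv c z n Ha) as H.
  assert (Pc : (0 < c)%R) by apply Ha.
  destruct (ex_csum (sym (fun n => 1 / (z + IZR n)))
     (fun n => 2 * Cmod z * (/ c ^ 2) * / INR (S n) ^ 2)%R) as [l Hl].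
  - assert (Hz : (0 <= Cmod z)%R) by apply Cmod_ge_0.
    intros n; destruct n as [|n].
    + simpl sym; pose proof (H 0%Z) as [N0 B0]; rewrite Cplus_0_r in N0, B0 |- *.
      simpl INR in B0 |- *; replace (1 / z) with (/ z * / z * z) by (field; auto).
      rewrite !Cmod_mult; rewrite Rinv_1, Rmult_1_r in B0.
      rewrite pow1, Rinv_1, Rmult_1_r, <- pow_inv; simpl; rewrite Rmult_1_r.
      assert (Cmod (/ z) * Cmod (/ z) <= / c * / c)%R
        by (apply Rmult_le_compat; auto using Cmod_ge_0).
      assert (0 <= / c * / c)%R by (apply Rle_trans with (2 := H0); apply Rmult_le_pos; apply Cmod_ge_0).
      nra.
    + cbn [sym]; destruct (H (Z.of_nat (S n))) as [N1 B1], (H (- Z.of_nat (S n))%Z) as [N2 B2].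
      replace (Z.abs_nat (Z.of_nat (S n))) with (S n) in B1 by lia.
      replace (Z.abs_nat (- Z.of_nat (S n))) with (S n) in B2 by lia.
      rewrite opp_IZR, RtoC_opp in *; set (x := RtoC (IZR (Z.of_nat (S n)))) in *.
      replace (1 / (z + x) + 1 / (z + - x)) with (2 * z * (/ (z + x) * / (z + - x)))
        by (field; auto).
      rewrite !Cmod_mult, Cmod_R, Rabs_pos_eq, Rmult_assoc by lra.
      replace (2 * Cmod z * / c ^ 2 * / INR (S (S n)) ^ 2)%R with
        (2 * (Cmod z * ((/ c * / INR (S (S n))) * (/ c * / INR (S (S n))))))%R
        by (pose proof (lt_0_INR (S (S n)) ltac:(lia)); field; lra).
      apply Rmult_le_compat_l; [lra|]; apply Rmult_le_compat_l; auto.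
      apply Rmult_le_compat; auto using Cmod_ge_0.
  - apply (@ex_series_scal R_AbsRing R_NormedModule (2 * Cmod z * / c ^ 2)%R), ex_series_inv_square.
  - unfold cot_series; rewrite (csum_CSeries _ _ Hl); exact Hl.
Qed.

Lemma away_near (c : R) (z w : C) :
  away c z -> (Cmod (w - z) <= c / 2)%R -> away (c / 2) w.
Proof.
  intros [Hc H] Hw; split; [lra|]; intros n; specialize (H n).
  pose proof (Cmod_minus_ge (z + IZR n) (- (w - z))) as H1.
  replace (z + IZR n - - (w - z)) with (w + IZR n) in H1 by ring; rewrite Cmod_opp in H1.
  pose proof (Rabs_pos (IZR n)); nra.
Qed.

(** Term by term the remainder is exactly (w - z)^2 / ((z + n)^2 (w + n)), whose sum over n is at
    most K |w - z|^2 with K independent of w. *)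
Lemma cderiv_cot_series (c : R) (z : C) : away c z -> qexp z <> 1 ->
  cderiv cot_series z (- csc2 z).
Proof.
  intros Ha Hq; assert (Pc : (0 < c)%R) by apply Ha.
  set (K := Series (fun n => 2 * (2 / c ^ 3) * / INR (S n) ^ 2)%R).
  apply cderiv_quad with (c / 2)%R K; [lra|]; intros w Hw.
  assert (Haw : away (c / 2) w) by (apply away_near with z; auto; lra).
  set (h := fun n : Z => (w - z) * (w - z) * (/ (z + IZR n) * / (z + IZR n) * / (w + IZR n))).
  assert (Hs : csum (sym h) (cot_series w - cot_series z - - csc2 z * (w - z))).
  { apply csum_ext with (fun n => sym (fun n => 1 / (w + IZR n)) n
      - sym (fun n => 1 / (z + IZR n)) n
      + (w - z) * sym (fun n => 1 / ((z + IZR n) * (z + IZR n))) n).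
    - assert (E : forall n : Z, 1 / (w + IZR n) - 1 / (z + IZR n)
        + (w - z) * (1 / ((z + IZR n) * (z + IZR n))) = h n).
      { intros n; unfold h; pose proof (proj1 (away_Cmod_inv _ _ n Ha)).
        pose proof (proj1 (away_Cmod_inv _ _ n Haw)); field; auto. }
      intros [|n]; cbn [sym]; rewrite <- !E; ring.
    - replace (cot_series w - cot_series z - - csc2 z * (w - z)) with
        (cot_series w - cot_series z + (w - z) * csc2 z) by ring.
      apply csum_plus; [apply csum_minus; eapply cot_series_correct; eauto|].
      apply csum_scal; eapply csum_csc2; eauto. }
  assert (EK : ex_series (fun n => 2 * (2 / c ^ 3) * / INR (S n) ^ 2)%R).
  { apply (@ex_series_scal R_AbsRing R_NormedModule (2 * (2 / c ^ 3))%R), ex_series_inv_square. }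
  assert (P2 : (0 <= Cmod (w - z) ^ 2)%R) by apply pow2_ge_0.
  eapply Rle_trans.
  - apply csum_Cmod_le with (1 := Hs)
      (B := fun n => (Cmod (w - z) ^ 2 * (2 * (2 / c ^ 3) * / INR (S n) ^ 2))%R).
    + assert (Hh : forall n : Z, (Cmod (h n) <=
         Cmod (w - z) ^ 2 * (2 / c ^ 3) * / INR (S (Z.abs_nat n)) ^ 2)%R).
      { intros n; unfold h; destruct (away_Cmod_inv _ _ n Ha) as [_ B1].
        destruct (away_Cmod_inv _ _ n Haw) as [_ B2]; rewrite !Cmod_mult.
        assert (Px : (1 <= INR (S (Z.abs_nat n)))%R) by (apply (le_INR 1); lia).
        set (x := INR (S (Z.abs_nat n))) in *.
        assert (B3 : (Cmod (/ (w + IZR n)) <= 2 / c)%R).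
        { eapply Rle_trans; [apply B2|].
          replace (2 / c)%R with (/ (c / 2) * / 1)%R by (field; lra).
          apply Rmult_le_compat_l; [apply Rlt_le, Rinv_0_lt_compat; lra|].
          apply Rinv_le_contravar; lra. }
        replace (Cmod (w - z) ^ 2 * (2 / c ^ 3) * / x ^ 2)%R with
          (Cmod (w - z) * Cmod (w - z) * ((/ c * / x) * (/ c * / x) * (2 / c)))%R by (field; lra).
        apply Rmult_le_compat_l; [nra|].
        repeat apply Rmult_le_compat; auto using Cmod_ge_0; apply Rmult_le_pos; apply Cmod_ge_0. }
      intros n; pose proof (sym_Cmod h (fun n => Cmod (w - z) ^ 2 * (2 / c ^ 3) * / INR (S n) ^ 2)%R Hh n).
      simpl in H |- *; lra.
    + apply (@ex_series_scal R_AbsRing R_NormedModule (Cmod (w - z) ^ 2)%R), EK.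
  - rewrite Series_scal_l; fold K; lra.
Qed.

(** This is pi cot (pi z). *)
Definition cot_q (z : C) : C := PI * Ci * ((qexp z + 1) / (qexp z - 1)).

Lemma cderiv_cot_q (z : C) : qexp z <> 1 -> cderiv cot_q z (- csc2 z).
Proof.
  intros Hq; assert (N : qexp z - 1 <> 0) by (apply Cminus_neq_0; auto).
  assert (N' : 1 - qexp z <> 0) by (apply Cminus_neq_0; auto).
  assert (E : Ci * Ci = - (1)) by (unfold Cmult, Ci, Copp, RtoC; simpl; f_equal; ring).
  pose proof (cderiv_qexp z) as Hd.
  pose proof (cderiv_plus _ _ _ _ _ Hd (cderiv_const 1 z)) as H1.
  pose proof (cderiv_minus _ _ _ _ _ Hd (cderiv_const 1 z)) as H2.
  pose proof (cderiv_comp Cinv (fun w => qexp w - 1) _ _ _ (cderiv_inv _ N) H2) as H3.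
  pose proof (cderiv_scal (PI * Ci) _ _ _ (cderiv_mult _ _ _ _ _ H1 H3)) as H4.
  unfold cot_q, Cdiv.
  replace (- csc2 z) with (PI * Ci * ((2 * PI * Ci * qexp z + 0) * / (qexp z - 1)
    + (qexp z + 1) * (- / ((qexp z - 1) * (qexp z - 1)) * (2 * PI * Ci * qexp z - 0)))).
  { exact H4. }
  unfold csc2; generalize dependent (qexp z); intros q Hq N N' _ _ _ _ _.
  transitivity (Ci * Ci * (- (4 * PI * PI) * (q / ((1 - q) * (1 - q))))).
  - field; auto.
  - rewrite E; ring.
Qed.

(** The terms of n and -1 - n cancel, so the sum over |n| <= N reduces to its last term 1/(N +
    1/2). *)
Lemma cot_series_half : cot_series (/ 2) = 0.
Proof.
  apply csum_unique with (1 := cot_series_correct _ _ away_half).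
  pose proof C2_neq_0 as N2.
  assert (No : forall k : nat, 2 * INR k + 1 <> 0).
  { intros k; rewrite <- RtoC_mult, <- RtoC_plus; apply RtoC_neq; pose proof (pos_INR k); lra. }
  assert (Nh : forall n : Z, / 2 + IZR n <> 0) by (intros n; apply (away_Cmod_inv _ _ n away_half)).
  assert (E : forall N, psum (sym (fun n => 1 / (/ 2 + IZR n))) (S N) = 2 / (2 * INR N + 1)).
  { induction N as [|N IH].
    - simpl; field; repeat split; auto; try apply RtoC_neq; try lra.
    - change (psum (sym (fun n => 1 / (/ 2 + IZR n))) (S (S N))) with
        (psum (sym (fun n => 1 / (/ 2 + IZR n))) (S N)
         + (1 / (/ 2 + IZR (Z.of_nat (S N))) + 1 / (/ 2 + IZR (- Z.of_nat (S N))))).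
      rewrite IH.
      pose proof (Nh (Z.of_nat (S N))) as N3; pose proof (Nh (- Z.of_nat (S N))%Z) as N4.
      pose proof (No N) as N5; pose proof (No (S N)) as N6.
      assert (A1 : 1 / (/ 2 + IZR (Z.of_nat (S N))) = 2 / (2 * INR (S N) + 1)).
      { revert N3 N6; rewrite <- INR_IZR_INZ; generalize (RtoC (INR (S N))); intros x N3 N6.
        replace (/ 2 + x) with ((2 * x + 1) / 2) by (field; auto); field; auto. }
      assert (A2 : 1 / (/ 2 + IZR (- Z.of_nat (S N))) = - (2 / (2 * INR N + 1))).
      { revert N4 N5; rewrite opp_IZR, <- INR_IZR_INZ, S_INR, RtoC_opp, RtoC_plus.
        generalize (RtoC (INR N)); intros x N4 N5.
        replace (/ 2 + - (x + 1)) with (- (2 * x + 1) / 2) by (field; auto); field; auto. }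
      rewrite A1, A2; ring. }
  apply clim_incr_1; apply clim_ext with (fun N => 2 / (2 * INR N + 1)); [intros; symmetry; apply E|].
  apply clim_incr_1.
  apply clim_le with (fun N => 2 * / INR (S N))%R.
  - exists 0%nat; intros n _.
    replace (2 / (2 * INR (S n) + 1) - 0) with (2 / (2 * INR (S n) + 1)) by ring.
    rewrite Cmod_div, <- RtoC_mult, <- RtoC_plus, !Cmod_R by auto.
    pose proof (lt_0_INR (S n) ltac:(lia)); rewrite !Rabs_pos_eq by lra.
    apply Rmult_le_compat_l; [lra|]; apply Rinv_le_contravar; lra.
  - apply is_lim_seq_0_scal; apply (is_lim_seq_incr_1 (fun n => / INR n)%R 0).
    apply (is_lim_seq_inv INR p_infty); [apply is_lim_seq_INR | discriminate].
Qed.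

Lemma cot_q_half : cot_q (/ 2) = 0.
Proof.
  unfold cot_q; rewrite qexp_half.
  replace (-1 + 1) with (RtoC 0) by (rewrite <- RtoC_plus; f_equal; ring).
  unfold Cdiv; ring.
Qed.

(** Both sides have derivative -csc2 and both vanish at 1/2. The segment from 1/2 to z lies in the
    upper half-plane except for its starting point, so it meets no pole. *)
Lemma csum_cot (z : C) : upper_half z ->
  csum (sym (fun n => 1 / (z + IZR n))) (cot_q z).
Proof.
  intros Hz; destruct (away_upper_half z Hz) as [c Hc].
  pose proof (cot_series_correct c z Hc) as H.
  enough (E : cot_series z - cot_q z = cot_series (/ 2) - cot_q (/ 2)).
  { rewrite cot_series_half, cot_q_half in E.
    replace (cot_q z) with (cot_series z - (cot_series z - cot_q z)) by ring.
    rewrite E; replace (cot_series z - (0 - 0)) with (cot_series z) by ring; exact H. }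
  apply (cderiv_zero_segment (fun w => cot_series w - cot_q w)).
  intros t Ht; set (w := / 2 + t * (z - / 2)).
  replace (RtoC 0) with (- csc2 w - - csc2 w) by ring.
  assert (Hw : exists c', away c' w /\ qexp w <> 1).
  { destruct (Req_dec t 0) as [E|N].
    - replace w with (/ 2) by (unfold w; rewrite E; ring).
      exists (/ 4)%R; split; [apply away_half | rewrite qexp_half; apply RtoC_neq; lra].
    - assert (Uw : upper_half w).
      { unfold upper_half in *; replace (Im w) with (t * Im z)%R; [nra|].
        unfold w; rewrite <- RtoC_inv by lra; destruct z as [x y].
        unfold Cminus, Cplus, Copp, Cmult, RtoC, Im; simpl; ring. }
      destruct (away_upper_half w Uw) as [c' Hc']; exists c'; split; auto.
      apply qexp_neq_1, Uw. }
  destruct Hw as [c' [Hc' Hq]].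
  apply cderiv_minus; [eapply cderiv_cot_series; eauto | apply cderiv_cot_q; auto].
Qed.

(** * Transformation of E_2 under inversion *)

Lemma Cpow_lim_0 (x : C) : (Cmod x < 1)%R -> clim (fun n => x ^ n) 0.
Proof.
  intros Hx; apply clim_le with (fun n => Cmod x ^ n)%R.
  - exists 0%nat; intros n _; replace (x ^ n - 0) with (x ^ n) by ring.
    rewrite Cmod_pow; lra.
  - apply is_lim_seq_geom; rewrite Rabs_pos_eq; auto; apply Cmod_ge_0.
Qed.

Lemma one_minus_neq_0 (x : C) : (Cmod x < 1)%R -> 1 - x <> 0.
Proof. intros Hx; apply Cminus_neq_0; intros E; rewrite <- E, Cmod_1 in Hx; lra. Qed.

Lemma csum_geom (x : C) : (Cmod x < 1)%R -> csum (fun n => x ^ n) (1 / (1 - x)).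
Proof.
  intros Hx; pose proof (one_minus_neq_0 x Hx) as N.
  apply clim_ext with (fun n => / (1 - x) * (1 - x ^ n)).
  - intros n; induction n as [|n IH]; [simpl; ring|].
    cbn [psum]; rewrite <- IH; simpl; field; auto.
  - replace (1 / (1 - x)) with (/ (1 - x) * (1 - 0)) by (field; auto).
    apply clim_scal, clim_minus; [apply clim_const | apply Cpow_lim_0, Hx].
Qed.

(** Obtained as x times the Cauchy square of the geometric series. *)
Lemma csum_geom_deriv (x : C) : (Cmod x < 1)%R ->
  csum (fun n => INR (S n) * x ^ S n) (x / ((1 - x) * (1 - x))).
Proof.
  intros Hx; pose proof (one_minus_neq_0 x Hx) as N.
  assert (HG : ex_series (fun n => Cmod x ^ n)%R).
  { apply ex_series_geom; rewrite Rabs_pos_eq; auto; apply Cmod_ge_0. }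
  assert (HB : forall n, (Cmod (x ^ n) <= Cmod x ^ n)%R) by (intros; rewrite Cmod_pow; lra).
  pose proof (csum_mult _ _ _ _ _ _ HB HB HG HG (csum_geom x Hx) (csum_geom x Hx)) as H.
  apply (csum_scal x) in H.
  replace (x / ((1 - x) * (1 - x))) with (x * (1 / (1 - x) * (1 / (1 - x)))) by (field; auto).
  apply csum_ext with (2 := H); intros n.
  assert (E : fps_mul (fun m => x ^ m) (fun m => x ^ m) n = INR (S n) * x ^ n).
  { unfold fps_mul; rewrite sum_n_psum, (psum_ext _ (fun _ => x ^ n)).
    - generalize (S n) as m; induction m as [|m IH]; [simpl; ring|].
      cbn [psum]; rewrite IH, S_INR, RtoC_plus; ring.
    - intros i Hi; rewrite <- Cpow_add_r; f_equal; lia. }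
  change (x * fps_mul (fun m => x ^ m) (fun m => x ^ m) n = INR (S n) * x ^ S n).
  rewrite E; simpl Cpow; ring.
Qed.

Lemma series_geom_deriv (r : R) : (0 <= r < 1)%R ->
  is_series (fun n => INR (S n) * r ^ S n)%R (r / ((1 - r) * (1 - r)))%R.
Proof.
  intros Hr; assert (Hx : (Cmod r < 1)%R) by (rewrite Cmod_R, Rabs_pos_eq; lra).
  pose proof (csum_Re _ _ (csum_geom_deriv r Hx)) as H.
  replace (r / ((1 - r) * (1 - r)))%R with (Re (r / ((1 - r) * (1 - r)))).
  - apply is_series_ext with (2 := H); intros n.
    rewrite <- RtoC_pow, <- RtoC_mult; reflexivity.
  - rewrite <- RtoC_minus, <- RtoC_mult, <- RtoC_div; [reflexivity|].
    apply Rgt_not_eq; nra.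
Qed.

Lemma pow_S_le_base (r : R) (n : nat) : (0 <= r <= 1)%R -> (r ^ S n <= r)%R.
Proof.
  intros Hr; rewrite <- (Rmult_1_r r) at 2; simpl; apply Rmult_le_compat_l; [lra|].
  rewrite <- (pow1 n); apply pow_incr; auto.
Qed.

Lemma Cmod_pow_lt_1 (x : C) (n : nat) : (Cmod x < 1)%R -> (Cmod (x ^ S n) < 1)%R.
Proof.
  intros H; rewrite Cmod_pow; pose proof (Cmod_ge_0 x).
  pose proof (pow_S_le_base (Cmod x) n); lra.
Qed.

Lemma ex_series_geom_scal (r K : R) : (0 <= r < 1)%R ->
  ex_series (fun i => K * r ^ S i)%R.
Proof.
  intros Hr; apply (@ex_series_scal R_AbsRing R_NormedModule K).
  apply (ex_series_ext (fun i => r * r ^ i)%R); [reflexivity|].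
  apply (@ex_series_scal R_AbsRing R_NormedModule r), ex_series_geom.
  rewrite Rabs_pos_eq; lra.
Qed.

Lemma one_minus_pow_inv_sq (x : C) (i : nat) : (Cmod x < 1)%R ->
  (Cmod x ^ S i / ((1 - Cmod x ^ S i) * (1 - Cmod x ^ S i))
   <= / ((1 - Cmod x) * (1 - Cmod x)) * Cmod x ^ S i)%R.
Proof.
  intros Hx; pose proof (Cmod_ge_0 x) as P.
  pose proof (pow_S_le_base (Cmod x) i ltac:(lra)).
  assert (0 <= Cmod x ^ S i)%R by (apply pow_le; auto).
  unfold Rdiv; rewrite Rmult_comm; apply Rmult_le_compat_r; auto.
  apply Rinv_le_contravar; nra.
Qed.

Definition csc2_series (tau : C) : C := CSeries (fun i => csc2 (INR (S i) * tau)).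

(** Both series sum the double series of n q^(mn) over m, n >= 1: summing over n first gives csc2 (m
    tau) up to the factor -4 pi^2, summing over m first gives the Lambert series of E_2. *)
Lemma csum_csc2_series (tau : C) : upper_half tau ->
  csum (fun i => csc2 (INR (S i) * tau)) (csc2_series tau) /\
  csum (fun m => INR (S m) * qexp tau ^ S m / (1 - qexp tau ^ S m))
    (csc2_series tau / - (4 * PI * PI)).
Proof.
  intros Ht; pose proof (Cmod_qexp_lt_1 tau Ht) as Hq.
  set (q := qexp tau) in *; set (r := Cmod q) in *.
  assert (Pr : (0 <= r < 1)%R) by (split; [apply Cmod_ge_0 | auto]).
  pose proof CPI_neq_0 as NP.
  assert (N4 : - (4 * PI * PI) <> 0).
  { rewrite <- !RtoC_mult, <- RtoC_opp; apply RtoC_neq; pose proof PI_RGT_0; nra. }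
  assert (Ec : forall i, csc2 (INR (S i) * tau) =
     - (4 * PI * PI) * (q ^ S i / ((1 - q ^ S i) * (1 - q ^ S i)))).
  { intros i; unfold csc2; rewrite qexp_nat; reflexivity. }
  set (c := fun i j : nat => INR (S j) * (q ^ S i) ^ S j).
  assert (HB : forall i N, (Cmod (psum (c i) N) <= / ((1 - r) * (1 - r)) * r ^ S i)%R).
  { intros i N.
    assert (Hri : (0 <= r ^ S i < 1)%R).
    { split; [apply pow_le; lra|]; pose proof (pow_S_le_base r i); lra. }
    eapply Rle_trans; [|apply one_minus_pow_inv_sq; auto].
    fold r; pose proof (series_geom_deriv _ Hri) as HS.
    rewrite <- (is_series_unique _ _ HS).
    eapply Rle_trans; [|apply (rpsum_le_Series _ N)].
    - apply psum_Cmod; intros j; unfold c; rewrite Cmod_mult, Cmod_R, !Cmod_pow.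
      rewrite Rabs_pos_eq by apply pos_INR; fold r; lra.
    - eexists; exact HS.
    - intros j; apply Rmult_le_pos; [apply pos_INR | apply pow_le; lra]. }
  assert (Hex : ex_series (fun i => / ((1 - r) * (1 - r)) * r ^ S i)%R)
    by (apply ex_series_geom_scal; auto).
  assert (Hr : forall i, csum (c i) (q ^ S i / ((1 - q ^ S i) * (1 - q ^ S i)))).
  { intros i; apply csum_geom_deriv, Cmod_pow_lt_1, Hq. }
  assert (Hl : exists l, csum (fun i => q ^ S i / ((1 - q ^ S i) * (1 - q ^ S i))) l).
  { apply (ex_csum _ (fun i => / ((1 - r) * (1 - r)) * r ^ S i)%R); auto.
    intros i; apply clim_Cmod_le with (1 := Hr i) (B := fun _ => (/ ((1 - r) * (1 - r)) * r ^ S i)%R).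
    - exists 0%nat; intros n _; apply HB.
    - apply is_lim_seq_const. }
  destruct Hl as [l Hl].
  assert (HX : csum (fun i => csc2 (INR (S i) * tau)) (- (4 * PI * PI) * l)).
  { apply csum_ext with (2 := csum_scal (- (4 * PI * PI)) _ _ Hl); intros; rewrite Ec; auto. }
  unfold csc2_series; rewrite (csum_CSeries _ _ HX); split; auto.
  replace (- (4 * PI * PI) * l / - (4 * PI * PI)) with l by (field; auto).
  apply (csum_swap c (fun i => q ^ S i / ((1 - q ^ S i) * (1 - q ^ S i))) _ _ _ Hex HB Hr); auto.
  intros j.
  pose proof (csum_scal (INR (S j) * q ^ S j) _ _ (csum_geom _ (Cmod_pow_lt_1 q j Hq))) as H.
  pose proof (one_minus_neq_0 _ (Cmod_pow_lt_1 q j Hq)) as Nj.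
  replace (INR (S j) * q ^ S j / (1 - q ^ S j)) with
    (INR (S j) * q ^ S j * (1 / (1 - q ^ S j))) by (field; auto).
  apply csum_ext with (2 := H); intros i; unfold c.
  rewrite <- Cmult_assoc, <- Cpow_S, <- !Cpow_mult_r; do 2 f_equal; lia.
Qed.

Lemma E2_csc2_series (tau : C) : upper_half tau ->
  E2 tau = 1 + 6 / (PI * PI) * csc2_series tau.
Proof.
  intros Ht; destruct (csum_csc2_series tau Ht) as [_ H].
  unfold E2; rewrite (csum_CSeries _ _ H).
  pose proof CPI_neq_0.
  replace (RtoC 24) with (4 * 6) by (rewrite <- RtoC_mult; f_equal; ring).
  assert (RtoC 4 <> 0) by (apply RtoC_neq; lra).
  field; auto.
Qed.

Lemma upper_half_S (tau : C) : upper_half tau -> upper_half (- / tau).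
Proof.
  unfold upper_half; destruct tau as [x y]; unfold Cinv, Copp, Im; simpl; intros H.
  replace (- (- y / (x * (x * 1) + y * (y * 1))))%R with (y / (x * x + y * y))%R
    by (field; apply Rgt_not_eq; nra).
  apply Rdiv_lt_0_compat; nra.
Qed.

Lemma upper_half_neq_0 (tau : C) : upper_half tau -> tau <> 0.
Proof. unfold upper_half; intros H E; rewrite E in H; simpl in H; lra. Qed.

Lemma upper_half_scal (x : R) (tau : C) : (0 < x)%R -> upper_half tau -> upper_half (x * tau).
Proof.
  unfold upper_half; destruct tau as [a b]; unfold Cmult, RtoC, Im; simpl; intros; nra.
Qed.

(** As q^N tends to 0, cot_q tends to pi i (0 + 1)/(0 - 1). This nonzero value is the source of the
    extra term in the law of E_2. *)
Lemma cot_q_limit (z : C) : upper_half z ->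
  clim (fun N => cot_q (INR (S N) * z)) (- (PI * Ci)).
Proof.
  intros Hz; pose proof (Cmod_qexp_lt_1 z Hz) as Hq; set (q := qexp z) in *.
  apply clim_ext with (fun N => PI * Ci * ((q ^ S N + 1) * / (q ^ S N - 1))).
  { intros N; unfold cot_q; rewrite qexp_nat; reflexivity. }
  assert (H0 : clim (fun n => q ^ S n) 0) by (apply (clim_incr_1 (fun n => q ^ n)), Cpow_lim_0, Hq).
  assert (Hi : clim (fun n => / (q ^ S n - 1)) (- (1))).
  { apply clim_le with (fun n => / (1 - Cmod q) * Cmod q ^ S n)%R.
    - exists 0%nat; intros n _; set (x := q ^ S n).
      assert (Hx : (Cmod x < 1)%R) by (apply Cmod_pow_lt_1, Hq).
      pose proof (one_minus_neq_0 x Hx) as N1.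
      replace (/ (x - 1) - - (1)) with (- (/ (1 - x) * x)).
      + rewrite Cmod_opp, Cmod_mult, Cmod_inv by auto.
        unfold x at 2; rewrite Cmod_pow; apply Rmult_le_compat_r.
        { apply pow_le, Cmod_ge_0. }
        apply Rinv_le_contravar; [lra|].
        pose proof (Cmod_minus_ge 1 x) as H; rewrite Cmod_1 in H.
        assert (Cmod x <= Cmod q)%R; [|lra].
        unfold x; rewrite Cmod_pow; apply pow_S_le_base; pose proof (Cmod_ge_0 q); lra.
      + assert (x - 1 <> 0).
        { intros E; apply N1; replace (1 - x) with (- (x - 1)) by ring; rewrite E; ring. }
        field; auto.
    - apply is_lim_seq_0_scal; apply (is_lim_seq_incr_1 (fun n => Cmod q ^ n)%R 0).
      apply is_lim_seq_geom; rewrite Rabs_pos_eq; auto; apply Cmod_ge_0. }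
  replace (- (PI * Ci)) with (PI * Ci * ((0 + 1) * - (1))) by ring.
  apply clim_scal, clim_mult; auto; apply clim_plus; auto using clim_const.
Qed.

Section Lattice.

Context (tau : C) (Ht : upper_half tau).

Let row (i : nat) : C := INR (S i) * tau.
Let sq (i : nat) (n : Z) : C := 1 / ((row i + IZR n) * (row i + IZR n)).
(* [1 / (z^2 - 1)] telescopes along rows and differs from [1 / z^2] by an
   absolutely summable term. *)
Let tel (i : nat) (n : Z) : C := 1 / ((row i + IZR n) * (row i + IZR n) - 1).
(** The boundary terms of the telescoping sums. *)
Let rho (N i : nat) : C := 1 / (row i + INR N) - 1 / (row i - INR N).

Lemma row_upper_half (i : nat) : upper_half (row i).
Proof. apply upper_half_scal; auto; apply lt_0_INR; lia. Qed.

Lemma row_neq_0 (i : nat) (n : Z) : row i + IZR n <> 0.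
Proof.
  intros E; pose proof (row_upper_half i) as H; unfold upper_half in H.
  assert (Im (row i + IZR n) = Im (row i)).
  { destruct (row i); unfold Cplus, RtoC, Im; simpl; ring. }
  rewrite <- H0, E in H; apply (Rlt_irrefl 0), H.
Qed.

Lemma row_shift_neq_0 (i : nat) (n : Z) : (row i + IZR n) * (row i + IZR n) - 1 <> 0.
Proof.
  replace ((row i + IZR n) * (row i + IZR n) - 1) with
    ((row i + IZR (n + 1)) * (row i + IZR (n - 1)))
    by (rewrite plus_IZR, minus_IZR, RtoC_plus, RtoC_minus; ring).
  apply Cmult_neq_0; apply row_neq_0.
Qed.

Lemma row_neq_0_plus (i N : nat) : row i + INR N <> 0.
Proof. rewrite INR_IZR_INZ; apply row_neq_0. Qed.

Lemma row_neq_0_minus (i N : nat) : row i - INR N <> 0.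
Proof.
  pose proof (row_neq_0 i (- Z.of_nat N)) as H.
  rewrite opp_IZR, RtoC_opp, <- INR_IZR_INZ in H; exact H.
Qed.

(** Since 1/(x^2 - 1) = (1/(x - 1) - 1/(x + 1))/2 telescopes in steps of two, each end of the range
    keeps two terms; hence both [rho N] and [rho (S N)]. *)
Lemma psum_tel (i N : nat) :
  psum (sym (tel i)) (S N) = - / 2 * (rho N i + rho (S N) i).
Proof.
  pose proof C2_neq_0 as N2.
  induction N as [|N IH].
  - pose proof (row_neq_0_plus i 1) as A1; pose proof (row_neq_0_minus i 1) as A2.
    pose proof (row_shift_neq_0 i 0) as A3; pose proof (row_neq_0_minus i 0) as A0.
    simpl psum; unfold tel, rho; simpl INR in *.
    replace (row i + 0) with (row i) in * by ring; replace (row i - 0) with (row i) in * by ring.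
    field; repeat split; auto.
  - change (psum (sym (tel i)) (S (S N))) with
      (psum (sym (tel i)) (S N) + (tel i (Z.of_nat (S N)) + tel i (- Z.of_nat (S N))%Z)).
    rewrite IH.
    pose proof (row_shift_neq_0 i (Z.of_nat (S N))) as B1.
    pose proof (row_shift_neq_0 i (- Z.of_nat (S N))) as B2.
    pose proof (row_neq_0_plus i N) as B3; pose proof (row_neq_0_minus i N) as B4.
    pose proof (row_neq_0_plus i (S N)) as B5; pose proof (row_neq_0_minus i (S N)) as B6.
    pose proof (row_neq_0_plus i (S (S N))) as B7; pose proof (row_neq_0_minus i (S (S N))) as B8.
    assert (A1 : tel i (Z.of_nat (S N)) = / 2 * (1 / (row i + INR N) - 1 / (row i + INR (S (S N))))).
    { unfold tel; rewrite <- INR_IZR_INZ, !S_INR in *; rewrite !RtoC_plus in *.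
      field; repeat split; auto. }
    assert (A2 : tel i (- Z.of_nat (S N)) = / 2 * (1 / (row i - INR (S (S N))) - 1 / (row i - INR N))).
    { unfold tel; rewrite opp_IZR, RtoC_opp, <- INR_IZR_INZ, !S_INR in *; rewrite !RtoC_plus in *.
      field; repeat split; auto. }
    rewrite A1, A2; unfold rho; field; repeat split; auto.
Qed.

(** For w = -N/tau, 1/(m tau + N) - 1/(m tau - N) is -1/tau times 1/(w + m) + 1/(w - m): the sum
    over m is the cotangent series at w without its central term. *)
Lemma csum_rho (N : nat) :
  csum (rho (S N)) (- / tau * (cot_q (INR (S N) * - / tau) - 1 / (INR (S N) * - / tau))).
Proof.
  pose proof (upper_half_neq_0 tau Ht) as Nt.
  assert (PN : RtoC (INR (S N)) <> 0) by (apply CINR_neq_0; lia).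
  assert (Hw : upper_half (INR (S N) * - / tau))
    by (apply upper_half_scal; [apply lt_0_INR; lia | apply upper_half_S, Ht]).
  pose proof (csum_cot _ Hw) as H; set (w := INR (S N) * - / tau) in *.
  replace (cot_q w) with (sym (fun n => 1 / (w + IZR n)) 0 + (cot_q w - 1 / w)) in H
    by (simpl sym; rewrite Cplus_0_r; ring).
  apply csum_first, (csum_scal (- / tau)) in H.
  apply csum_ext with (2 := H); intros i; cbn [sym].
  pose proof (row_neq_0_plus i (S N)) as B5; pose proof (row_neq_0_minus i (S N)) as B6.
  unfold rho; rewrite opp_IZR, RtoC_opp, <- INR_IZR_INZ.
  replace (w + INR (S i)) with ((row i - INR (S N)) / tau) by (unfold w, row; field; auto).
  replace (w + - INR (S i)) with (- (row i + INR (S N)) / tau) by (unfold w, row; field; auto).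
  field; repeat split; auto.
Qed.

(** For fixed i the terms [rho N i] tend to 0 with N, yet their sums over i do not: the two limits
    fail to commute by exactly this amount. *)
Lemma csum_rho_limit : exists s : nat -> C,
  (forall N, csum (rho N) (s N)) /\ clim s (PI * Ci / tau).
Proof.
  pose proof (upper_half_neq_0 tau Ht) as Nt.
  exists (fun N => match N with
    | O => RtoC 0
    | S n => - / tau * (cot_q (INR (S n) * - / tau) - 1 / (INR (S n) * - / tau))
    end); split.
  - intros [|N]; [|apply csum_rho].
    apply csum_ext with (fun _ => 0); [|apply csum_0].
    intros i; unfold rho; simpl INR; rewrite Cplus_0_r; replace (row i - 0) with (row i) by ring; ring.
  - apply clim_incr_1.
    replace (PI * Ci / tau) with (- / tau * (- (PI * Ci) - 0)) by (field; auto).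
    apply clim_scal, clim_minus; [apply cot_q_limit, upper_half_S, Ht|].
    apply clim_le with (fun n => Cmod tau * / INR (S n))%R.
    + exists 0%nat; intros n _.
      assert (Pn : RtoC (INR (S n)) <> 0) by (apply CINR_neq_0; lia).
      replace (1 / (INR (S n) * - / tau) - 0) with (- (tau * / INR (S n))) by (field; auto).
      rewrite Cmod_opp, Cmod_mult, Cmod_inv, Cmod_R, Rabs_pos_eq; auto; [lra | apply pos_INR].
    + apply is_lim_seq_0_scal; apply (is_lim_seq_incr_1 (fun n => / INR n)%R 0).
      apply (is_lim_seq_inv INR p_infty); [apply is_lim_seq_INR | discriminate].
Qed.

Lemma csum_tel (i : nat) : csum (sym (tel i)) 0.
Proof.
  destruct (away_upper_half _ (row_upper_half i)) as [c Hc].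
  assert (H0 : clim (fun N => rho N i) 0).
  { apply clim_le with (fun N => 2 * / c * / INR (S N))%R.
    - exists 0%nat; intros N _.
      destruct (away_Cmod_inv _ _ (Z.of_nat N) Hc) as [A1 B1].
      destruct (away_Cmod_inv _ _ (- Z.of_nat N) Hc) as [A2 B2].
      replace (Z.abs_nat (Z.of_nat N)) with N in B1 by lia.
      replace (Z.abs_nat (- Z.of_nat N)) with N in B2 by lia.
      rewrite opp_IZR, RtoC_opp in *; rewrite <- INR_IZR_INZ in *.
      unfold rho; replace (1 / (row i + INR N) - 1 / (row i - INR N) - 0) with
        (/ (row i + INR N) + - / (row i + - INR N)) by (unfold Cminus in *; field; auto).
      eapply Rle_trans; [apply Cmod_triangle|]; rewrite Cmod_opp; lra.
    - apply is_lim_seq_0_scal; apply (is_lim_seq_incr_1 (fun n => / INR n)%R 0).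
      apply (is_lim_seq_inv INR p_infty); [apply is_lim_seq_INR | discriminate]. }
  apply clim_incr_1; apply clim_ext with (fun N => - / 2 * (rho N i + rho (S N) i)).
  - intros N; symmetry; apply psum_tel.
  - replace (RtoC 0) with (- / 2 * (0 + 0)) by ring; apply clim_scal, clim_plus; auto.
    apply (clim_incr_1 (fun N => rho N i)), H0.
Qed.

(** Column 0 is the sum of 1/m^2 divided by tau^2. Columns n and -n together are tau^-2 times the
    expansion of csc2 at w = -n/tau without its term 1/w^2, and 1/(w^2 tau^2) = 1/n^2. *)
Lemma csum_columns (N : nat) :
  csum (fun i => psum (sym (sq i)) (S N))
    (PI * PI / 6 / (tau * tau)
     + psum (fun n => csc2 (INR (S n) * - / tau) / (tau * tau)
                      - 1 / (INR (S n) * INR (S n))) N).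
Proof.
  pose proof (upper_half_neq_0 tau Ht) as Nt.
  assert (PS : forall i, RtoC (INR (S i)) <> 0) by (intros; apply CINR_neq_0; lia).
  set (k := fun n => match n with
    | O => PI * PI / 6 / (tau * tau)
    | S m => csc2 (INR (S m) * - / tau) / (tau * tau) - 1 / (INR (S m) * INR (S m))
    end).
  change (csum (fun i => psum (sym (sq i)) (S N)) (k O + psum (fun n => k (S n)) N)).
  rewrite <- psum_first; apply (csum_psum (fun i n => sym (sq i) n)); intros [|n]; cbn [sym k].
  - replace (PI * PI / 6 / (tau * tau)) with (/ (tau * tau) * (PI * PI / 6))
      by (unfold Cdiv; ring).
    apply csum_ext with (2 := csum_scal (/ (tau * tau)) _ _ zeta2_value); intros i.
    unfold sq, row; rewrite Cplus_0_r; field; auto.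
  - assert (Hw : upper_half (INR (S n) * - / tau))
      by (apply upper_half_scal; [apply lt_0_INR; lia | apply upper_half_S, Ht]).
    destruct (away_upper_half _ Hw) as [c Hc].
    pose proof (csum_csc2 _ _ Hc (qexp_neq_1 _ Hw)) as H.
    set (w := INR (S n) * - / tau) in *.
    replace (csc2 w) with (sym (fun n => 1 / ((w + IZR n) * (w + IZR n))) 0
      + (csc2 w - 1 / (w * w))) in H by (simpl sym; rewrite Cplus_0_r; ring).
    apply csum_first, (csum_scal (/ (tau * tau))) in H.
    replace (csc2 w / (tau * tau) - 1 / (INR (S n) * INR (S n))) with
      (/ (tau * tau) * (csc2 w - 1 / (w * w))).
    + apply csum_ext with (2 := H); intros i; cbn [sym].
      pose proof (row_neq_0_plus i (S n)) as B5; pose proof (row_neq_0_minus i (S n)) as B6.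
      unfold sq; rewrite !opp_IZR, !RtoC_opp, <- !INR_IZR_INZ.
      replace (w + INR (S i)) with ((row i - INR (S n)) / tau) by (unfold w, row; field; auto).
      replace (w + - INR (S i)) with (- (row i + INR (S n)) / tau) by (unfold w, row; field; auto).
      unfold Cminus in *; field; repeat split; auto.
    + unfold w; field; auto.
Qed.

Lemma csc2_series_S :
  csc2_series tau - PI * Ci / tau =
  PI * PI / 6 / (tau * tau) + csc2_series (- / tau) / (tau * tau) - PI * PI / 6.
Proof.
  pose proof (upper_half_neq_0 tau Ht) as Nt.
  destruct csum_rho_limit as [s [Hs Hl]].
  destruct (upper_half_lattice tau Ht) as [c [Hc Hlat]].
  destruct (csum_csc2_series tau Ht) as [HX _].
  destruct (csum_csc2_series _ (upper_half_S _ Ht)) as [HX' _].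
  set (h := fun (i : nat) (n : Z) => sq i n - tel i n).
  set (Z2 := Series (fun n => / INR (S n) ^ 2)%R).
  set (g := fun N => PI * PI / 6 / (tau * tau)
     + psum (fun n => csc2 (INR (S n) * - / tau) / (tau * tau)
                      - 1 / (INR (S n) * INR (S n))) N).
  assert (Hsym : forall i n, sym (h i) n = sym (sq i) n - sym (tel i) n).
  { intros i [|n]; cbn [sym]; unfold h; ring. }
  (* The difference is -1/(z^2 (z - 1)(z + 1)). The two factors z are bounded below by c (1 + |n|),
     the factors z - 1 and z + 1 by c m. *)
  assert (Hh : forall i n, (Cmod (h i n) <=
     (/ c ^ 4 * / INR (S i) ^ 2) * / INR (S (Z.abs_nat n)) ^ 2)%R).
  { intros i n; unfold h, sq, tel; set (z := row i + IZR n).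
    assert (Hm : (1 <= INR (S i))%R) by (apply (le_INR 1); lia).
    destruct (Hlat (INR (S i)) n Hm) as [_ L1].
    destruct (Hlat (INR (S i)) (n + 1)%Z Hm) as [L2 _].
    destruct (Hlat (INR (S i)) (n - 1)%Z Hm) as [L3 _].
    fold (row i) in L1, L2, L3; fold z in L1; rewrite <- INR_abs_nat in L1.
    pose proof (row_neq_0 i n) as N1; fold z in N1.
    pose proof (row_shift_neq_0 i n) as N2; fold z in N2.
    replace (1 / (z * z) - 1 / (z * z - 1)) with (- / (z * z * (z * z - 1))) by (field; auto).
    assert (E : z * z - 1 = (row i + IZR (n + 1)) * (row i + IZR (n - 1))).
    { unfold z; rewrite plus_IZR, minus_IZR, RtoC_plus, RtoC_minus; ring. }
    rewrite Cmod_opp, Cmod_inv by (repeat apply Cmult_neq_0; auto).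
    rewrite E, !Cmod_mult.
    set (x := INR (S i)) in *; set (y := INR (S (Z.abs_nat n))) in *.
    assert (Py : (0 < y)%R) by (apply lt_0_INR; lia).
    replace (/ c ^ 4 * / x ^ 2 * / y ^ 2)%R with
      (/ ((c * y) * (c * y) * ((c * x) * (c * x))))%R by (field; lra).
    assert (0 < c * y)%R by (apply Rmult_lt_0_compat; auto).
    assert (0 < c * x)%R by (apply Rmult_lt_0_compat; lra).
    apply Rinv_le_contravar; [repeat apply Rmult_lt_0_compat; auto; lra|].
    repeat apply Rmult_le_compat; auto; try lra; repeat apply Rmult_le_pos; lra. }
  (* Tannery with the rows cut at |n| <= N: full rows give csc2 (m tau) - 0, while for fixed N the
     sum over m consists of columns of 1/z^2 and of the boundary terms. *)
  assert (Hlim : clim (fun N => g N + / 2 * (s N + s (S N))) (csc2_series tau)).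
  { apply (tannery (fun N i => psum (sym (h i)) (S N)) (fun i => csc2 (INR (S i) * tau))
             (fun i => 2 * / c ^ 4 * Z2 * / INR (S i) ^ 2)%R); auto.
    - apply (@ex_series_scal R_AbsRing R_NormedModule (2 * / c ^ 4 * Z2)%R), ex_series_inv_square.
    - intros N i.
      eapply Rle_trans.
      + apply psum_Cmod; apply (sym_Cmod (h i) (fun n => / c ^ 4 * / INR (S i) ^ 2 * / INR (S n) ^ 2)%R).
        apply Hh.
      + assert (P0 : (0 <= / c ^ 4 * / INR (S i) ^ 2)%R).
        { apply Rmult_le_pos; apply Rlt_le, Rinv_0_lt_compat, pow_lt; auto; apply lt_0_INR; lia. }
        eapply Rle_trans; [apply rpsum_le_Series|].
        * apply (ex_series_ext (fun n => (2 * (/ c ^ 4 * / INR (S i) ^ 2)) * / INR (S n) ^ 2)%R).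
          { intros; simpl; ring. }
          apply (@ex_series_scal R_AbsRing R_NormedModule (2 * (/ c ^ 4 * / INR (S i) ^ 2))%R),
            ex_series_inv_square.
        * intros n; assert (0 <= / INR (S n) ^ 2)%R.
          { apply Rlt_le, Rinv_0_lt_compat, pow_lt, lt_0_INR; lia. }
          repeat apply Rmult_le_pos; auto; try lra.
          -- apply Rlt_le, Rinv_0_lt_compat, pow_lt; auto.
          -- apply Rlt_le, Rinv_0_lt_compat, pow_lt, lt_0_INR; lia.
        * rewrite (Series_ext _ (fun n => (2 * (/ c ^ 4 * / INR (S i) ^ 2)) * / INR (S n) ^ 2)%R)
            by (intros; ring).
          rewrite Series_scal_l; fold Z2; right; ring.
    - intros i; apply (clim_incr_1 (psum (sym (h i)))).
      destruct (away_upper_half _ (row_upper_half i)) as [c' Hc'].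
      replace (csc2 (INR (S i) * tau)) with (csc2 (row i) - 0) by (unfold row; ring).
      apply csum_ext with (fun n => sym (sq i) n - sym (tel i) n); [intros; symmetry; apply Hsym|].
      apply csum_minus; [|apply csum_tel].
      apply (csum_csc2 _ _ Hc'), qexp_neq_1, row_upper_half.
    - intros N.
      apply csum_ext with (fun i => psum (sym (sq i)) (S N) + / 2 * (rho N i + rho (S N) i)).
      + intros i; rewrite (psum_ext (sym (h i)) (fun n => sym (sq i) n - sym (tel i) n))
          by (intros; apply Hsym).
        rewrite psum_minus, psum_tel; ring.
      + apply csum_plus; [apply csum_columns|]; apply csum_scal, csum_plus; apply Hs. }
  assert (Hg : clim g (PI * PI / 6 / (tau * tau)
      + (csc2_series (- / tau) / (tau * tau) - PI * PI / 6))).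
  { apply clim_plus; [apply clim_const|].
    apply (csum_minus (fun n => csc2 (INR (S n) * - / tau) / (tau * tau))); [|apply zeta2_value].
    replace (csc2_series (- / tau) / (tau * tau)) with (/ (tau * tau) * csc2_series (- / tau))
      by (unfold Cdiv; ring).
    apply csum_ext with (2 := csum_scal (/ (tau * tau)) _ _ HX'); intros; unfold Cdiv; ring. }
  assert (Hl' : clim (fun N => / 2 * (s N + s (S N))) (/ 2 * (PI * Ci / tau + PI * Ci / tau))).
  { apply clim_scal, clim_plus; auto; apply (clim_incr_1 s), Hl. }
  rewrite (clim_unique _ _ _ Hlim (clim_plus _ _ _ _ Hg Hl')).
  pose proof C2_neq_0; assert (RtoC 6 <> 0) by (apply RtoC_neq; lra).
  field; repeat split; auto.
Qed.

End Lattice.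

(** The two terms pi^2/6 of [csc2_series_S] account for the constant term 1 of E_2 on both sides,
    and -6 i/pi = 12/(2 pi i). *)
Lemma E2_S (tau : C) : upper_half tau ->
  E2 (- / tau) = tau ^ 2 * E2 tau + 12 / (2 * PI * Ci) * tau.
Proof.
  intros Ht; pose proof (upper_half_neq_0 tau Ht) as Nt.
  rewrite !E2_csc2_series by (auto using upper_half_S).
  pose proof (csc2_series_S tau Ht) as H.
  pose proof C2_neq_0 as N2; pose proof CPI_neq_0 as NP; pose proof Ci_neq_0 as NI.
  assert (N6 : RtoC 6 <> 0) by (apply RtoC_neq; lra).
  assert (E : Ci * Ci = - (1)) by (unfold Cmult, Ci, Copp, RtoC; simpl; f_equal; ring).
  replace (RtoC 12) with (2 * 6) by (rewrite <- RtoC_mult; f_equal; ring).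
  assert (EX : csc2_series (- / tau) = tau * tau * (csc2_series tau - PI * Ci / tau + PI * PI / 6)
    - PI * PI / 6) by (rewrite H; field; auto).
  rewrite EX.
  transitivity (tau ^ 2 * (1 + 6 / (PI * PI) * csc2_series tau) - 6 * Ci * tau / PI).
  - simpl; field; auto.
  - assert (E' : 2 * 6 / (2 * PI * Ci) * tau = - (6 * Ci * tau / PI)).
    { transitivity (- (Ci * Ci) * (2 * 6 / (2 * PI * Ci) * tau)); [rewrite E; ring | field; auto]. }
    rewrite E'; ring.
Qed.

(** * Functions with a q-expansion *)

Definition has_qseries (f : C -> C) (a : nat -> C) : Prop :=
  forall tau, upper_half tau -> csum (fun n => a n * qexp tau ^ n) (f tau).

Definition summable_in_disc (a : nat -> C) : Prop :=
  forall r : R, (0 <= r < 1)%R -> ex_series (fun n => Cmod (a n) * r ^ n)%R.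

Lemma qexp_radius (r : R) : (0 < r < 1)%R ->
  exists tau, upper_half tau /\ Cmod (qexp tau) = r.
Proof.
  intros Hr; pose proof PI_RGT_0 as HP.
  assert (Hl : (ln r < 0)%R) by (rewrite <- ln_1; apply ln_increasing; lra).
  exists (0%R, (- ln r / (2 * PI))%R); split.
  - unfold upper_half, Im; simpl; apply Rdiv_lt_0_compat; lra.
  - rewrite Cmod_qexp; unfold Im; simpl.
    replace (- (2 * PI * (- ln r / (2 * PI))))%R with (ln r) by (field; lra).
    apply exp_ln; lra.
Qed.

(** Abel's argument: convergence at a point with |q| = s, where r < s < 1, bounds |a_n| s^n, and
    then (r/s)^n dominates. *)
Lemma has_qseries_summable (f : C -> C) (a : nat -> C) :
  has_qseries f a -> summable_in_disc a.
Proof.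
  intros H r Hr; set (s := ((1 + r) / 2)%R).
  assert (Hs : (0 < s < 1)%R) by (unfold s; lra).
  destruct (qexp_radius s Hs) as [tau [Ht Es]]; specialize (H tau Ht).
  assert (H0 : clim (fun n => a n * qexp tau ^ n) 0).
  { apply clim_ext with
      (fun n => psum (fun n => a n * qexp tau ^ n) (S n) - psum (fun n => a n * qexp tau ^ n) n).
    - intros; cbn [psum]; ring.
    - replace (RtoC 0) with (f tau - f tau) by ring.
      apply clim_minus; [apply clim_incr_1|]; exact H. }
  apply clim_Cmod in H0; rewrite Cmod_0 in H0.
  destruct (@filterlim_bounded R_AbsRing R_NormedModule
    (fun n => Cmod (a n * qexp tau ^ n))) as [K HK]; [exists 0%R; exact H0|].
  assert (HK' : forall n, (Cmod (a n) * s ^ n <= K)%R).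
  { intros n; rewrite <- Es, <- Cmod_pow, <- Cmod_mult.
    eapply Rle_trans; [apply Rle_abs | apply (HK n)]. }
  apply (@ex_series_le R_AbsRing R_CompleteNormedModule _ (fun n => K * (r / s) ^ n)%R).
  - intros n.
    assert (Pn : (0 <= Cmod (a n) * r ^ n)%R)
      by (apply Rmult_le_pos; [apply Cmod_ge_0 | apply pow_le; lra]).
    change (Rabs (Cmod (a n) * r ^ n) <= K * (r / s) ^ n)%R; rewrite Rabs_pos_eq by auto.
    unfold Rdiv; rewrite Rpow_mult_distr, pow_inv.
    assert (Ps : (0 < s ^ n)%R) by (apply pow_lt; lra).
    replace (Cmod (a n) * r ^ n)%R with ((Cmod (a n) * s ^ n) * (r ^ n * / s ^ n))%R
      by (field; lra).
    apply Rmult_le_compat_r; auto.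
    apply Rmult_le_pos; [apply pow_le; lra | apply Rlt_le, Rinv_0_lt_compat; auto].
  - apply (@ex_series_scal R_AbsRing R_NormedModule K), ex_series_geom.
    rewrite Rabs_pos_eq.
    + apply Rmult_lt_reg_r with s; [lra|]; unfold Rdiv; rewrite Rmult_assoc, Rinv_l by lra.
      unfold s; lra.
    + apply Rmult_le_pos; [lra | apply Rlt_le, Rinv_0_lt_compat; lra].
Qed.

(** Bernoulli's inequality gives n <= (1 + h)^n / h, so the factor n is absorbed by enlarging r to r
    (1 + h), still below 1. *)
Lemma summable_in_disc_mult_n (a : nat -> C) :
  summable_in_disc a -> summable_in_disc (fun n => INR n * a n).
Proof.
  intros H r Hr; set (h := ((1 - r) / 2)%R).
  assert (Hh : (0 < h)%R) by (unfold h; lra).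
  assert (Hs : (0 <= r * (1 + h) < 1)%R) by (unfold h; split; nra).
  specialize (H _ Hs).
  apply (@ex_series_le R_AbsRing R_CompleteNormedModule _
    (fun n => / h * (Cmod (a n) * (r * (1 + h)) ^ n))%R).
  - intros n.
    assert (Pr : (0 <= r ^ n)%R) by (apply pow_le; lra).
    pose proof (Cmod_ge_0 (a n)) as Pa; pose proof (pos_INR n) as Pn.
    change (Rabs (Cmod (INR n * a n) * r ^ n)
            <= / h * (Cmod (a n) * (r * (1 + h)) ^ n))%R.
    rewrite Cmod_mult, Cmod_R, (Rabs_pos_eq (INR n)) by auto.
    rewrite Rabs_pos_eq by (repeat apply Rmult_le_pos; auto).
    rewrite Rpow_mult_distr; pose proof (poly n h Hh) as B.
    replace (INR n * Cmod (a n) * r ^ n)%R with (Cmod (a n) * r ^ n * INR n)%R by ring.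
    replace (/ h * (Cmod (a n) * (r ^ n * (1 + h) ^ n)))%R with
      (Cmod (a n) * r ^ n * (/ h * (1 + h) ^ n))%R by ring.
    apply Rmult_le_compat_l; [apply Rmult_le_pos; auto|].
    apply Rmult_le_reg_l with h; auto; rewrite <- Rmult_assoc, Rinv_r by lra; lra.
  - apply (@ex_series_scal R_AbsRing R_NormedModule (/ h)%R); exact H.
Qed.

Lemma summable_in_disc_csum (a : nat -> C) (x : C) :
  summable_in_disc a -> (Cmod x < 1)%R -> exists l, csum (fun n => a n * x ^ n) l.
Proof.
  intros H Hx; apply (ex_csum _ (fun n => Cmod (a n) * Cmod x ^ n)%R).
  - intros n; rewrite Cmod_mult, Cmod_pow; lra.
  - apply H; split; auto; apply Cmod_ge_0.
Qed.

(** The bound is n^2 r^(n-2) |w - x|^2, with r^n / r^2 in place of a truncated exponent. The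
    remainder e_n satisfies e_(n+1) = w e_n + n x^(n-1) (w - x)^2, and n^2 + n <= (n + 1)^2. *)
Lemma pow_quadratic_bound (r : R) (x w : C) (n : nat) : (0 < r)%R ->
  (Cmod x <= r)%R -> (Cmod w <= r)%R ->
  (Cmod (w ^ n - x ^ n - INR n * x ^ (n - 1) * (w - x))
   <= INR n * INR n * r ^ n * (/ r ^ 2 * Cmod (w - x) ^ 2))%R.
Proof.
  intros Hr Hx Hw; set (B := (/ r ^ 2 * Cmod (w - x) ^ 2)%R).
  assert (PB : (0 <= B)%R).
  { apply Rmult_le_pos; [apply Rlt_le, Rinv_0_lt_compat, pow_lt; auto | apply pow2_ge_0]. }
  induction n as [|n IH].
  - simpl; replace (1 - 1 - 0 * 1 * (w - x)) with (RtoC 0) by ring; rewrite Cmod_0; lra.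
  - set (e := w ^ n - x ^ n - INR n * x ^ (n - 1) * (w - x)) in *.
    pose proof (pos_INR n) as Pn.
    assert (Pr : (0 <= r ^ S n)%R) by (apply pow_le; lra).
    replace (w ^ S n - x ^ S n - INR (S n) * x ^ (S n - 1) * (w - x)) with
      (w * e + INR n * x ^ (n - 1) * ((w - x) * (w - x))).
    + eapply Rle_trans; [apply Cmod_triangle|].
      rewrite !Cmod_mult, Cmod_R, (Rabs_pos_eq (INR n)), Cmod_pow by auto.
      assert (A1 : (Cmod w * Cmod e <= INR n * INR n * r ^ S n * B)%R).
      { replace (INR n * INR n * r ^ S n * B)%R with (r * (INR n * INR n * r ^ n * B))%R
          by (simpl; ring).
        apply Rmult_le_compat; auto using Cmod_ge_0. }
      assert (A2 : (INR n * Cmod x ^ (n - 1) * (Cmod (w - x) * Cmod (w - x))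
                    <= INR n * r ^ S n * B)%R).
      { destruct n as [|n]; [simpl; lra|].
        replace (S n - 1)%nat with n by lia.
        replace (INR (S n) * r ^ S (S n) * B)%R with
          (INR (S n) * r ^ n * (Cmod (w - x) * Cmod (w - x)))%R.
        - apply Rmult_le_compat_r; [apply Rmult_le_pos; apply Cmod_ge_0|].
          apply Rmult_le_compat_l; auto; apply pow_incr; split; auto; apply Cmod_ge_0.
        - unfold B; simpl; field; lra. }
      rewrite S_INR.
      assert (Pb : (0 <= r ^ S n * B)%R) by (apply Rmult_le_pos; auto).
      assert (0 <= INR n * (r ^ S n * B))%R by (apply Rmult_le_pos; auto).
      nra.
    + unfold e; rewrite S_INR, RtoC_plus; replace (S n - 1)%nat with n by lia.
      destruct n as [|n]; [simpl; ring|].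
      replace (S n - 1)%nat with n by lia; simpl Cpow; ring.
Qed.

Lemma cderiv_power_series (a : nat -> C) (F : C -> C) (x l : C) :
  summable_in_disc a ->
  (forall w, (Cmod w < 1)%R -> csum (fun n => a n * w ^ n) (F w)) ->
  (Cmod x < 1)%R ->
  csum (fun n => INR n * a n * x ^ (n - 1)) l -> cderiv F x l.
Proof.
  intros Ha HF Hx Hl; pose proof (Cmod_ge_0 x) as Px.
  set (r := ((1 + Cmod x) / 2)%R).
  assert (Hr : (0 < r < 1)%R) by (unfold r; lra).
  pose proof (summable_in_disc_mult_n _ (summable_in_disc_mult_n _ Ha)) as Hs.
  specialize (Hs r ltac:(lra)).
  set (K := Series (fun n => Cmod (INR n * (INR n * a n)) * r ^ n)%R).
  apply cderiv_quad with ((1 - Cmod x) / 2)%R (/ r ^ 2 * K)%R; [lra|]; intros w Hw.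
  assert (Hwr : (Cmod w <= r)%R).
  { replace w with (x + (w - x)) by ring.
    eapply Rle_trans; [apply Cmod_triangle|]; unfold r; lra. }
  assert (H : csum (fun n => a n * (w ^ n - x ^ n - INR n * x ^ (n - 1) * (w - x)))
     (F w - F x - l * (w - x))).
  { apply csum_ext with (fun n => a n * w ^ n - a n * x ^ n
      - (w - x) * (INR n * a n * x ^ (n - 1))); [intros; ring|].
    replace (l * (w - x)) with ((w - x) * l) by ring.
    apply csum_minus; [apply csum_minus; apply HF; lra | apply csum_scal, Hl]. }
  set (B := (/ r ^ 2 * Cmod (w - x) ^ 2)%R).
  eapply Rle_trans.
  - apply csum_Cmod_le with (1 := H)
      (B := fun n => (B * (Cmod (INR n * (INR n * a n)) * r ^ n))%R).
    + intros n; rewrite !Cmod_mult, !Cmod_R, !Rabs_pos_eq by apply pos_INR.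
      pose proof (pow_quadratic_bound r x w n ltac:(lra) ltac:(unfold r; lra) Hwr) as Hq.
      fold B in Hq.
      eapply Rle_trans; [apply Rmult_le_compat_l; [apply Cmod_ge_0 | exact Hq]|].
      right; ring.
    + apply (@ex_series_scal R_AbsRing R_NormedModule B); exact Hs.
  - rewrite Series_scal_l; fold K; unfold B; right; ring.
Qed.

Lemma upper_half_near (tau w : C) :
  upper_half tau -> (Cmod (w - tau) < Im tau)%R -> upper_half w.
Proof.
  unfold upper_half; intros Ht Hw.
  pose proof (im_le_Cmod (w - tau)) as H; apply Rabs_le_between in H.
  destruct w, tau; unfold Cminus, Cplus, Copp, Im in *; simpl in *; lra.
Qed.

Lemma two_pi_i_neq_0 : 2 * PI * Ci <> 0.
Proof. repeat apply Cmult_neq_0; auto using C2_neq_0, CPI_neq_0, Ci_neq_0. Qed.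

Lemma cderiv_D (f : C -> C) (tau l : C) :
  cderiv f tau (2 * PI * Ci * l) -> D f tau = l.
Proof.
  intros H; unfold D; rewrite (cderiv_C_derive _ _ _ H).
  rewrite Cmult_assoc, Cinv_l, Cmult_1_l; auto using two_pi_i_neq_0.
Qed.

(** On the half-plane f is a power series composed with [qexp]; the chain rule contributes 2 pi i q,
    which the normalisation of [D] reduces to q d/dq. *)
Lemma has_qseries_deriv (f : C -> C) (a : nat -> C) : has_qseries f a ->
  has_qseries (D f) (fun n => INR n * a n) /\
  forall tau, upper_half tau -> cderiv f tau (2 * PI * Ci * D f tau).
Proof.
  intros H; pose proof (has_qseries_summable f a H) as Ha.
  set (F := fun w => CSeries (fun n => a n * w ^ n)).
  assert (HF : forall w, (Cmod w < 1)%R -> csum (fun n => a n * w ^ n) (F w)).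
  { intros w Hw; destruct (summable_in_disc_csum a w Ha Hw) as [l Hl].
    unfold F; rewrite (csum_CSeries _ _ Hl); exact Hl. }
  assert (HD : forall tau, upper_half tau -> exists l,
    csum (fun n => INR n * a n * qexp tau ^ n) l /\ cderiv f tau (2 * PI * Ci * l)).
  { intros tau Ht; pose proof (Cmod_qexp_lt_1 tau Ht) as Hq; set (q := qexp tau) in *.
    assert (Nq : q <> 0) by apply qexp_neq_0.
    destruct (summable_in_disc_csum _ q (summable_in_disc_mult_n _ Ha) Hq) as [l Hl].
    exists l; split; auto.
    assert (Hd : cderiv F q (/ q * l)).
    { apply cderiv_power_series with a; auto.
      apply csum_ext with (2 := csum_scal (/ q) _ _ Hl); intros [|n].
      - simpl; ring.
      - replace (S n - 1)%nat with n by lia; simpl Cpow; field; auto. }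
    apply cderiv_ext_loc with (fun w => F (qexp w)) (Im tau).
    - exact Ht.
    - intros w Hw; pose proof (upper_half_near tau w Ht Hw) as Hw'.
      apply csum_unique with (2 := H w Hw'), HF, Cmod_qexp_lt_1, Hw'.
    - replace (2 * PI * Ci * l) with (/ q * l * (2 * PI * Ci * q)) by (field; auto).
      apply cderiv_comp; auto; apply cderiv_qexp. }
  split; intros tau Ht; destruct (HD tau Ht) as [l [Hl Hd]];
    rewrite (cderiv_D _ _ _ Hd); auto.
Qed.

(** This one condition yields holomorphy, invariance under integer translations and holomorphy at
    the cusp. It is stable under [D], sums and products, and holds for E_2 too. *)
Definition qexpandable (f : C -> C) : Prop := exists a, has_qseries f a.

Lemma qexpandable_ext (f g : C -> C) :
  (forall tau, upper_half tau -> f tau = g tau) -> qexpandable f -> qexpandable g.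
Proof.
  intros E [a Ha]; exists a; intros tau Ht; rewrite <- E by auto; apply Ha, Ht.
Qed.

Lemma qexpandable_deriv (f : C -> C) : qexpandable f ->
  qexpandable (D f) /\
  forall tau, upper_half tau -> cderiv f tau (2 * PI * Ci * D f tau).
Proof.
  intros [a Ha]; destruct (has_qseries_deriv f a Ha) as [H1 H2]; split; auto.
  exists (fun n => INR n * a n); exact H1.
Qed.

Lemma qexpandable_Diter (f : C -> C) (n : nat) : qexpandable f -> qexpandable (Diter n f).
Proof.
  intros H; induction n as [|n IH]; auto.
  apply (qexpandable_deriv _ IH).
Qed.

Lemma qexpandable_plus (f g : C -> C) : qexpandable f -> qexpandable g ->
  qexpandable (fun tau => f tau + g tau).
Proof.
  intros [a Ha] [b Hb]; exists (fun n => a n + b n); intros tau Ht.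
  apply csum_ext with (2 := csum_plus _ _ _ _ (Ha tau Ht) (Hb tau Ht)); intros; ring.
Qed.

Lemma qexpandable_scal (c : C) (f : C -> C) : qexpandable f ->
  qexpandable (fun tau => c * f tau).
Proof.
  intros [a Ha]; exists (fun n => c * a n); intros tau Ht.
  apply csum_ext with (2 := csum_scal c _ _ (Ha tau Ht)); intros; ring.
Qed.

Lemma qexpandable_const (c : C) : qexpandable (fun _ => c).
Proof.
  exists (fun n => match n with O => c | S _ => 0 end); intros tau _.
  assert (H : csum (fun n => match n with O => c | S _ => 0 end * qexp tau ^ n)
    (c * qexp tau ^ 0 + 0)).
  { apply (csum_first (fun n => match n with O => c | S _ => 0 end * qexp tau ^ n)).
    apply csum_ext with (fun _ => 0); [intros; ring | apply csum_0]. }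
  replace (c * qexp tau ^ 0 + 0) with c in H by (simpl; ring); exact H.
Qed.

Lemma qexpandable_mult (f g : C -> C) : qexpandable f -> qexpandable g ->
  qexpandable (fun tau => f tau * g tau).
Proof.
  intros [a Ha] [b Hb]; exists (fps_mul a b); intros tau Ht.
  assert (Hq : (0 <= Cmod (qexp tau) < 1)%R)
    by (split; [apply Cmod_ge_0 | apply Cmod_qexp_lt_1, Ht]).
  assert (B : forall (u : nat -> C) n,
    (Cmod (u n * qexp tau ^ n) <= Cmod (u n) * Cmod (qexp tau) ^ n)%R).
  { intros u n; rewrite Cmod_mult, Cmod_pow; apply Rle_refl. }
  pose proof (csum_mult _ _ _ _ _ _ (B a) (B b)
    (has_qseries_summable _ _ Ha _ Hq) (has_qseries_summable _ _ Hb _ Hq)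
    (Ha tau Ht) (Hb tau Ht)) as H.
  apply csum_ext with (2 := H); intros n; unfold fps_mul.
  rewrite !sum_n_psum, (Cmult_comm _ (qexp tau ^ n)), <- psum_scal.
  apply psum_ext; intros i Hi.
  replace (qexp tau ^ n) with (qexp tau ^ i * qexp tau ^ (n - i))
    by (rewrite <- Cpow_add_r; f_equal; lia).
  ring.
Qed.

Lemma qexpandable_psum (f : nat -> C -> C) (n : nat) :
  (forall i, (i < n)%nat -> qexpandable (f i)) ->
  qexpandable (fun tau => psum (fun i => f i tau) n).
Proof.
  induction n as [|n IH]; intros H; simpl; [apply qexpandable_const|].
  apply (qexpandable_plus (fun tau => psum (fun i => f i tau) n) (f n)); auto.
Qed.

Lemma qexpandable_periodic (f : C -> C) (tau : C) (n : Z) :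
  qexpandable f -> upper_half tau -> f (tau + IZR n) = f tau.
Proof.
  intros [a Ha] Ht.
  assert (Ht' : upper_half (tau + IZR n)).
  { unfold upper_half in *; destruct tau; unfold Cplus, RtoC, Im in *; simpl in *; lra. }
  pose proof (Ha _ Ht') as H; rewrite qexp_plus, qexp_IZR, Cmult_1_r in H.
  apply csum_unique with (1 := H), Ha, Ht.
Qed.

(** * The q-expansion of E_2 *)

(** The divisor function sigma_1 (n), with value 0 at n = 0. *)
Definition divisor_sum (n : nat) : C :=
  psum (fun i => if (n mod S i =? 0)%nat then RtoC (INR (S i)) else 0) n.

(** A geometric series in x^d, spread out over all exponents of x so that series with different d
    share an index. *)
Lemma psum_multiples (d : nat) (x v : C) (n : nat) : (d <> 0)%nat ->
  psum (fun k => if andb (k mod d =? 0)%nat (negb (k =? 0)%nat) then v * x ^ k else 0) (S n)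
  = v * psum (fun j => (x ^ d) ^ S j) (n / d).
Proof.
  intros Hd; induction n as [|n IH].
  - simpl psum at 1; rewrite Nat.Div0.div_0_l; simpl.
    rewrite Bool.andb_false_r; ring.
  - cbn [psum] in IH |- *; rewrite IH; clear IH.
    change (S n =? 0)%nat with false; simpl negb; rewrite Bool.andb_true_r.
    pose proof (Nat.div_mod (S n) d Hd) as E.
    pose proof (Nat.mod_upper_bound (S n) d Hd) as U.
    destruct (Nat.eqb_spec (S n mod d) 0) as [Z|Z].
    + rewrite Z in E; destruct (S n / d)%nat as [|k]; [lia|].
      assert (Ek : (n / d = k)%nat) by (symmetry; apply Nat.div_unique with (d - 1)%nat; nia).
      rewrite Ek; cbn [psum]; rewrite <- Cpow_mult_r.
      replace (S n) with (d * S k)%nat by lia; ring.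
    + assert (Ek : (n / d = S n / d)%nat).
      { symmetry; apply Nat.div_unique with (S n mod d - 1)%nat; lia. }
      rewrite Ek; ring.
Qed.

Lemma csum_finite (u : nat -> C) (n : nat) :
  (forall i, (n <= i)%nat -> u i = 0) -> csum u (psum u n).
Proof.
  intros H; apply clim_ext_loc with (fun _ => psum u n); [|apply clim_const].
  exists n; intros m Hm; induction Hm as [|m Hm IH]; auto.
  cbn [psum]; rewrite <- IH, H by auto; ring.
Qed.

Lemma filterlim_div (d : nat) : (d <> 0)%nat ->
  filterlim (fun n => n / d)%nat eventually eventually.
Proof.
  intros Hd P [N HN]; exists (d * N)%nat; intros n Hn; apply HN.
  apply Nat.div_le_lower_bound; auto.
Qed.

Lemma qexpandable_E2 : qexpandable E2.
Proof.
  apply qexpandable_ext with (fun tau => 1 + -24 * CSeries (fun m =>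
        INR (S m) * qexp tau ^ (S m) / (1 - qexp tau ^ (S m)))).
  { intros tau _; unfold E2; replace (RtoC (-24)) with (- (24)) by (rewrite <- RtoC_opp; auto); ring. }
  apply qexpandable_plus; [apply qexpandable_const | apply qexpandable_scal].
  exists divisor_sum; intros tau Ht.
  destruct (csum_csc2_series tau Ht) as [_ Hl].
  rewrite (csum_CSeries _ _ Hl); revert Hl.
  generalize (csc2_series tau / - (4 * PI * PI)); intros l Hl.
  pose proof (Cmod_qexp_lt_1 tau Ht) as Hq; set (q := qexp tau) in *.
  set (r := Cmod q) in *.
  assert (Pr : (0 <= r < 1)%R) by (split; [apply Cmod_ge_0 | auto]).
  (* Row i expands d q^d / (1 - q^d) for d = i + 1, with d q^k at each positive multiple k of d;
     column k collects the divisors of k. *)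
  set (c := fun i k : nat =>
    if andb (k mod S i =? 0)%nat (negb (k =? 0)%nat) then INR (S i) * q ^ k else 0).
  apply (csum_swap c (fun m => INR (S m) * q ^ S m / (1 - q ^ S m)) _
    (fun i => / (1 - r) * (INR (S i) * r ^ S i))%R); auto.
  - apply (@ex_series_scal R_AbsRing R_NormedModule (/ (1 - r))%R).
    eexists; apply series_geom_deriv, Pr.
  - intros i N.
    assert (Pi : (0 <= r ^ S i < 1)%R).
    { split; [apply pow_le; lra|]; pose proof (pow_S_le_base r i); lra. }
    pose proof (pos_INR (S i)) as Pn.
    assert (P1 : (0 < / (1 - r))%R) by (apply Rinv_0_lt_compat; lra).
    destruct N as [|n].
    { simpl psum; rewrite Cmod_0; repeat apply Rmult_le_pos; auto; try lra; apply pow_le; lra. }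
    unfold c; rewrite (psum_multiples (S i)) by lia.
    rewrite Cmod_mult, Cmod_R, Rabs_pos_eq by auto.
    replace (/ (1 - r) * (INR (S i) * r ^ S i))%R with (INR (S i) * (r ^ S i * / (1 - r)))%R by ring.
    apply Rmult_le_compat_l; auto.
    assert (HG : is_series (fun j => r ^ S i * (r ^ S i) ^ j)%R (r ^ S i * / (1 - r ^ S i))%R).
    { apply (@is_series_scal R_AbsRing R_NormedModule (r ^ S i)%R), is_series_geom; rewrite Rabs_pos_eq; lra. }
    eapply Rle_trans; [apply (psum_Cmod _ (fun j => r ^ S i * (r ^ S i) ^ j)%R)|].
    { intros j; rewrite !Cmod_pow; fold r; simpl; lra. }
    eapply Rle_trans; [apply rpsum_le_Series|].
    + eexists; exact HG.
    + intros j; apply Rmult_le_pos; [lra | apply pow_le; lra].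
    + rewrite (is_series_unique _ _ HG); apply Rmult_le_compat_l; [lra|].
      apply Rinv_le_contravar; [lra|]; pose proof (pow_S_le_base r i); lra.
  - intros i; apply clim_incr_1.
    apply clim_ext with (fun n => INR (S i) * psum (fun j => (q ^ S i) ^ S j) (n / S i)).
    { intros n; symmetry; apply (psum_multiples (S i)); lia. }
    pose proof (Cmod_pow_lt_1 q i Hq) as Hqi; pose proof (one_minus_neq_0 _ Hqi) as N1.
    replace (INR (S i) * q ^ S i / (1 - q ^ S i)) with
      (INR (S i) * (q ^ S i * (1 / (1 - q ^ S i)))) by (field; auto).
    apply clim_scal.
    apply (clim_comp (psum (fun j => (q ^ S i) ^ S j))); [apply filterlim_div; lia|].
    apply csum_ext with (2 := csum_scal (q ^ S i) _ _ (csum_geom _ Hqi)); intros; reflexivity.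
  - intros k; unfold divisor_sum.
    replace (psum (fun i => if (k mod S i =? 0)%nat then RtoC (INR (S i)) else 0) k * q ^ k)
      with (psum (fun i => c i k) k).
    + apply csum_finite; intros i Hi; unfold c.
      destruct k as [|k]; [simpl; rewrite Bool.andb_false_r; auto|].
      rewrite Nat.mod_small by lia; reflexivity.
    + rewrite Cmult_comm, <- psum_scal; apply psum_ext; intros i Hi; unfold c.
      destruct k as [|k]; [lia|].
      change (S k =? 0)%nat with false; simpl negb; rewrite Bool.andb_true_r.
      destruct (S k mod S i =? 0)%nat; ring.
Qed.

Lemma modular_form_qexpandable (k : nat) (f : C -> C) : modular_form k f -> qexpandable f.
Proof.
  intros [_ [_ [a Ha]]]; exists a; intros tau Ht; apply csum_is_series, Ha, Ht.
Qed.

Lemma qexpandable_holomorphic (f : C -> C) : qexpandable f ->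
  holomorphic_on_H f /\ holomorphic_at_infinity f.
Proof.
  intros H; split.
  - intros tau Ht; exists (2 * PI * Ci * D f tau).
    apply cderiv_is_derive, (qexpandable_deriv f H), Ht.
  - destruct H as [a Ha]; exists a; intros tau Ht; apply csum_is_series, Ha, Ht.
Qed.

(** * Modified derivatives under inversion *)

Lemma Cfact_neq_0 (n : nat) : Cfact n <> 0.
Proof. apply CINR_neq_0, fact_neq_0. Qed.

Lemma Cfact_S (n : nat) : Cfact (S n) = INR (S n) * Cfact n.
Proof.
  unfold Cfact; rewrite <- RtoC_mult, <- mult_INR; reflexivity.
Qed.

Definition kappa : C := / (2 * PI * Ci).

(* If [D (phi n) = (n + 1) (k + n) phi (n + 1)], the transformation law
   [Phi (-1/tau, X/tau^2) = tau^k exp (kappa X / tau) Phi (tau, X)] of the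
   generating series [Phi = sum phi_n X^n] propagates from low order.
   For [k = 0] the relation carries no information at [n = 0], so the
   coefficient of [X] must be supplied as well. *)
Lemma cohen_kuznetsov (k : nat) (phi : nat -> C -> C) :
  (forall n tau, upper_half tau ->
     cderiv (phi n) tau (2 * PI * Ci * (INR (S n) * INR (k + n) * phi (S n) tau))) ->
  (forall tau, upper_half tau -> phi 0%nat (- / tau) = tau ^ k * phi 0%nat tau) ->
  (k = 0%nat -> forall tau, upper_half tau ->
     phi 1%nat (- / tau) = tau ^ 2 * phi 1%nat tau + kappa * tau * phi 0%nat tau) ->
  forall n tau, upper_half tau ->
    phi n (- / tau)
    = psum (fun j => kappa ^ j / Cfact j * tau ^ (k + 2 * n - j) * phi (n - j)%nat tau) (S n).
Proof.
  intros Hd H0 H1.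
  assert (N1 : RtoC 1 <> 0) by (apply RtoC_neq; lra).
  assert (Base : forall tau, upper_half tau -> phi 0%nat (- / tau) =
    psum (fun j => kappa ^ j / Cfact j * tau ^ (k + 2 * 0 - j) * phi (0 - j)%nat tau) 1).
  { intros tau Ht; rewrite H0 by auto; cbn [psum].
    replace (k + 2 * 0 - 0)%nat with k by lia; simpl Cpow; simpl Nat.sub.
    unfold Cfact; simpl INR; field; auto. }
  (* Differentiate the law for n. The left side becomes a multiple of phi_(n+1) (-1/tau); on the
     right the product rule feeds two neighbouring terms of the law for n + 1. *)
  assert (Step : forall n, (k + n <> 0)%nat ->
    (forall tau, upper_half tau -> phi n (- / tau)
      = psum (fun j => kappa ^ j / Cfact j * tau ^ (k + 2 * n - j) * phi (n - j)%nat tau) (S n)) ->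
    forall tau, upper_half tau -> phi (S n) (- / tau)
      = psum (fun j => kappa ^ j / Cfact j * tau ^ (k + 2 * S n - j) * phi (S n - j)%nat tau) (S (S n))).
  { intros n Hkn IH tau Ht.
    pose proof (upper_half_neq_0 tau Ht) as Nt.
    assert (NP : 2 * PI * Ci <> 0) by apply two_pi_i_neq_0.
    set (c := fun j => kappa ^ j / Cfact j).
    set (e := fun j => (k + 2 * n - j)%nat).
    assert (D1 : cderiv (fun w => phi n (- / w)) tau
      (2 * PI * Ci * (INR (S n) * INR (k + n) * phi (S n) (- / tau)) * - - / (tau * tau))).
    { apply (cderiv_comp (phi n) (fun w => - / w)); [apply Hd, upper_half_S, Ht|].
      apply cderiv_opp, cderiv_inv, Nt. }
    assert (D2 : cderiv (fun w => psum (fun j => c j * w ^ e j * phi (n - j)%nat w) (S n)) tau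
      (psum (fun j => c j * (INR (e j) * tau ^ (e j - 1)) * phi (n - j)%nat tau
        + c j * tau ^ e j * (2 * PI * Ci * (INR (S (n - j)) * INR (k + (n - j))
            * phi (S (n - j)) tau))) (S n))).
    { apply (cderiv_psum (fun j w => c j * w ^ e j * phi (n - j)%nat w)); intros j _.
      apply (cderiv_mult (fun w => c j * w ^ e j) (phi (n - j)%nat)); [|apply Hd, Ht].
      apply cderiv_scal, cderiv_pow. }
    assert (E : 2 * PI * Ci * (INR (S n) * INR (k + n) * phi (S n) (- / tau)) * - - / (tau * tau)
      = psum (fun j => c j * (INR (e j) * tau ^ (e j - 1)) * phi (n - j)%nat tau
        + c j * tau ^ e j * (2 * PI * Ci * (INR (S (n - j)) * INR (k + (n - j))
            * phi (S (n - j)) tau))) (S n)).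
    { apply cderiv_unique with (1 := D1).
      apply cderiv_ext_loc with (3 := D2) (d := Im tau); [exact Ht|].
      intros w Hw; symmetry; apply IH, (upper_half_near tau); auto. }
    set (T := fun j => c j * tau ^ (k + 2 * S n - j) * phi (S n - j)%nat tau).
    (* [al] comes from differentiating phi_(n-j), and [be] from differentiating the power of tau,
       which shifts j by one. For all j, al j + be j = (n + 1)(k + n); moreover al (n + 1) = 0 and
       be 0 = 0, so both sums extend to the full range. *)
    set (al := fun j => (INR n - INR j + 1) * (INR k + INR n - INR j)).
    set (be := fun j => INR j * (INR k + 2 * INR n - INR j + 1)).
    assert (E2 : INR (S n) * INR (k + n) * phi (S n) (- / tau)
      = psum (fun j => al j * T j + be (S j) * T (S j)) (S n)).
    { transitivity (kappa * (tau * tau) * (2 * PI * Ci * (INR (S n) * INR (k + n)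
         * phi (S n) (- / tau)) * - - / (tau * tau))).
      { unfold kappa; field; auto using C2_neq_0, CPI_neq_0, Ci_neq_0. }
      rewrite E, <- psum_scal; apply psum_ext; intros j Hj.
      assert (A1 : kappa * (tau * tau) * (c j * (INR (e j) * tau ^ (e j - 1)) * phi (n - j)%nat tau)
        = be (S j) * T (S j)).
      { assert (Ee : tau * tau * (INR (e j) * tau ^ (e j - 1)) = INR (e j) * tau ^ (S (e j))).
        { destruct (e j) as [|m]; [simpl; ring|].
          replace (S m - 1)%nat with m by lia; simpl Cpow; ring. }
        unfold T, be; replace (k + 2 * S n - S j)%nat with (S (e j)) by (unfold e; lia).
        replace (S n - S j)%nat with (n - j)%nat by lia.
        replace (INR k + 2 * INR n - INR (S j) + 1) with (RtoC (INR (e j))).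
        - transitivity (kappa * c j * (tau * tau * (INR (e j) * tau ^ (e j - 1)))
             * phi (n - j)%nat tau); [ring|].
          rewrite Ee; unfold c; rewrite Cfact_S; simpl (kappa ^ S j).
          field; split; first [apply Cfact_neq_0 | apply CINR_neq_0; lia].
        - unfold e; rewrite minus_INR, plus_INR, mult_INR, (S_INR j) by lia.
          rewrite RtoC_minus, !RtoC_plus, RtoC_mult.
          replace (RtoC (INR 2)) with (RtoC 2) by (simpl; f_equal; ring); ring. }
      assert (A2 : kappa * (tau * tau) * (c j * tau ^ e j * (2 * PI * Ci
          * (INR (S (n - j)) * INR (k + (n - j)) * phi (S (n - j)) tau))) = al j * T j).
      { unfold T, al; replace (k + 2 * S n - j)%nat with (S (S (e j))) by (unfold e; lia).
        replace (S n - j)%nat with (S (n - j)) by lia.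
        rewrite S_INR, plus_INR, minus_INR, !RtoC_plus, !RtoC_minus by lia.
        simpl (tau ^ S (S (e j))).
        transitivity ((kappa * (2 * PI * Ci)) * (tau * (tau * tau ^ e j)) * c j
           * ((INR n - INR j + 1) * (INR k + (INR n - INR j))) * phi (S (n - j)) tau); [ring|].
        replace (kappa * (2 * PI * Ci)) with (RtoC 1)
          by (unfold kappa; rewrite Cinv_l; auto).
        ring. }
      rewrite <- A1, <- A2; ring. }
    assert (E3 : psum (fun j => al j * T j + be (S j) * T (S j)) (S n)
      = INR (S n) * INR (k + n) * psum T (S (S n))).
    { rewrite psum_plus, <- psum_scal.
      assert (F1 : psum (fun j => al j * T j) (S (S n)) = psum (fun j => al j * T j) (S n)).
      { cbn [psum]; unfold al at 3; rewrite S_INR, RtoC_plus; ring. }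
      assert (F2 : psum (fun j => be j * T j) (S (S n)) = psum (fun j => be (S j) * T (S j)) (S n)).
      { rewrite psum_first; unfold be at 1; simpl (INR 0); ring. }
      rewrite <- F1, <- F2, <- psum_plus; apply psum_ext; intros j _.
      unfold al, be; rewrite S_INR, plus_INR, !RtoC_plus; ring. }
    rewrite E3 in E2.
    assert (NN : INR (S n) * INR (k + n) <> 0).
    { apply Cmult_neq_0; apply CINR_neq_0; lia. }
    transitivity (/ (INR (S n) * INR (k + n)) * (INR (S n) * INR (k + n) * phi (S n) (- / tau))).
    - rewrite Cmult_assoc, Cinv_l, Cmult_1_l; auto.
    - rewrite E2, Cmult_assoc, Cinv_l, Cmult_1_l by auto; reflexivity. }
  intros n; induction n as [|n IH]; [exact Base|].
  destruct (Nat.eq_dec (k + n) 0) as [Z|Z]; [|apply Step; auto].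
  assert (k = 0%nat) by lia; assert (n = 0%nat) by lia; subst k n.
  intros tau Ht; rewrite H1 by auto; cbn [psum].
  simpl; unfold Cfact; simpl INR; field; auto.
Qed.

Lemma pochhammer_neq_0 (k n : nat) : (0 < k)%nat -> pochhammer (INR k) n <> 0.
Proof.
  intros Hk; induction n as [|n IH]; simpl; [apply RtoC_neq; lra|].
  apply Cmult_neq_0; auto; rewrite <- RtoC_plus, <- plus_INR; apply CINR_neq_0; lia.
Qed.

Lemma qexpandable_mod_deriv (k n : nat) (f : C -> C) :
  qexpandable f -> qexpandable (mod_deriv k n f).
Proof.
  intros Hf; destruct k as [|k].
  - apply (qexpandable_mult f); auto; destruct n as [|m]; [apply qexpandable_const|].
    apply qexpandable_ext with (fun tau => / (12 * Cfact m) * Diter m E2 tau).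
    + intros; unfold mod_deriv_one, Cdiv; ring.
    + apply qexpandable_scal, qexpandable_Diter, qexpandable_E2.
  - apply qexpandable_ext with (fun tau => / pochhammer (INR (S k)) n * Diter n f tau).
    + intros; unfold mod_deriv, Cdiv; ring.
    + apply qexpandable_scal, qexpandable_Diter, Hf.
Qed.

Definition phi (k : nat) (f : C -> C) (n : nat) (tau : C) : C :=
  mod_deriv k n f tau / Cfact n.

Lemma cderiv_Diter (f : C -> C) (n : nat) (tau : C) : qexpandable f -> upper_half tau ->
  cderiv (Diter n f) tau (2 * PI * Ci * Diter (S n) f tau).
Proof.
  intros Hf Ht; apply (qexpandable_deriv _ (qexpandable_Diter f n Hf)), Ht.
Qed.

Lemma cderiv_phi (k : nat) (f : C -> C) (n : nat) (tau : C) : M k f -> upper_half tau ->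
  cderiv (phi k f n) tau (2 * PI * Ci * (INR (S n) * INR (k + n) * phi k f (S n) tau)).
Proof.
  intros [Hm Hc] Ht; pose proof (modular_form_qexpandable k f Hm) as Hf.
  pose proof (Cfact_neq_0 n) as Nn; pose proof (CINR_neq_0 (S n) ltac:(lia)) as NS.
  assert (N12 : RtoC 12 <> 0) by (apply RtoC_neq; lra).
  destruct k as [|k].
  - destruct (Hc eq_refl) as [c Hcc].
    (* In weight 0, f is known to be constant on the half-plane only, so it is replaced by its value
       c in a neighbourhood of tau. *)
    assert (Loc : forall g l, cderiv (fun w => c * g w) tau l ->
        cderiv (fun w => f w * g w) tau l).
    { intros g l; apply cderiv_ext_loc with (Im tau); [exact Ht|].
      intros w Hw; rewrite Hcc; auto; apply (upper_half_near tau); auto. }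
    unfold phi, mod_deriv; destruct n as [|m].
    + apply cderiv_ext with (fun w => f w * (1 / Cfact 0)).
      { intros; simpl; unfold Cdiv; ring. }
      (* At k = n = 0 the factor k + n vanishes, in agreement with the derivative of a constant. *)
      simpl INR; rewrite Cmult_0_r, Cmult_0_l, Cmult_0_r.
      apply (Loc (fun _ => 1 / Cfact 0)), cderiv_const.
    + pose proof (Cfact_neq_0 m) as Nm; pose proof (CINR_neq_0 (S m) ltac:(lia)) as NSm.
      apply cderiv_ext with (fun w => f w * (/ (12 * Cfact m * Cfact (S m)) * Diter m E2 w)).
      { intros; unfold mod_deriv_one; field; auto. }
      rewrite Hcc by auto.
      replace (2 * PI * Ci * (INR (S (S m)) * INR (0 + S m)
          * (c * mod_deriv_one (S (S m)) tau / Cfact (S (S m)))))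
        with (c * (/ (12 * Cfact m * Cfact (S m)) * (2 * PI * Ci * Diter (S m) E2 tau))).
      * apply (Loc (fun w => / (12 * Cfact m * Cfact (S m)) * Diter m E2 w)).
        apply cderiv_scal, cderiv_scal, cderiv_Diter; auto using qexpandable_E2.
      * unfold mod_deriv_one; rewrite !Cfact_S, Nat.add_0_l; field; auto.
  - pose proof (pochhammer_neq_0 (S k) n ltac:(lia)) as Np.
    assert (Nk : RtoC (INR (S k + n)) <> 0) by (apply CINR_neq_0; lia).
    apply cderiv_ext with (fun w => / (pochhammer (INR (S k)) n * Cfact n) * Diter n f w).
    { intros w; unfold phi, mod_deriv; field; auto. }
    replace (2 * PI * Ci * (INR (S n) * INR (S k + n) * phi (S k) f (S n) tau)) with
      (/ (pochhammer (INR (S k)) n * Cfact n) * (2 * PI * Ci * Diter (S n) f tau)).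
    + apply cderiv_scal, cderiv_Diter; auto.
    + unfold phi, mod_deriv; rewrite Cfact_S.
      change (pochhammer (INR (S k)) (S n)) with
        (pochhammer (INR (S k)) n * (INR (S k) + INR n)).
      rewrite <- RtoC_plus, <- plus_INR; field; auto.
Qed.

Lemma weakly_modular_S (k : nat) (f : C -> C) (tau : C) :
  weakly_modular k f -> upper_half tau -> f (- / tau) = tau ^ k * f tau.
Proof.
  intros H Ht; pose proof (upper_half_neq_0 tau Ht) as Nt.
  specialize (H 0%Z (-1)%Z 1%Z 0%Z eq_refl tau Ht).
  replace ((0 * tau + -1) / (1 * tau + 0)) with (- / tau) in H.
  - replace (1 * tau + 0) with tau in H by ring; exact H.
  - replace (1 * tau + 0) with tau by ring.
    replace (RtoC (-1)) with (- (1)) by (rewrite <- RtoC_opp; auto); field; auto.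
Qed.

Lemma phi_S (k : nat) (f : C -> C) (n : nat) (tau : C) : M k f -> upper_half tau ->
  phi k f n (- / tau)
  = psum (fun j => kappa ^ j / Cfact j * tau ^ (k + 2 * n - j) * phi k f (n - j) tau) (S n).
Proof.
  intros HM; revert n tau; destruct HM as [[Hh [Hw Hi]] Hc].
  assert (N1 : RtoC 1 <> 0) by (apply RtoC_neq; lra).
  apply cohen_kuznetsov.
  - intros; apply cderiv_phi; [repeat split; auto | auto].
  - intros tau Ht; unfold phi.
    assert (Em : forall w, mod_deriv k 0 f w = f w).
    { intros w; destruct k; simpl; [ring | field; auto]. }
    rewrite !Em, (weakly_modular_S k) by auto; unfold Cdiv; ring.
  (* Here phi_1 = c E_2/12, and dividing 12/(2 pi i) in the law of E_2 by 12 leaves [kappa]. *)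
  - intros -> tau Ht; destruct (Hc eq_refl) as [c Hcc].
    unfold phi, mod_deriv, mod_deriv_one; simpl Diter; change (Diter 0 E2) with E2.
    rewrite E2_S, !Hcc by auto using upper_half_S.
    unfold Cfact; simpl INR; unfold kappa; field.
    repeat split; auto using C2_neq_0, CPI_neq_0, Ci_neq_0; apply RtoC_neq; lra.
Qed.

(** * The extended bracket *)

Lemma upper_half_plus_Z (tau : C) (n : Z) : upper_half tau -> upper_half (tau + IZR n).
Proof.
  unfold upper_half; destruct tau; unfold Cplus, RtoC, Im; simpl; lra.
Qed.

Lemma upper_half_linear_neq_0 (tau : C) (c d : Z) : upper_half tau -> c <> 0%Z ->
  IZR c * tau + IZR d <> 0.
Proof.
  unfold upper_half; intros Ht Hc E; apply (f_equal Im) in E.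
  destruct tau as [x y]; unfold Cplus, Cmult, RtoC, Im in *; simpl in *.
  assert (H : (IZR c * y = 0)%R) by lra.
  apply Rmult_integral in H; destruct H as [H|H]; [|lra].
  apply eq_IZR_R0 in H; auto.
Qed.

(* Euclid's algorithm on the lower row [(c, d)] writes every matrix as a
   product of translations and inversions. *)
Lemma weakly_modular_of_generators (k : nat) (F : C -> C) :
  (forall (n : Z) tau, upper_half tau -> F (tau + IZR n) = F tau) ->
  (forall tau, upper_half tau -> F (- / tau) = tau ^ k * F tau) ->
  weakly_modular k F.
Proof.
  intros HT HS.
  (* Inverting twice returns to tau with factor (-1)^k. This absorbs the sign ambiguity of the
     matrices, and forces F to vanish on the half-plane in odd weight. *)
  assert (Hsign : forall tau, upper_half tau -> (-1) ^ k * F tau = F tau).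
  { intros tau Ht; pose proof (upper_half_neq_0 tau Ht) as Nt.
    pose proof (HS _ (upper_half_S _ Ht)) as H.
    replace (- / - / tau) with tau in H.
    - rewrite H at 2; rewrite HS, Cmult_assoc, <- Cpow_mult_l by auto; do 2 f_equal.
      replace (RtoC (-1)) with (- (1)) by (rewrite <- RtoC_opp; auto); field; auto.
    - field; auto. }
  assert (Main : forall (N : nat) (a b c d : Z), (Z.abs_nat c < N)%nat ->
    (a * d - b * c = 1)%Z -> forall tau, upper_half tau ->
    F ((IZR a * tau + IZR b) / (IZR c * tau + IZR d)) = (IZR c * tau + IZR d) ^ k * F tau).
  { induction N as [|N IH]; intros a b c d HN Hdet tau Ht; [lia|].
    destruct (Z.eq_dec c 0) as [->|Nc].
    - rewrite Z.mul_0_r, Z.sub_0_r in Hdet.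
      assert (N1 : RtoC 1 <> 0) by (apply RtoC_neq; lra).
      destruct (Z.mul_eq_1 a d Hdet) as [Ha|Ha].
      + assert (d = 1)%Z by lia; subst a d.
        replace ((1 * tau + IZR b) / (0 * tau + 1)) with (tau + IZR b) by (field; auto).
        replace (0 * tau + 1) with (RtoC 1) by ring.
        rewrite HT, Cpow_1_l by auto; ring.
      + change (a = -1)%Z in Ha; assert (d = -1)%Z by lia; subst a d.
        assert (Em : RtoC (-1) = - (1)) by (rewrite <- RtoC_opp; auto).
        replace ((-1 * tau + IZR b) / (0 * tau + -1)) with (tau + IZR (- b)).
        * replace (0 * tau + -1) with (RtoC (-1)) by ring.
          rewrite HT, Hsign by auto; auto.
        * rewrite opp_IZR, RtoC_opp, Em.
          replace (0 * tau + - (1)) with (- (1)) by ring; field.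
    (* Write d = c n + d' and substitute tau' = -1/(tau + n). In terms of tau' the matrix has lower
       row (d', -c), and |d'| < |c|. *)
    - pose proof (Z.div_mod d c Nc) as Ed; set (n := (d / c)%Z) in *.
      assert (Hlt : (Z.abs_nat (d mod c) < Z.abs_nat c)%nat).
      { pose proof (Z.mod_pos_bound d c); pose proof (Z.mod_neg_bound d c); lia. }
      set (d' := (d mod c)%Z) in *; set (b' := (b - n * a)%Z).
      assert (Ht1 : upper_half (tau + IZR n)) by (apply upper_half_plus_Z, Ht).
      assert (Ht2 : upper_half (- / (tau + IZR n))) by (apply upper_half_S, Ht1).
      specialize (IH b' (- a)%Z d' (- c)%Z ltac:(lia)
        ltac:(unfold b'; nia) _ Ht2).
      rewrite HS, HT in IH by auto.
      pose proof (upper_half_neq_0 _ Ht1) as N1.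
      pose proof (upper_half_linear_neq_0 tau c d Ht Nc) as N2.
      assert (E1 : IZR d' * - / (tau + IZR n) + IZR (- c) =
                   - (IZR c * tau + IZR d) / (tau + IZR n)).
      { rewrite Ed, opp_IZR, plus_IZR, mult_IZR, RtoC_plus, RtoC_mult, RtoC_opp.
        field; auto. }
      assert (E2 : IZR b' * - / (tau + IZR n) + IZR (- a) =
                   - (IZR a * tau + IZR b) / (tau + IZR n)).
      { unfold b'; rewrite opp_IZR, minus_IZR, mult_IZR, RtoC_minus, RtoC_mult, RtoC_opp.
        field; auto. }
      rewrite E1, E2 in IH.
      replace (- (IZR a * tau + IZR b) / (tau + IZR n) /
               (- (IZR c * tau + IZR d) / (tau + IZR n)))
        with ((IZR a * tau + IZR b) / (IZR c * tau + IZR d)) in IH.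
      + rewrite IH, Cmult_assoc, <- Cpow_mult_l.
        replace (- (IZR c * tau + IZR d) / (tau + IZR n) * (tau + IZR n)) with
          ((IZR c * tau + IZR d) * -1).
        * rewrite Cpow_mult_l, <- Cmult_assoc, Hsign; auto.
        * replace (RtoC (-1)) with (- (1)) by (rewrite <- RtoC_opp; auto); field; auto.
      + field; auto. }
  intros a b c d Hdet tau Ht; apply (Main (S (Z.abs_nat c))); auto.
Qed.

(** * Formal power series and the modularity of the bracket *)

Lemma fps_mul_psum (u v : nat -> C) (n : nat) :
  fps_mul u v n = psum (fun j => u j * v (n - j)%nat) (S n).
Proof. apply sum_n_psum. Qed.

Lemma fps_mul_ext (u u' v v' : nat -> C) (n : nat) :
  (forall i, (i <= n)%nat -> u i = u' i) -> (forall i, (i <= n)%nat -> v i = v' i) ->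
  fps_mul u v n = fps_mul u' v' n.
Proof.
  intros Hu Hv; rewrite !fps_mul_psum; apply psum_ext; intros i Hi.
  rewrite Hu, Hv by lia; reflexivity.
Qed.

Lemma fps_mul_comm (u v : nat -> C) (n : nat) : fps_mul u v n = fps_mul v u n.
Proof.
  rewrite !fps_mul_psum, psum_rev; apply psum_ext; intros i Hi.
  replace (S n - 1 - i)%nat with (n - i)%nat by lia.
  replace (n - (n - i))%nat with i by lia; ring.
Qed.

Lemma psum_triangle (g : nat -> nat -> C) (n : nat) :
  psum (fun i => psum (fun j => g j (i - j)%nat) (S i)) (S n)
  = psum (fun j => psum (g j) (S (n - j))) (S n).
Proof.
  induction n as [|n IH]; [simpl; ring|].
  change (psum (fun i => psum (fun j => g j (i - j)%nat) (S i)) (S (S n))) with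
    (psum (fun i => psum (fun j => g j (i - j)%nat) (S i)) (S n)
     + (psum (fun j => g j (S n - j)%nat) (S n) + g (S n) (S n - S n)%nat)).
  change (psum (fun j => psum (g j) (S (S n - j))) (S (S n))) with
    (psum (fun j => psum (g j) (S (S n - j))) (S n) + psum (g (S n)) (S (S n - S n))).
  rewrite IH, Cplus_assoc, <- psum_plus, Nat.sub_diag; f_equal; [|simpl; ring].
  apply psum_ext; intros j Hj.
  replace (S n - j)%nat with (S (n - j)) by lia; reflexivity.
Qed.

Lemma fps_mul_assoc (u v w : nat -> C) (n : nat) :
  fps_mul (fps_mul u v) w n = fps_mul u (fps_mul v w) n.
Proof.
  rewrite !fps_mul_psum.
  transitivity (psum (fun i => psum (fun j => u j * v (i - j)%nat * w (n - j - (i - j))%nat) (S i)) (S n)).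
  - apply psum_ext; intros i Hi; rewrite fps_mul_psum, Cmult_comm, <- psum_scal.
    apply psum_ext; intros j Hj.
    replace (n - j - (i - j))%nat with (n - i)%nat by lia; ring.
  - rewrite (psum_triangle (fun j m => u j * v m * w (n - j - m)%nat)).
    apply psum_ext; intros j Hj; rewrite fps_mul_psum, <- psum_scal.
    apply psum_ext; intros; ring.
Qed.

(** The substitution of -X for X. *)
Definition fps_alt (u : nat -> C) (n : nat) : C := (-1) ^ n * u n.

Lemma fps_alt_mul (u v : nat -> C) (n : nat) :
  fps_alt (fps_mul u v) n = fps_mul (fps_alt u) (fps_alt v) n.
Proof.
  unfold fps_alt at 1; rewrite !fps_mul_psum, <- psum_scal; apply psum_ext; intros i Hi.
  unfold fps_alt; replace ((-1) ^ n) with ((-1) ^ i * (-1) ^ (n - i)); [ring|].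
  rewrite <- Cpow_add_r; f_equal; lia.
Qed.

Lemma fps_alt_exp (a : C) (n : nat) : fps_alt (fps_exp a) n = fps_exp (- a) n.
Proof.
  unfold fps_alt, fps_exp, Cdiv; rewrite Cmult_assoc, <- Cpow_mult_l; do 2 f_equal.
  replace (RtoC (-1)) with (- (1)) by (rewrite <- RtoC_opp; auto); ring.
Qed.

Lemma fps_exp_S (a : C) (n : nat) : INR (S n) * fps_exp a (S n) = a * fps_exp a n.
Proof.
  unfold fps_exp; rewrite Cfact_S; simpl Cpow.
  field; split; first [apply Cfact_neq_0 | apply CINR_neq_0; lia].
Qed.

(** The product has zero derivative: n + 1 times the coefficient of X^(n+1) splits as j + (n + 1 -
    j), and by [fps_exp_S] the two parts are -a and a times the same sum. *)
Lemma fps_exp_inverse (a : C) (n : nat) :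
  fps_mul (fps_exp (- a)) (fps_exp a) n = match n with O => 1 | S _ => 0 end.
Proof.
  destruct n as [|n].
  - rewrite fps_mul_psum; simpl; unfold fps_exp, Cfact; simpl.
    field; apply RtoC_neq; lra.
  - rewrite fps_mul_psum; set (u := fps_exp (- a)); set (v := fps_exp a).
    assert (NN : RtoC (INR (S n)) <> 0) by (apply CINR_neq_0; lia).
    assert (E : INR (S n) * psum (fun j => u j * v (S n - j)%nat) (S (S n)) = 0).
    { rewrite <- psum_scal.
      transitivity (psum (fun j => INR j * u j * v (S n - j)%nat) (S (S n))
        + psum (fun j => u j * (INR (S n - j) * v (S n - j)%nat)) (S (S n))).
      { rewrite <- psum_plus; apply psum_ext; intros j Hj.
        rewrite (minus_INR (S n) j), RtoC_minus by lia; ring. }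
      rewrite psum_first.
      change (psum (fun j => u j * (INR (S n - j) * v (S n - j)%nat)) (S (S n))) with
        (psum (fun j => u j * (INR (S n - j) * v (S n - j)%nat)) (S n)
         + u (S n) * (INR (S n - S n) * v (S n - S n)%nat)).
      rewrite Nat.sub_diag; simpl (INR 0).
      transitivity (psum (fun i => INR (S i) * u (S i) * v (S n - S i)%nat) (S n)
        + psum (fun j => u j * (INR (S n - j) * v (S n - j)%nat)) (S n)); [ring|].
      rewrite <- psum_plus, <- (psum_zero (S n)); apply psum_ext; intros j Hj.
      unfold u, v; rewrite fps_exp_S.
      replace (S n - j)%nat with (S (n - j)) by lia; rewrite fps_exp_S.
      replace (S n - S j)%nat with (n - j)%nat by lia; ring. }
    transitivity (/ INR (S n) * (INR (S n) * psum (fun j => u j * v (S n - j)%nat) (S (S n)))).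
    + rewrite Cmult_assoc, Cinv_l, Cmult_1_l; auto.
    + rewrite E; ring.
Qed.

(* [(e^{aX} u)(-X) (e^{aX} v)(X) = u(-X) v(X)]. *)
Lemma fps_exp_cancel (a : C) (u v : nat -> C) (n : nat) :
  fps_mul (fps_alt (fps_mul (fps_exp a) u)) (fps_mul (fps_exp a) v) n
  = fps_mul (fps_alt u) v n.
Proof.
  transitivity (fps_mul (fps_mul (fps_alt u) (fps_exp (- a))) (fps_mul (fps_exp a) v) n).
  { apply fps_mul_ext; auto; intros i _; rewrite fps_alt_mul, fps_mul_comm.
    apply fps_mul_ext; auto; intros; apply fps_alt_exp. }
  rewrite fps_mul_assoc; apply fps_mul_ext; auto; intros i _.
  rewrite <- fps_mul_assoc.
  rewrite (fps_mul_ext _ (fun n => match n with O => 1 | S _ => 0 end) v v)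
    by (auto; intros; apply fps_exp_inverse).
  rewrite fps_mul_psum, psum_first, Nat.sub_0_r.
  rewrite (psum_ext _ (fun _ => 0)) by (intros; ring).
  rewrite psum_zero; ring.
Qed.

Lemma binom_Cfact (n i : nat) :
  binom n i = Cfact n / (Cfact i * Cfact (n - i)).
Proof.
  unfold binom, Binomial.C, Cfact; rewrite RtoC_div, RtoC_mult; auto.
  apply Rmult_integral_contrapositive; split; apply INR_fact_neq_0.
Qed.

Lemma ext_RC_bracket_fps (k l n : nat) (f g : C -> C) (tau : C) :
  ext_RC_bracket k l n f g tau
  = Cfact n * fps_mul (fps_alt (fun i => phi k f i tau)) (fun i => phi l g i tau) n.
Proof.
  unfold ext_RC_bracket; rewrite sum_n_psum, fps_mul_psum, <- psum_scal.
  apply psum_ext; intros i Hi; unfold fps_alt, phi; rewrite binom_Cfact.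
  field; split; apply Cfact_neq_0.
Qed.

(** Factoring tau^(k + 2n) out of tau^(k + 2n - j) leaves tau^-j, which turns [kappa ^ j] into the
    power of [kappa / tau] in the exponential. *)
Lemma phi_S_fps (k : nat) (f : C -> C) (n : nat) (tau : C) : M k f -> upper_half tau ->
  phi k f n (- / tau)
  = tau ^ (k + 2 * n) * fps_mul (fps_exp (kappa / tau)) (fun i => phi k f i tau) n.
Proof.
  intros HM Ht; rewrite phi_S, fps_mul_psum, <- psum_scal by auto.
  pose proof (upper_half_neq_0 tau Ht) as Nt.
  apply psum_ext; intros j Hj; unfold fps_exp.
  replace (k + 2 * n)%nat with (j + (k + 2 * n - j))%nat at 2 by lia.
  unfold Cdiv; rewrite Cpow_add_r, Cpow_mult_l, Cpow_inv by auto.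
  pose proof (Cfact_neq_0 j); pose proof (Cpow_nz tau j Nt); field; auto.
Qed.

Lemma ext_RC_bracket_S (k l n : nat) (f g : C -> C) (tau : C) :
  M k f -> M l g -> upper_half tau ->
  ext_RC_bracket k l n f g (- / tau)
  = tau ^ (k + l + 2 * n) * ext_RC_bracket k l n f g tau.
Proof.
  intros Mf Mg Ht; rewrite !ext_RC_bracket_fps.
  (* The exponentials are inserted on the tau side, where the bracket does not see them; each factor
     then becomes phi_i (-1/tau) up to a power of tau. *)
  rewrite <- (fps_exp_cancel (kappa / tau) (fun i => phi k f i tau)), !fps_mul_psum.
  rewrite (Cmult_comm (Cfact n) (psum _ _)), (Cmult_comm (Cfact n) (psum _ _)), Cmult_assoc.
  f_equal; rewrite <- psum_scal.
  apply psum_ext; intros i Hi; unfold fps_alt; rewrite !phi_S_fps by auto.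
  replace (k + l + 2 * n)%nat with ((k + 2 * i) + (l + 2 * (n - i)))%nat by lia.
  rewrite (Cpow_add_r tau (k + 2 * i)); ring.
Qed.

Lemma qexpandable_ext_RC_bracket (k l n : nat) (f g : C -> C) :
  qexpandable f -> qexpandable g -> qexpandable (ext_RC_bracket k l n f g).
Proof.
  intros Hf Hg.
  apply qexpandable_ext with (fun tau => psum (fun i => (-1) ^ i * binom n i
     * (mod_deriv k i f tau * mod_deriv l (n - i) g tau)) (S n)).
  { intros tau _; unfold ext_RC_bracket; rewrite sum_n_psum; apply psum_ext; intros; ring. }
  apply (qexpandable_psum (fun i tau => (-1) ^ i * binom n i
     * (mod_deriv k i f tau * mod_deriv l (n - i) g tau))); intros i _.
  apply qexpandable_scal, qexpandable_mult; apply qexpandable_mod_deriv; auto.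
Qed.

Lemma M_ext_RC_bracket (k l n : nat) (f g : C -> C) : M k f -> M l g ->
  M (k + l + 2 * n) (ext_RC_bracket k l n f g).
Proof.
  intros Mf Mg.
  pose proof (qexpandable_ext_RC_bracket k l n f g
    (modular_form_qexpandable _ _ (proj1 Mf)) (modular_form_qexpandable _ _ (proj1 Mg))) as Hq.
  destruct (qexpandable_holomorphic _ Hq) as [H1 H2].
  split; [repeat split; auto|].
  - apply weakly_modular_of_generators.
    + intros m tau Ht; apply qexpandable_periodic; auto.
    + intros tau Ht; apply ext_RC_bracket_S; auto.
  (* Total weight 0 forces k = l = n = 0, and the bracket is the product of two constants. *)
  - intros E; assert (k = 0%nat) by lia; assert (l = 0%nat) by lia.
    assert (n = 0%nat) by lia; subst k l n.
    destruct (proj2 Mf eq_refl) as [a Ha], (proj2 Mg eq_refl) as [b Hb].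
    exists (a * b); intros tau Ht.
    rewrite ext_RC_bracket_fps, fps_mul_psum; unfold fps_alt, phi, Cfact; simpl.
    rewrite Ha, Hb by auto; field; apply RtoC_neq; lra.
Qed.

(** * The three explicit formulas *)

Lemma pochhammer_Cfact (k n : nat) :
  pochhammer (INR (S k)) n = Cfact (k + n) / Cfact k.
Proof.
  induction n as [|n IH].
  - rewrite Nat.add_0_r; simpl pochhammer; field; apply Cfact_neq_0.
  - change (pochhammer (INR (S k)) (S n)) with
      (pochhammer (INR (S k)) n * (INR (S k) + INR n)).
    rewrite IH, Nat.add_succ_r, Cfact_S, <- RtoC_plus, <- plus_INR.
    replace (S k + n)%nat with (S (k + n)) by lia.
    unfold Cdiv; ring.
Qed.

(** Equality holds term by term: binom (n+k-1, n-i) / (k)_n = 1 / ((n-i)! (k)_i), and binom (n+l-1,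
    i) / (l)_n = 1 / (i! (l)_(n-i)). *)
Lemma ext_RC_bracket_positive (k l n : nat) (f g : C -> C) (tau : C) :
  (0 < k)%nat -> (0 < l)%nat ->
  ext_RC_bracket k l n f g tau
  = Cfact n / (pochhammer (INR k) n * pochhammer (INR l) n)
    * RC_bracket k l n f g tau.
Proof.
  intros Hk Hl; destruct k as [|k]; [lia|]; destruct l as [|l]; [lia|].
  unfold ext_RC_bracket, RC_bracket; rewrite !sum_n_psum, <- psum_scal.
  apply psum_ext; intros i Hi; unfold mod_deriv; rewrite !binom_Cfact, !pochhammer_Cfact.
  replace (n + S k - 1 - (n - i))%nat with (k + i)%nat by lia.
  replace (n + S l - 1 - i)%nat with (l + (n - i))%nat by lia.
  replace (n + S k - 1)%nat with (k + n)%nat by lia.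
  replace (n + S l - 1)%nat with (l + n)%nat by lia.
  field; repeat split; apply Cfact_neq_0.
Qed.

Lemma ext_RC_bracket_one (l n : nat) (f g : C -> C) (tau : C) :
  f tau = 1 -> (0 < l)%nat ->
  ext_RC_bracket 0 l n f g tau = / pochhammer (INR l) n * Kaneko_Koike l n g tau.
Proof.
  intros Hf Hl; destruct l as [|l]; [lia|].
  unfold ext_RC_bracket; rewrite sum_n_psum.
  destruct n as [|m].
  - cbn [psum]; rewrite binom_Cfact; simpl; rewrite Hf; unfold Cfact; simpl.
    change (Diter 0 g tau) with (g tau); field; apply RtoC_neq; lra.
  - assert (N12 : RtoC 12 <> 0) by (apply RtoC_neq; lra).
    (* The term i = 0 is D^n g / (l)_n; the terms with i >= 1 contain derivatives of E_2 and make up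
       the bracket with E_2. *)
    rewrite psum_first; unfold Kaneko_Koike, RC_bracket.
    rewrite sum_n_psum; unfold Cminus; rewrite Cmult_plus_distr_l; f_equal.
    + rewrite binom_Cfact; unfold mod_deriv; rewrite Nat.sub_0_r, Hf.
      simpl Cpow; simpl mod_deriv_one.
      replace (Cfact 0) with (RtoC 1) by reflexivity.
      field; split; [apply pochhammer_neq_0; lia | apply Cfact_neq_0].
    (* The sum is reversed because [RC_bracket] is indexed by the derivatives of g, whereas the
       extended bracket is indexed by those of its first argument, here E_2. *)
    + transitivity ((- / pochhammer (INR (S l)) (S m) * (INR (S l + S m - 1) / 12) * (-1) ^ m) *
        psum (fun i => (-1) ^ (S m - 1 - i) * binom (m + S l - 1) (m - (S m - 1 - i))
          * binom (m + 2 - 1) (S m - 1 - i) * Diter (S m - 1 - i) g tau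
          * Diter (m - (S m - 1 - i)) E2 tau) (S m));
        [|rewrite (psum_rev (fun i => _ * Diter (m - i) E2 tau)); ring].
      rewrite <- psum_scal; apply psum_ext; intros i Hi.
      replace (S m - 1 - i)%nat with (m - i)%nat by lia.
      replace (m - (m - i))%nat with i by lia.
      replace (S m - S i)%nat with (m - i)%nat by lia.
      unfold mod_deriv; rewrite Hf; simpl mod_deriv_one.
      rewrite !binom_Cfact, !pochhammer_Cfact.
      replace (m + S l - 1 - i)%nat with (l + (m - i))%nat by lia.
      replace (m + S l - 1)%nat with (l + m)%nat by lia.
      replace (m + 2 - 1 - (m - i))%nat with (S i) by lia.
      replace (m + 2 - 1)%nat with (S m) by lia.
      replace (S m - S i)%nat with (m - i)%nat by lia.
      replace (S l + S m - 1)%nat with (S (l + m)) by lia.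
      replace (l + S m)%nat with (S (l + m)) by lia; rewrite (Cfact_S (l + m)).
      (* The factor (-1)^m from [Kaneko_Koike] undoes the change of signs caused by the reversal. *)
      assert (Es : (-1) ^ m * (-1) ^ (m - i) = (-1) ^ i).
      { rewrite <- Cpow_add_r; replace (m + (m - i))%nat with (i + 2 * (m - i))%nat by lia.
        rewrite Cpow_add_r, Cpow_mult_r.
        replace ((-1) ^ 2) with (RtoC 1) by (simpl; rewrite <- !RtoC_mult; f_equal; ring).
        rewrite Cpow_1_l; ring. }
      replace ((-1) ^ S i) with (- ((-1) ^ m * (-1) ^ (m - i))).
      * pose proof (CINR_neq_0 (S (l + m)) ltac:(lia)).
        field; repeat split; auto using Cfact_neq_0.
      * rewrite Es, Cpow_S; generalize ((-1) ^ i); intros x.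
        replace (RtoC (-1)) with (- (1)) by (rewrite <- RtoC_opp; auto); ring.
Qed.

(** Exchange i and n - i. For odd n the sum therefore vanishes. *)
Lemma psum_alternating_square (n : nat) (w : nat -> C) :
  (-1) ^ n * psum (fun i => (-1) ^ i * w i * w (n - i)%nat) (S n)
  = psum (fun i => (-1) ^ i * w i * w (n - i)%nat) (S n).
Proof.
  rewrite (psum_rev _ (S n)) at 2; rewrite <- psum_scal; apply psum_ext; intros i Hi.
  replace (S n - 1 - i)%nat with (n - i)%nat by lia.
  replace (n - (n - i))%nat with i by lia.
  replace ((-1) ^ (n - i)) with ((-1) ^ n * (-1) ^ i); [ring|].
  rewrite <- Cpow_add_r; replace (n + i)%nat with ((n - i) + 2 * i)%nat by lia.
  rewrite Cpow_add_r, Cpow_mult_r.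
  replace ((-1) ^ 2) with (RtoC 1) by (simpl; rewrite <- !RtoC_mult; f_equal; ring).
  rewrite Cpow_1_l; ring.
Qed.

Lemma ext_RC_bracket_one_one (n : nat) (f g : C -> C) (tau : C) :
  f tau = 1 -> g tau = 1 ->
  ext_RC_bracket 0 0 n f g tau
  = / Cfact n * sum_n (fun m => (-1) ^ m * binom n m ^ 2
                            * omega m tau * omega (n - m) tau) n.
Proof.
  intros Hf Hg; rewrite ext_RC_bracket_fps, sum_n_psum.
  assert (Hphi : forall (h : C -> C) i, h tau = 1 -> phi 0 h i tau = omega_factor tau i).
  { intros h i Hh; unfold phi, mod_deriv; rewrite Hh; destruct i as [|m]; simpl.
    - unfold Cfact; simpl; field; apply RtoC_neq; lra.
    - field; repeat split; try apply Cfact_neq_0; apply RtoC_neq; lra. }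
  rewrite (fps_mul_ext _ (fps_alt (omega_factor tau)) _ (omega_factor tau))
    by (intros; unfold fps_alt; cbv beta; rewrite ?(Hphi f), ?(Hphi g) by auto; reflexivity).
  rewrite <- (fps_exp_cancel (- E2 tau / 12)).
  set (W := fps_mul (fps_exp (- E2 tau / 12)) (omega_factor tau)).
  assert (Hsq : forall i, (-1) ^ i * (-1) ^ i = 1).
  { intros i; rewrite <- Cpow_mult_l, <- RtoC_mult.
    replace (-1 * -1)%R with 1%R by ring; apply Cpow_1_l. }
  set (w := fun i => omega i tau / Cfact i ^ 2).
  assert (HW : forall i, W i = (-1) ^ i * w i).
  { intros i; unfold w, omega; fold W.
    transitivity ((-1) ^ i * (-1) ^ i * W i); [rewrite Hsq; ring|].
    pose proof (Cfact_neq_0 i); field; auto. }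
  (* [fps_alt] cancels the sign in the first factor W i and leaves (-1)^(n-i) from the second, hence
     the global (-1)^n, which the symmetry of the sum then removes. *)
  transitivity (Cfact n * ((-1) ^ n * psum (fun i => (-1) ^ i * w i * w (n - i)%nat) (S n))).
  - f_equal; rewrite fps_mul_psum, <- psum_scal; apply psum_ext; intros i Hi.
    unfold fps_alt; rewrite !HW.
    replace ((-1) ^ n) with ((-1) ^ i * (-1) ^ (n - i)) by (rewrite <- Cpow_add_r; f_equal; lia).
    ring.
  - rewrite psum_alternating_square, <- !psum_scal; apply psum_ext; intros i Hi.
    unfold w; rewrite binom_Cfact.
    pose proof (Cfact_neq_0 i); pose proof (Cfact_neq_0 n); pose proof (Cfact_neq_0 (n - i)).
    field; auto.
Qed.

Theorem theorem9 (k l : nat) (f g : C -> C) (Mf : M k f) (Mg : M l g)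
    (n : nat) :
  M (k + l + 2 * n) (ext_RC_bracket k l n f g)
  /\ ((0 < k)%nat -> (0 < l)%nat ->
      forall tau : C, upper_half tau ->
        ext_RC_bracket k l n f g tau
        = Cfact n / (pochhammer (INR k) n * pochhammer (INR l) n)
          * RC_bracket k l n f g tau)
  /\ (k = 0%nat -> (forall tau : C, upper_half tau -> f tau = 1) ->
      (0 < l)%nat ->
      forall tau : C, upper_half tau ->
        ext_RC_bracket k l n f g tau
        = / pochhammer (INR l) n * Kaneko_Koike l n g tau)
  /\ (k = 0%nat -> (forall tau : C, upper_half tau -> f tau = 1) ->
      l = 0%nat -> (forall tau : C, upper_half tau -> g tau = 1) ->
      forall tau : C, upper_half tau ->
        ext_RC_bracket k l n f g tau
        = / Cfact n
          * sum_n (fun m => (-1) ^ m * binom n m ^ 2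
                            * omega m tau * omega (n - m) tau) n).
Proof.
  split; [apply M_ext_RC_bracket; auto|].
  split; [intros; apply ext_RC_bracket_positive; auto|].
  split.
  - intros -> Hf Hl tau Ht; apply ext_RC_bracket_one; auto.
  - intros -> Hf -> Hg tau Ht; apply ext_RC_bracket_one_one; auto.
Qed.
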